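(* (Pieri rules for odd quasisymmetric Schur functions.) Let $\alpha$ be a composition and $n\ge1$. Then in $\mathsf{OQSym}$ $$\mathscr{S}_\alpha\mathscr{S}_{(n)}=\sum_\beta(-1)^{\binom{\tilde\alpha^T}{2}+\binom{\tilde\beta^T}{2}}\,oc_{\tilde\alpha(n)}^{\tilde\beta}\,\mathscr{S}_\beta,$$ where the sum is taken over all compositions $\beta$ such that (1) $\delta=\tilde\beta/\tilde\alpha$ is a horizontal strip of size $n$, and (2) $\mathrm{row}_{S(\delta)}(\beta)=\alpha$. Also, $$\mathscr{S}_\alpha\mathscr{S}_{(1^n)}=\sum_\beta(-1)^{\binom{\tilde\alpha^T}{2}+\binom{\tilde\beta^T}{2}}\,oc_{\tilde\alpha(1^n)}^{\tilde\beta}\,\mathscr{S}_\beta,$$ where the sum is taken over all compositions $\beta$ such that (1) $\epsilon=\tilde\beta/\tilde\alpha$ is a vertical strip of size $n$, and (2) $\mathrm{col}_{M(\epsilon)}(\beta)=\alpha$.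
   Context: **Odd quasisymmetric functions.** Let $k$ be a commutative ring with unity and $A_{-1}=k\langle\langle x_1,x_2,\dots\rangle\rangle/(x_ix_j+x_jx_i,\ i>j)$. For a composition $\alpha=(\alpha_1,\dots,\alpha_r)$, $M_\alpha=\sum_{i_1<\cdots<i_r}x_{i_1}^{\alpha_1}\cdots x_{i_r}^{\alpha_r}$; $F_\alpha=\sum_\beta M_\beta$ over all refinements $\beta$ of $\alpha$ (including $\alpha$). $\mathsf{OQSym}$ is the subalgebra of $A_{-1}$ with basis $\{M_\alpha\}$. **Partitions.** $\tilde\alpha$ is the partition obtained by sorting the parts of $\alpha$ in weakly decreasing order; $\lambda^T$ is the transpose of a partition $\lambda$; $\binom{\lambda}{2}=\sum_i\binom{\lambda_i}{2}$; $NE(\lambda)$ is the number of pairs of boxes $((i,j),(i',j'))$ of $\lambda$ with $i>i'$, $j<j'$. A skew diagram is a horizontal (vertical) strip if no two of its boxes lie in the same column (row); its size is its number of boxes. **Young composition tableaux.** The diagram of $\alpha=(\alpha_1,\dots,\alpha_r)$ has $\alpha_i$ left-justified boxes in row $i$ (rows numbered from the top). A standard Young composition tableau (SYCT) of shape $\alpha\vDash n$ is a bijective filling $\tau$ of the diagram with $1,\dots,n$ such that rows increase left to right, the first column increases from top to bottom, and (triple rule) if $i>j$, boxes $(j,k+1)$ and $(i,k)$ are in $\alpha$, and $\tau(i,k)\le\tau(j,k+1)$, then $(i,k+1)\in\alpha$ and $\tau(i,k+1)<\tau(j,k+1)$. $\mathrm{SYCT}(\alpha)$ is the set of these. $c(\tau)$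 is the composition of $n$ whose set of proper partial sums is the descent set $\{m\in[n-1]: m+1\text{ appears weakly left of }m\text{ in }\tau\}$. $\mathrm{inv}^c(\tau)$ is the number of pairs of boxes $((i,j),(i',j'))$ with $j<j'$ and $\tau(i,j)>\tau(i',j')$. **Odd quasisymmetric Schur function:** $\mathscr{S}_\alpha=(-1)^{NE(\tilde\alpha)}\sum_{\tau\in\mathrm{SYCT}(\alpha)}(-1)^{\mathrm{inv}^c(\tau)}F_{c(\tau)}$. **Coefficients.** $T_\lambda$ is the standard tableau of shape $\lambda$ filled row by row with $1,2,\dots$; for a tableau $T$, $\mathrm{inv}(T)$ is the number of pairs of boxes $((i,j),(i',j'))$ with $i<i'$ and $T(i,j)\ge T(i',j')$; for a standard skew tableau $S$ of shape $\mu/\lambda$, $(T_\lambda)_S$ is the standard tableau of shape $\mu$ obtained by adding $|\lambda|$ to the entries of $S$ and filling $\lambda$ with $T_\lambda$. The odd Littlewood-Richardson number is $oc_{\lambda\mu}^\nu=\sum_S(-1)^{\mathrm{inv}((T_\lambda)_S)}$ over standard $S$ of shape $\nu/\lambda$ whose rectification (by Schützenberger slides) is $T_\mu$, and $0$ if $\lambda\not\subset\nu$. In particular, if $\mu/\lambda$ is a horizontal strip of size $n$, $oc_{\lambda(n)}^\mu=(-1)^{\mathrm{inv}((T_\lambda)_S)}$ with $S$ labelled $1,\dots,n$ from left to right; if $\mu/\lambda$ is a vertical strip of size $n$, $oc_{\lambda(1^n)}^\mu=(-1)^{\mathrm{inv}((T_\lambda)_S)}$ with $S$ labelled $1,\dots,n$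 from top to bottom. **Operators.** Let $\alpha=(\alpha_1,\dots,\alpha_r)$ have largest part $m$, and let $s\in[m]$. If there is $1\le i\le r$ with $\alpha_i=s$ and $\alpha_j\ne s$ for all $j<i$, put $\mathrm{rem}_s(\alpha)=(\alpha_1,\dots,\alpha_{i-1},s-1,\alpha_{i+1},\dots,\alpha_r)$; otherwise $\mathrm{rem}_s(\alpha)=\emptyset$. For $S=\{s_1<\cdots<s_j\}$, $\mathrm{row}_S(\alpha)=\mathrm{rem}_{s_1}(\cdots(\mathrm{rem}_{s_{j-1}}(\mathrm{rem}_{s_j}(\alpha)))\cdots)$. For a multiset $M=\{m_1\le\cdots\le m_j\}$, $\mathrm{col}_M(\alpha)=\mathrm{rem}_{m_j}(\cdots(\mathrm{rem}_{m_2}(\mathrm{rem}_{m_1}(\alpha)))\cdots)$. Zeros are removed from $\mathrm{row}_S(\alpha)$ and $\mathrm{col}_M(\alpha)$ to obtain a composition if necessary. $S(\delta)$ is the set of columns occupied by a horizontal strip $\delta$; $M(\epsilon)$ is the multiset of columns occupied by a vertical strip $\epsilon$ (a column counted once for each box of $\epsilon$ in it).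
   Formalization: The second formula is proved with an additional factor (-1)^{binom(n,2)} on the right-hand side; as printed it fails by a global sign, e.g. for α=(1), n=2, where the product is S_(111)+S_(21)+S_(12) but the printed sum is its negative. *)

(* Defs.v *)
(* MathComp, with classical reasoning and pointwise function spaces from
   MathComp-Analysis. *)
From HB Require Import structures.
From mathcomp Require Import all_boot all_order all_algebra.
From mathcomp Require Import generic_quotient ring_quotient.
From mathcomp Require Import boolp functions.

Set Implicit Arguments.
Unset Strict Implicit.
Unset Printing Implicit Defensive.

Import GRing.Theory.

(* Conventions: compositions and partitions are sequences of positive naturals
   (the empty composition, of 0, is allowed).  Rows, columns and variables are
   numbered from 0 (so that row i of the text is row i.-1 here), except in the
   column sets S(delta) and M(epsilon), where columns keep their numbering
   from 1 because they are compared with parts of compositions. *)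

(******************************************************************************)
(* The ring A_{-1} = k<<x_0, x_1, ...>> / (x_i x_j + x_j x_i, i > j)          *)
(******************************************************************************)

(* A series in noncommuting variables: its coefficient at the word
   x_{i_1} ... x_{i_m} is its value at [:: i_1; ...; i_m]. *)
Definition ncseries (k : comPzRingType) := seq nat -> k.

Section NCSeries.
Variable k : comPzRingType.
Local Open Scope ring_scope.

HB.instance Definition _ := GRing.Zmodule.copy (ncseries k) (seq nat -> k).

Definition ncone : ncseries k := fun w => (w == [::])%:R.

Definition ncmul (f g : ncseries k) : ncseries k :=
  fun w => \sum_(i < (size w).+1) f (take i w) * g (drop i w).

Lemma ncmul_nil f g : ncmul f g [::] = f [::] * g [::].
Proof. by rewrite /ncmul big_ord1. Qed.

Lemma ncmul_cons f g a w :
  ncmul f g (a :: w) = f [::] * g (a :: w) + ncmul (fun v => f (a :: v)) g w.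
Proof. by rewrite /ncmul big_ord_recl. Qed.

Lemma ncmulDl : left_distributive ncmul +%R.
Proof.
move=> f g h; apply/funext => w.
rewrite -[RHS]/(ncmul f h w + ncmul g h w) /ncmul -big_split /=.
by apply: eq_bigr => i _; rewrite -mulrDl.
Qed.

Lemma ncmulDr : right_distributive ncmul +%R.
Proof.
move=> f g h; apply/funext => w.
rewrite -[RHS]/(ncmul f g w + ncmul f h w) /ncmul -big_split /=.
by apply: eq_bigr => i _; rewrite -mulrDr.
Qed.

Lemma ncmulZl c (f g : ncseries k) w :
  ncmul (fun v => c * f v) g w = c * ncmul f g w.
Proof. by rewrite /ncmul big_distrr /=; apply: eq_bigr => i _; rewrite mulrA. Qed.

Lemma ncmulA : associative ncmul.
Proof.
move=> f g h; apply/funext => w; elim: w f g h => [|a w IHw] f g h.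
  by rewrite !ncmul_nil mulrA.
rewrite !ncmul_cons IHw ncmul_nil mulrDr mulrA -addrA; congr (_ + _).
rewrite -ncmulZl.
have -> : (fun v => ncmul f g (a :: v)) =
   (fun v => f [::] * g (a :: v)) + ncmul (fun v => f (a :: v)) g :> ncseries k.
  by apply/funext => v; rewrite ncmul_cons.
by rewrite ncmulDl.
Qed.

Lemma ncmul1f : left_id ncone ncmul.
Proof.
move=> f; apply/funext => w; rewrite /ncmul big_ord_recl /= take0 drop0.
rewrite mul1r big1 ?addr0 // => i _; rewrite /ncone.
by case: w i => [[]|a w i] //=; rewrite mul0r.
Qed.

Lemma ncmulf1 : right_id ncone ncmul.
Proof.
move=> f; apply/funext => w; rewrite /ncmul big_ord_recr /= take_size drop_size.
rewrite mulr1 big1 ?add0r // => i _; rewrite /ncone.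
by rewrite -size_eq0 size_drop subn_eq0 leqNgt ltn_ord mulr0.
Qed.

HB.instance Definition _ := GRing.Zmodule_isPzRing.Build (ncseries k)
  ncmulA ncmul1f ncmulf1 ncmulDl ncmulDr.

Definition ncvar (i : nat) : ncseries k := fun w => (w == [:: i])%:R.

Inductive anticomm_ideal : ncseries k -> Prop :=
| anticomm_rel i j : (j < i)%N ->
    anticomm_ideal (ncvar i * ncvar j + ncvar j * ncvar i)
| anticomm0 : anticomm_ideal 0
| anticommD f g :
    anticomm_ideal f -> anticomm_ideal g -> anticomm_ideal (f + g)
| anticommMl f g : anticomm_ideal g -> anticomm_ideal (f * g)
| anticommMr f g : anticomm_ideal f -> anticomm_ideal (f * g).

(* Ideals of a formal power series ring are closed ideals: the closure is for
   coefficientwise convergence, a neighbourhood being given by finitely many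
   words. *)
Definition anticomm_closure : {pred ncseries k} := fun f =>
  `[< forall s : seq (seq nat),
        exists2 g, anticomm_ideal g & {in s, f =1 g} >].

Lemma anticomm_closureP (f : ncseries k) :
  reflect (forall s : seq (seq nat),
             exists2 g, anticomm_ideal g & {in s, f =1 g})
          (f \in anticomm_closure).
Proof. exact: asboolP. Qed.

Lemma anticomm_closure_zmod : zmod_closed anticomm_closure.
Proof.
split=> [|f g /anticomm_closureP If /anticomm_closureP Ig].
  by apply/anticomm_closureP => s; exists 0 => //; apply: anticomm0.
apply/anticomm_closureP => s; have [f' If' ff'] := If s.
have [g' Ig' gg'] := Ig s; exists (f' - g') => [|w sw].
  by apply: anticommD => //; rewrite -mulN1r; apply: anticommMl.
by rewrite /GRing.add /GRing.opp /= ff' // gg'.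
Qed.

HB.instance Definition _ := GRing.isZmodClosed.Build (ncseries k)
  anticomm_closure anticomm_closure_zmod.

Lemma anticomm_closureMl (f g : ncseries k) :
  g \in anticomm_closure -> f * g \in anticomm_closure.
Proof.
move=> /anticomm_closureP Ig; apply/anticomm_closureP => s.
have [g' Ig' gg'] := Ig [seq drop i w | w <- s, i <- iota 0 (size w).+1].
exists (f * g') => [|w sw]; first exact: anticommMl.
apply: eq_bigr => i _; congr (_ * _); apply: gg'; apply/allpairsPdep.
by exists w, (nat_of_ord i); split=> //; rewrite mem_iota ltn_ord.
Qed.

Lemma anticomm_closureMr (f g : ncseries k) :
  f \in anticomm_closure -> f * g \in anticomm_closure.
Proof.
move=> /anticomm_closureP If; apply/anticomm_closureP => s.
have [f' If' ff'] := If [seq take i w | w <- s, i <- iota 0 (size w).+1].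
exists (f' * g) => [|w sw]; first exact: anticommMr.
apply: eq_bigr => i _; congr (_ * _); apply: ff'; apply/allpairsPdep.
by exists w, (nat_of_ord i); split=> //; rewrite mem_iota ltn_ord.
Qed.

End NCSeries.

Definition skewseries (k : comPzRingType) :=
  Quotient.quot (@anticomm_closure k).

Section SkewSeries.
Variable k : comPzRingType.
Local Open Scope ring_scope.
Local Open Scope quotient_scope.

Local Notation A := (skewseries k).

HB.instance Definition _ := GRing.Zmodule.on A.

Definition skew_pi (f : ncseries k) : A := \pi_A f.

Definition skewone : A := skew_pi 1.
Definition skewmul (x y : A) : A := skew_pi (repr x * repr y).

Lemma skew_piP (f g : ncseries k) :
  skew_pi f = skew_pi g <-> f - g \in @anticomm_closure k.
Proof. by rewrite (Quotient.idealrBE (@anticomm_closure k)); split=> /eqP. Qed.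

Lemma skew_repr (x : A) : skew_pi (repr x) = x.
Proof. exact: reprK. Qed.

Lemma skew_piD : {morph skew_pi : f g / f + g}.
Proof. by move=> f g; rewrite /skew_pi !piE. Qed.

Lemma skew_piM f g : skew_pi (f * g) = skewmul (skew_pi f) (skew_pi g).
Proof.
apply/skew_piP; set f' := repr (skew_pi f); set g' := repr (skew_pi g).
have -> : f * g - f' * g' = (f - f') * g + f' * (g - g').
  by rewrite mulrBl mulrBr addrA subrK.
by apply: rpredD; [apply: anticomm_closureMr | apply: anticomm_closureMl];
  apply/skew_piP; rewrite skew_repr.
Qed.

Lemma skewmulA : associative skewmul.
Proof.
move=> x y z; rewrite -[x]skew_repr -[y]skew_repr -[z]skew_repr.
by rewrite -!skew_piM mulrA.
Qed.

Lemma skewmul1l : left_id skewone skewmul.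
Proof. by move=> x; rewrite -[x]skew_repr -skew_piM mul1r. Qed.

Lemma skewmul1r : right_id skewone skewmul.
Proof. by move=> x; rewrite -[x]skew_repr -skew_piM mulr1. Qed.

Lemma skewmulDl : left_distributive skewmul +%R.
Proof.
move=> x y z; rewrite -[x]skew_repr -[y]skew_repr -[z]skew_repr.
by rewrite -skew_piD -!skew_piM -skew_piD mulrDl.
Qed.

Lemma skewmulDr : right_distributive skewmul +%R.
Proof.
move=> x y z; rewrite -[x]skew_repr -[y]skew_repr -[z]skew_repr.
by rewrite -skew_piD -!skew_piM -skew_piD mulrDr.
Qed.

HB.instance Definition _ := GRing.Zmodule_isPzRing.Build A
  skewmulA skewmul1l skewmul1r skewmulDl skewmulDr.

Lemma skew_pi_zmod_morphism : zmod_morphism skew_pi.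
Proof. by move=> f g; rewrite /skew_pi !piE. Qed.

Lemma skew_pi_monoid_morphism : monoid_morphism skew_pi.
Proof. by split=> // f g; rewrite skew_piM. Qed.

HB.instance Definition _ := GRing.isZmodMorphism.Build (ncseries k) A
  skew_pi skew_pi_zmod_morphism.
HB.instance Definition _ := GRing.isMonoidMorphism.Build (ncseries k) A
  skew_pi skew_pi_monoid_morphism.

Lemma skew_pi_anticomm i j : (j < i)%N ->
  skew_pi (ncvar k i) * skew_pi (ncvar k j) +
  skew_pi (ncvar k j) * skew_pi (ncvar k i) = 0.
Proof.
move=> ji; rewrite -!rmorphM -rmorphD -(rmorph0 skew_pi); apply/skew_piP.
rewrite subr0; apply/anticomm_closureP => s.
by exists (ncvar k i * ncvar k j + ncvar k j * ncvar k i) => //;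
  apply: anticomm_rel.
Qed.

End SkewSeries.

(******************************************************************************)
(* Compositions, partitions and diagrams                                      *)
(******************************************************************************)

Definition is_comp (a : seq nat) : bool := all (ltn 0) a.

Fixpoint compositions (n : nat) : seq (seq nat) :=
  if n is m.+1 then
    [seq 1 :: c | c <- compositions m] ++
    [seq (head 0 c).+1 :: behead c | c <- compositions m & c != [::]]
  else [:: [::]].

Lemma mem_compositions n a :
  (a \in compositions n) = is_comp a && (sumn a == n).
Proof.
elim: n a => [|n IHn] a /=.
  by rewrite inE; case: a => [|[|x] a] //=; rewrite addSn andbF.
rewrite mem_cat; apply/orP/andP.
  case=> /mapP[c]; first by rewrite IHn => /andP[hc /eqP<-] -> /=.
  rewrite mem_filter IHn; case: c => //= x c /andP[/andP[_ hc] /eqP<-] -> /=.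
  by rewrite hc.
case: a => [|[|[|x]] a] [] //= ha; rewrite addSn eqSS => /eqP an.
  by left; apply/mapP; exists a => //; rewrite IHn ha -an add0n eqxx.
right; apply/mapP; exists (x.+1 :: a) => //.
by rewrite mem_filter /= IHn /= (_ : is_comp _ = true) //= -an addSn eqxx.
Qed.

Lemma compositions_uniq n : uniq (compositions n).
Proof.
elim: n => [|n IHn] //=; rewrite cat_uniq; apply/and3P; split.
- by rewrite map_inj_uniq // => c d [].
- apply/hasPn => b /mapP[c]; rewrite mem_filter mem_compositions => hc ->.
  by apply/negP => /mapP[d _]; case: c hc => //= -[|x] c.
- rewrite map_inj_in_uniq ?filter_uniq // => c d.
  by rewrite !mem_filter; case: c d => [|x c] [|y d] //= _ _ [-> ->].
Qed.

Definition refines (b a : seq nat) : Prop :=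
  exists2 bs : seq (seq nat), flatten bs = b & map sumn bs = a.

Definition tilde (a : seq nat) : seq nat := sort geq a.

Definition transpose (la : seq nat) : seq nat :=
  [seq count (ltn j) la | j <- iota 0 (head 0 la)].

Definition binom2 (la : seq nat) : nat := \sum_(l <- la) 'C(l, 2).

Definition included (la mu : seq nat) : bool :=
  all (fun i => nth 0 la i <= nth 0 mu i) (iota 0 (size la)).

(* The boxes (row, column) of mu / la. *)
Definition skew_boxes (mu la : seq nat) : seq (nat * nat) :=
  [seq (i, j) | i <- iota 0 (size mu),
                j <- iota (nth 0 la i) (nth 0 mu i - nth 0 la i)].

Definition boxes (a : seq nat) : seq (nat * nat) := skew_boxes a [::].

Definition count_pairs (P : nat * nat -> nat * nat -> bool)
    (s : seq (nat * nat)) : nat :=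
  count (fun p => P p.1 p.2) [seq (b, c) | b <- s, c <- s].

Definition NE (la : seq nat) : nat :=
  count_pairs (fun b c => (c.1 < b.1) && (b.2 < c.2)) (boxes la).

Definition horizontal_strip (n : nat) (mu la : seq nat) : bool :=
  [&& included la mu, uniq [seq b.2 | b <- skew_boxes mu la]
    & size (skew_boxes mu la) == n].

Definition vertical_strip (n : nat) (mu la : seq nat) : bool :=
  [&& included la mu, uniq [seq b.1 | b <- skew_boxes mu la]
    & size (skew_boxes mu la) == n].

(* The columns, numbered from 1, of the boxes of mu / la: a sorted sequence
   which represents both the set S(delta) of a horizontal strip (without
   repetition) and the multiset M(epsilon) of a vertical strip. *)
Definition strip_columns (mu la : seq nat) : seq nat :=
  sort leq [seq b.2.+1 | b <- skew_boxes mu la].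

(* None stands for the value "emptyset" of the text, which is not the empty
   composition. *)
Definition rem_part (s : nat) (a : seq nat) : option (seq nat) :=
  if s \in a then Some (set_nth 0 a (index s a) s.-1) else None.

Definition drop_zeros (a : seq nat) : seq nat := [seq x <- a | 0 < x].

Definition row_op (S : seq nat) (a : seq nat) : option (seq nat) :=
  omap drop_zeros (foldr (fun s => obind (rem_part s)) (Some a) S).

Definition col_op (M : seq nat) (a : seq nat) : option (seq nat) :=
  omap drop_zeros (foldl (fun a s => obind (rem_part s) a) (Some a) M).

(******************************************************************************)
(* Tableaux, as sequences of rows                                             *)
(******************************************************************************)

Definition entry (T : seq (seq nat)) (i j : nat) : nat :=
  nth 0 (nth [::] T i) j.

Definition fillings (a : seq nat) : seq (seq (seq nat)) :=
  [seq reshape a w | w <- permutations (iota 1 (sumn a))].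

Definition is_SYCT (a : seq nat) (T : seq (seq nat)) : Prop :=
  [/\ all (sorted ltn) T,
      sorted ltn [seq entry T i 0 | i <- iota 0 (size a)]
    & forall i j l, j < i -> (j, l.+1) \in boxes a -> (i, l) \in boxes a ->
        entry T i l <= entry T j l.+1 ->
        (i, l.+1) \in boxes a /\ entry T i l.+1 < entry T j l.+1].

Definition SYCT (a : seq nat) : seq (seq (seq nat)) :=
  [seq T <- fillings a | `[< is_SYCT a T >]].

Definition column_of (T : seq (seq nat)) (m : nat) : nat :=
  reshape_offset (shape T) (index m (flatten T)).

Definition descents (T : seq (seq nat)) : seq nat :=
  [seq m <- iota 1 (size (flatten T)).-1 | column_of T m.+1 <= column_of T m].

(* The composition of n whose proper partial sums are the elements of D. *)
Definition comp_of_descents (n : nat) (D : seq nat) : seq nat :=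
  if n == 0 then [::] else pairmap (fun a b => b - a) 0 (rcons D n).

Definition desc_comp (T : seq (seq nat)) : seq nat :=
  comp_of_descents (size (flatten T)) (descents T).

Definition col_inv (T : seq (seq nat)) : nat :=
  count_pairs (fun b c => (b.2 < c.2) && (entry T c.1 c.2 < entry T b.1 b.2))
    (boxes (shape T)).

Definition row_inv (T : seq (seq nat)) : nat :=
  count_pairs (fun b c => (b.1 < c.1) && (entry T c.1 c.2 <= entry T b.1 b.2))
    (boxes (shape T)).

(* T_la *)
Definition row_tableau (la : seq nat) : seq (seq nat) :=
  reshape la (iota 1 (sumn la)).

(* A tableau of shape nu / la is the sequence of its rows, the i-th of them
   starting in column la_i. *)
Definition skew_shape (nu la : seq nat) : seq nat :=
  [seq nth 0 nu i - nth 0 la i | i <- iota 0 (size nu)].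

(* The value 0 marks the unoccupied positions. *)
Definition skew_entry (la : seq nat) (S : seq (seq nat)) (i j : nat) : nat :=
  if j < nth 0 la i then 0 else entry S i (j - nth 0 la i).

Definition is_skew_SYT (nu la : seq nat) (S : seq (seq nat)) : Prop :=
  all (sorted ltn) S /\
  forall i j, (i, j) \in skew_boxes nu la -> (i.+1, j) \in skew_boxes nu la ->
    skew_entry la S i j < skew_entry la S i.+1 j.

Definition skew_SYT (nu la : seq nat) : seq (seq (seq nat)) :=
  [seq S <- fillings (skew_shape nu la) | `[< is_skew_SYT nu la S >]].

(* (T_la)_S *)
Definition adjoin (la : seq nat) (S : seq (seq nat)) : seq (seq nat) :=
  [seq nth [::] (row_tableau la) i ++ map (addn (sumn la)) (nth [::] S i)
  | i <- iota 0 (size S)].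

(* Moves the entry in box c to the empty box b. *)
Definition move_entry (f : nat -> nat -> nat) (b c : nat * nat) :
    nat -> nat -> nat :=
  fun i j => if (i, j) == b then f c.1 c.2 else if (i, j) == c then 0 else f i j.

(* [slide i j f g]: the Schutzenberger slide of f into the empty box (i, j)
   gives g. *)
Inductive slide :
    nat -> nat -> (nat -> nat -> nat) -> (nat -> nat -> nat) -> Prop :=
| slide_stop i j f : f i j.+1 = 0 -> f i.+1 j = 0 -> slide i j f f
| slide_right i j f g :
    0 < f i j.+1 -> (f i.+1 j == 0) || (f i j.+1 < f i.+1 j) ->
    slide i j.+1 (move_entry f (i, j) (i, j.+1)) g -> slide i j f g
| slide_down i j f g :
    0 < f i.+1 j -> (f i j.+1 == 0) || (f i.+1 j < f i j.+1) ->
    slide i.+1 j (move_entry f (i, j) (i.+1, j)) g -> slide i j f g.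

(* [rectifies la f g]: slides into corners of the inner shape la lead from f
   to g, of straight shape.  The result does not depend on the slides. *)
Inductive rectifies :
    seq nat -> (nat -> nat -> nat) -> (nat -> nat -> nat) -> Prop :=
| rectifies_straight la f : sumn la = 0 -> rectifies la f f
| rectifies_slide la i j f g h :
    nth 0 la i = j.+1 -> nth 0 la i.+1 <= j -> slide i j f g ->
    rectifies (set_nth 0 la i j) g h -> rectifies la f h.

Definition has_rectification (la : seq nat) (S T : seq (seq nat)) : Prop :=
  exists2 f, rectifies la (skew_entry la S) f & forall i j, f i j = entry T i j.

Local Open Scope ring_scope.

(* oc_{la mu}^nu *)
Definition oddLR (la mu nu : seq nat) : int :=
  if included la nu then
    \sum_(S <- skew_SYT nu la | `[< has_rectification la S (row_tableau mu) >])
      (-1) ^+ row_inv (adjoin la S)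
  else 0.

(******************************************************************************)
(* Odd quasisymmetric functions, as elements of A_{-1}                        *)
(******************************************************************************)

(* Each word occurs at most once in M_a, as the parts of a are positive. *)
Definition OQ_monomial (k : comPzRingType) (a : seq nat) : skewseries k :=
  skew_pi (fun w : seq nat =>
    `[< exists2 s : seq nat, sorted ltn s /\ size s = size a
          & w = flatten [seq nseq p.1 p.2 | p <- zip a s] >]%:R).

Definition OQ_fundamental (k : comPzRingType) (a : seq nat) : skewseries k :=
  \sum_(b <- compositions (sumn a) | `[< refines b a >]) OQ_monomial k b.

Definition OQ_schur (k : comPzRingType) (a : seq nat) : skewseries k :=
  (-1) ^+ NE (tilde a) *
  \sum_(T <- SYCT a) (-1) ^+ col_inv T * OQ_fundamental k (desc_comp T).

(* For a product with S_(mu) the complete sign also has the factor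
   (-1)^{binom(mu^T, 2)}, which is 1 for mu = (n) but (-1)^{'C(n, 2)} for
   mu = (1^n).  For instance, with S_(1) = M_1 and S_(11) = M_11,
     S_(1) S_(11) = M_111 + M_21 - M_12 = S_(111) + S_(21) + S_(12)
   while pieri_sign is -1 for these three terms, and the odd
   Littlewood-Richardson numbers are 1. *)
Definition pieri_sign (a b : seq nat) : int :=
  (-1) ^+ (binom2 (transpose (tilde a)) + binom2 (transpose (tilde b))).

(* Main.v *)
Require Import Defs.
From mathcomp Require Import all_boot all_order all_algebra zify boolp.

(** In a standard Young composition tableau the row of the largest entry is
    determined by its column, so that a tableau is nothing but the word of the
    columns of its entries, read from the largest down; such a word builds the
    shape box by box ([mem_words]).  In these terms the fundamental function of a
    tableau is a sum over weakly increasing words, those for which the columns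
    and the letters form a biword sorted strictly ([OQ_fundamental_column_word]),
    and the column inversions are pairs of increasing letters of the column
    word.  The functions of the one-row and one-column shapes are sums over
    weakly and strictly increasing words; up to the sign of ['C(n, 2)]
    transpositions the latter may be taken strictly decreasing
    ([skew_incr_decr]).

    In the skew ring each series is equal to a signed sum over sorted words
    ([skew_pi_normal_form]).  The coefficient of a sorted word in the product is
    then a signed sum over the pairs of a biword, whose column word has shape
    [alpha], and a monotone word with [n] letters.  The letters of the second
    word are inserted into the biword, as in the Robinson-Schensted-Knuth
    correspondence.  An insertion is assembled from squares of a local growth rule
    for compositions ([local_rule]): it adds one box to the shape, and each larger
    letter that is passed either stays as it is or moves together with the box.  Four
    properties of the local rule extend to insertions.  The rule is invertible,
    hence insertion is a bijection; it keeps biwords sorted; it turns weakly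
    increasing letters into strictly increasing columns of added boxes, and
    strictly decreasing letters into weakly decreasing columns ([insert_order]);
    and the number of increasing pairs of the column word changes, modulo 2, by the
    number of letters that have been passed, which is the sign of sorting, and by
    the number of boxes of the old shape weakly to the right of the added one
    ([insert_parity]).  Since a monotone chain of
    removals from [beta] to [alpha] is determined by the two shapes, the product
    is a sum with one signed term for each [beta] that admits such a chain
    ([schur_product_expansion]).  These chains are the removals in the conditions
    on [beta] ([horizontal_chain], [vertical_chain]).

    The sign remains.  Slides preserve the descents of a standard skew tableau,
    because consecutive values are in one of two relative positions, one of which
    depends on rows only and the other on columns only ([move_descent]).  The
    straight tableau with one row is the only one without descents, and the one
    with one column is the only one with all of them.  So the odd
    Littlewood-Richardson number of a horizontal or vertical strip has a single
    term, given by the labelling from left to right or from top to bottom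
    ([oddLR_row], [oddLR_col]).  Comparing its inversions with the boxes to the
    right of the boxes removed is a count of pairs of boxes, in which the
    binomials of the column heights account for pairs in the same column
    ([parity_row], [parity_col]). *)

Set Implicit Arguments.
Unset Strict Implicit.
Unset Printing Implicit Defensive.
Import GRing.Theory.

(** * Adding and removing boxes of a composition *)

Fixpoint up_pos (k : nat) (a : seq nat) : option (seq nat) :=
  if a is x :: a' then
    if up_pos k a' is Some b then Some (x :: b)
    else if x == k then Some (k.+1 :: a') else None
  else None.

(** The box that a new largest entry occupies in a Young composition tableau:
    the triple rule forces the entry to extend the lowest row among those of
    length [k], and a new row can only be placed at the bottom.  Columns are
    numbered from 0 here, so [k] is both that length and the column of the
    new box. *)
Definition up (k : nat) (a : seq nat) : option (seq nat) :=
  if k == 0 then Some (rcons a 1) else up_pos k a.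

(** The box removal rem at the part [c.+1], a part that vanishes being deleted
    at once. *)
Fixpoint down (c : nat) (a : seq nat) : option (seq nat) :=
  if a is x :: a' then
    if x == c.+1 then Some (if c == 0 then a' else c :: a')
    else omap (cons x) (down c a')
  else None.

Lemma up_pos_None k a : (up_pos k a == None) = (k \notin a).
Proof.
elim: a => //= x a IHa; rewrite inE negb_or -IHa.
case: (up_pos k a) => [b|] /=; first by rewrite andbF.
by rewrite andbT [k == x]eq_sym; case: (x == k).
Qed.

Lemma down_None c a : (down c a == None) = (c.+1 \notin a).
Proof.
elim: a => //= x a IHa; rewrite inE negb_or -IHa.
by rewrite [_ == x]eq_sym; case: (x == _); case: (down c a).
Qed.

Lemma up_def k a : (k == 0) || (k \in a) -> exists b, up k a = Some b.
Proof.
rewrite /up; case: eqP => [_ _|_ /= ka]; first by eexists.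
by move: (up_pos_None k a); rewrite ka; case: (up_pos k a) => // b _; exists b.
Qed.

Lemma up_mem k a b : up k a = Some b -> (k == 0) || (k \in a).
Proof.
rewrite /up; case: eqP => //= _ ab; move: (up_pos_None k a).
by rewrite ab; case: (k \in a).
Qed.

Lemma down_def c a : c.+1 \in a -> exists b, down c a = Some b.
Proof.
by move=> ca; move: (down_None c a); rewrite ca; case: (down c a) => // b _; exists b.
Qed.

Lemma down_mem c a b : down c a = Some b -> c.+1 \in a.
Proof. by move=> ab; move: (down_None c a); rewrite ab; case: (c.+1 \in a). Qed.

Lemma up_pos_count k a b : up_pos k a = Some b ->
  forall p : pred nat, count p b + p k = count p a + p k.+1.
Proof.
elim: a b => //= x a IHa b; case E: (up_pos k a) => [d|]; first last.
  by case: eqP => // -> [<-] p /=; lia.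
by case=> <- p /=; have := IHa _ E p; lia.
Qed.

Lemma up_count k a b : up k a = Some b -> forall p : pred nat, ~~ p 0 ->
  count p b + p k = count p a + p k.+1.
Proof.
rewrite /up; case: eqP => [-> [<-] p /negbTE ->|_ /up_pos_count ab p _ //].
by rewrite -cats1 count_cat /=; lia.
Qed.

Lemma down_count c a b : down c a = Some b -> forall p : pred nat, ~~ p 0 ->
  count p a + p c = count p b + p c.+1.
Proof.
elim: a b => //= x a IHa b; case: eqP => [->|_] /=.
  case: eqP => [-> [<-] p /negbTE->|_ [<-] p _] /=; do 2!case: (p _) => /=; rewrite ?addn0 ?add0n ?add1n ?addn1 //.
case E: (down c a) => [d|] //= [<-] p p0 /=; have := IHa _ E p p0; lia.
Qed.

Lemma down_memE c a b : down c a = Some b -> forall x, 0 < x -> x != c.+1 ->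
  (x \in b) = (x == c) || (x \in a).
Proof.
move=> ab x x0 xk; have /= := down_count ab (p := pred1 x).
rewrite -!has_pred1 !has_count ![_ == x]eq_sym (negPf xk) addn0 -lt0n => <-//.
by rewrite addnC; case: (x == _).
Qed.

Lemma up_in k a b : up k a = Some b -> k.+1 \in b.
Proof.
move=> ab; have /= := up_count ab (p := pred1 k.+1).
rewrite -has_pred1 has_count eqxx eqn_leq ltnn andbF addn0 addn1 => -> //.
Qed.

Lemma down_in c a b : down c a = Some b -> (c == 0) || (c \in b).
Proof.
case: c => //= c ab; have /= := down_count ab (p := pred1 c.+1).
rewrite -has_pred1 has_count eqxx [_ == c.+1]eqn_leq ltnn /= addn0 addn1.
by move=> <-.
Qed.

Lemma up_comp k a b : up k a = Some b -> is_comp a -> is_comp b.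
Proof.
move=> ab; rewrite /is_comp !all_count => /eqP ha; have := up_count ab (p := ltn 0).
have := count_size (ltn 0) b; have : size b = size a + (k == 0); last first.
  move=> -> ; rewrite ha /=; case: eqP; lia.
move: ab; rewrite /up; case: eqP => [_ [<-]|_]; first by rewrite size_rcons addn1.
by move=> /up_pos_count /(_ predT); rewrite !count_predT /=; lia.
Qed.

Lemma up_sumn k a b : up k a = Some b -> sumn b = (sumn a).+1.
Proof.
rewrite /up; case: eqP => [_ [<-]|_]; first by rewrite -cats1 sumn_cat /=; lia.
elim: a b => //= x a IHa b; case E: (up_pos k a) => [d|].
  by case=> <- /=; rewrite (IHa _ E); lia.
by case: eqP => // -> [<-] /=; lia.
Qed.

Lemma down_sumn c a b : down c a = Some b -> sumn a = (sumn b).+1.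
Proof.
elim: a b => //= x a IHa b; case: eqP => [->|_].
  by case: eqP => [->|_] [<-] /=; lia.
by case E: (down c a) => [d|] //= [<-] /=; rewrite (IHa _ E); lia.
Qed.

(** A part that one of the operators creates could be consumed by the other only
    if [k = c].  If they consume parts of the same length, [up k] takes the last
    one and [down c] the first one, and with a single such part both sides
    fail. *)
Lemma down_up_commute c k b : k != c ->
  obind (down c) (up k b) = obind (up k) (down c b).
Proof.
rewrite /up; case: (eqVneq k 0) => [-> c0|k0 kc].
  have {}c0 : c != 0 by rewrite eq_sym.
  elim: b => /= [|x b IHb]; first by rewrite ifN //; lia.
  rewrite IHb; case: eqP => [_|_] /=; first by rewrite (negPf c0).
  by case: (down c b).
elim: b => //= x b IHb.
case U: (up_pos k b) IHb => [b1|] /= IHb.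
  case: eqP => [xc|xc] /=.
    by case: eqP => [_|c0] /=; rewrite U.
  rewrite IHb; case D: (down c b) => [d|] //=.
  case U': (up_pos k d) => [d'|] //=; rewrite ifN //.
  have kb : k \in b.
    by move: (up_pos_None k b); rewrite U; case: (k \in b).
  have kd : k \notin d by rewrite -up_pos_None U'.
  apply: contra kd => /eqP xk.
  by rewrite (down_memE D) ?kb ?orbT ?lt0n // -xk; apply/eqP.
have kb : k \notin b by rewrite -up_pos_None U.
case: (eqVneq x k) => [->|xk] /=.
  rewrite eqSS (negPf kc); case: (eqVneq k c.+1) => [kc1|kc1] /=.
    case D: (down c b) => [d|] /=; first by rewrite kc1 (down_mem D) in kb.
    case: eqP => [c0|c0] /=; rewrite U //.
    by rewrite eq_sym (negPf kc).
  case D: (down c b) IHb => [d|] //= /esym ->; by rewrite eqxx.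
case: (eqVneq x c.+1) => [kc1|kc1] /=.
  by case: eqP => [c0|c0] /=; rewrite U // eq_sym (negPf kc).
by case D: (down c b) IHb => [d|] //= /esym ->; rewrite (negPf xk).
Qed.

(** If the first part [c.+1] comes before the last part [c], the operators act on
    these two parts in either order; otherwise each of them undoes the other. *)
Lemma down_up_same c b b' : c.+1 \in b -> up c b = Some b' ->
  down c b' = obind (up c) (down c b).
Proof.
rewrite /up; case: eqP => [->|c0].
  move=> + [<-]; elim: b => //= x b IHb; rewrite inE eq_sym.
  by case: eqP => //= _ /IHb ->; case: (down 0 b).
elim: b b' => //= x b IHb b'; rewrite inE eq_sym.
case: eqP => [->|xc] /= cb.
  case U: (up_pos c b) => [b1|] //=; last by rewrite ifN //; lia.
  by case=> <- /=; rewrite eqxx (introF eqP c0) /= U.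
have cb' := cb; rewrite -[_ \in _]negbK -down_None in cb'.
case U: (up_pos c b) => [b1|] //=.
  case=> <- /=; rewrite (introF eqP xc) (IHb _ cb U).
  case D: (down c b) cb' => [d|] //= _.
  have cd : c \in d by move: (down_in D) => /orP[/eqP|].
  by move: (up_pos_None c d); rewrite cd; case: (up_pos c d).
case: eqP => // -> [<-] /=; rewrite eqxx (introF eqP c0).
have cnb : c \notin b by rewrite -up_pos_None U.
elim: b {IHb U cb} cnb cb' => //= y b IHb; rewrite inE negb_or => /andP[cy cb].
case: (eqVneq y c.+1) => [-> _ |yc] /=.
  rewrite (introF eqP c0) /= eqxx; move: (up_pos_None c b).
  by rewrite cb => /eqP ->.
case D: (down c b) IHb => [d|] //= /(_ cb isT) + _; rewrite [y == c]eq_sym (negPf cy).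
by case: (up_pos c d) => [e [->]|] //=; rewrite eqxx => -[]; lia.
Qed.

Lemma down_up_id c b b' : c.+1 \notin b -> up c b = Some b' -> down c b' = Some b.
Proof.
rewrite /up; case: eqP => [->|c0].
  move=> + [<-]; elim: b => //= x b IHb; rewrite inE negb_or eq_sym.
  by move=> /andP[/negPf -> /IHb ->].
elim: b b' => //= x b IHb b'; rewrite inE negb_or eq_sym => /andP[xc cb].
case U: (up_pos c b) => [b1|] //=; first by case=> <- /=; rewrite (negPf xc) (IHb _ cb U).
by case: eqP => // -> [<-] /=; rewrite eqxx (introF eqP c0).
Qed.

Lemma up_down_id c b a : 0 < c -> c \notin b -> down c b = Some a -> up c a = Some b.
Proof.
rewrite lt0n /up => c0; rewrite (negPf c0); elim: b a => //= x b IHb a.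
rewrite inE negb_or eq_sym => /andP[xc cb]; rewrite (negPf c0).
case: eqP => [-> [<-]|_] /=.
  by move: (up_pos_None c b); rewrite cb eqxx => /eqP ->.
by case D: (down c b) => [d|] //= [<-] /=; rewrite (IHb _ cb D).
Qed.

(** * The local rule *)

(** The value 0 when no part is at most [c] is meaningful: adding a box at
    column 0 creates a new row. *)
Definition floor_part (c : nat) (b : seq nat) : nat := \max_(x <- b | x <= c) x.
Definition max_part (b : seq nat) : nat := \max_(x <- b) x.

Lemma floor_part_le c b : floor_part c b <= c.
Proof. by apply/bigmax_leqP_seq. Qed.

Lemma floor_part_ge c b x : x \in b -> x <= c -> x <= floor_part c b.
Proof. by move=> xb xc; apply: leq_bigmax_seq. Qed.

Lemma max_part_ge b x : x \in b -> x <= max_part b.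
Proof. by move=> xb; apply: leq_bigmax_seq. Qed.

Lemma floor_part_in c b : (floor_part c b == 0) || (floor_part c b \in b).
Proof.
elim: b => [|x b IHb]; first by rewrite /floor_part big_nil.
rewrite /floor_part big_cons -/(floor_part c b) inE; case: ifP => _; last first.
  by case/orP: IHb => ->; rewrite ?orbT.
case: (leqP x (floor_part c b)) => xm; last by rewrite eqxx orbT.
by case/orP: IHb => ->; rewrite ?orbT.
Qed.

Lemma max_partE b : max_part b = floor_part (max_part b) b.
Proof.
apply/eqP; rewrite eqn_leq floor_part_le andbT; apply/bigmax_leqP_seq => x xb _.
by rewrite floor_part_ge // max_part_ge.
Qed.

Lemma max_part_in b : (max_part b == 0) || (max_part b \in b).
Proof. by rewrite max_partE floor_part_in. Qed.

(** A growth rule.  When [down c] leads from [b] to [a] and [up k] from [a] to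
    [a'], the pair [(k', c')] completes the square on its other side: [up k']
    leads from [b] to some [b'], and [down c'] from [b'] to [a'].  At distinct
    columns the operators commute.  At equal columns the box is bumped to the
    nearest column, from [c] leftwards, in which [b] can receive one. *)
Definition local_rule (b : seq nat) (c k : nat) : nat * nat :=
  if k == c then (floor_part c b, floor_part c b) else (k, c).

(** At equal columns, either [b] can receive a box in column [c], and the operators
    still exchange, or it cannot; then [up c] undoes [down c], and at the new
    column [down] undoes [up]. *)
Lemma local_rule_fwd b c k a a' : down c b = Some a -> up k a = Some a' ->
  exists b', up (local_rule b c k).1 b = Some b' /\ down (local_rule b c k).2 b' = Some a'.
Proof.
move=> ba aa; rewrite /local_rule; case: eqP => [kc|/eqP kc] /=; last first.
  have := down_up_commute b kc; rewrite ba /= aa.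
  by case: (up k b) => // b' /= ?; exists b'.
rewrite {k}kc in aa; have [b' bb'] := up_def (floor_part_in c b); exists b'; split=> //.
have [mc|] := eqVneq (floor_part c b) c.
  by rewrite mc in bb' *; rewrite (down_up_same (down_mem ba) bb') ba.
have := floor_part_le c b; rewrite leq_eqVlt => /orP[->//|mc _].
have cb : c \notin b by apply: contraL mc => cb; rewrite -leqNgt (floor_part_ge cb).
have c0 : 0 < c by apply: leq_ltn_trans mc.
rewrite (up_down_id c0 cb ba) in aa; case: aa => <-.
apply: down_up_id bb'; apply: contraL (ltnSn (floor_part c b)) => mb.
by rewrite -leqNgt; apply: floor_part_ge.
Qed.

(** The rule can be inverted except at the pair formed of twice the largest part,
    which is the one at which an insertion starts.  For [k' = c'] the column [c]
    to be recovered is one less than the smallest part exceeding [k']. *)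
Lemma local_rule_bwd b b' c' k' a' : up k' b = Some b' -> down c' b' = Some a' ->
  (exists c k a, [/\ local_rule b c k = (k', c'), down c b = Some a & up k a = Some a']) \/
  [/\ k' = max_part b, c' = max_part b & a' = b].
Proof.
move=> bb ba; have [kc|kc] := eqVneq k' c'; last first.
  left; exists c', k'; have := down_up_commute b kc; rewrite bb /= ba.
  by case: (down c' b) => // a /= /esym ?; exists a; rewrite /local_rule (negPf kc).
rewrite -{c'}kc in ba *; have kb := up_mem bb.
case k1b: (k'.+1 \in b).
  left; rewrite (down_up_same k1b bb) in ba; have [a da] := down_def k1b.
  exists k', k', a; split=> //; last by rewrite da in ba.
  rewrite /local_rule eqxx; congr (_, _); apply/eqP;
    by rewrite eqn_leq floor_part_le; case/orP: kb => [/eqP ->|kb] //; apply: floor_part_ge.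
rewrite (down_up_id (negbT k1b) bb) in ba; case: ba => <-.
case: (ltnP k' (max_part b)) => kp; last first.
  right; suff -> : max_part b = k' by [].
  by apply/eqP; rewrite eqn_leq kp; case/orP: kb => [/eqP -> //|/max_part_ge].
(* The smallest part [p = c.+1] exceeding [k']. *)
left; have ex : exists p, (k' < p) && (p \in b).
  by exists (max_part b); rewrite kp; case/orP: (max_part_in b) => // /eqP E; rewrite E in kp.
case: (ex_minnP ex) => -[//|c] /andP[kc cb] cmin.
have {}kc : k' < c by rewrite ltn_neqAle -ltnS kc andbT; apply/negP => /eqP E; rewrite E cb in k1b.
have cnb : c \notin b by apply/negP => cinb; have := cmin c; rewrite kc cinb ltnn => /(_ isT).
have [a da] := down_def cb; exists c, c, a.
split=> //; last by apply: up_down_id da => //; apply: leq_ltn_trans kc.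
rewrite /local_rule eqxx; suff -> : floor_part c b = k' by [].
apply/eqP; rewrite eqn_leq; apply/andP; split; last first.
  by case/orP: kb => [/eqP ->//|kb]; apply: floor_part_ge => //; apply: ltnW.
apply/bigmax_leqP_seq => x xb xc; rewrite leqNgt; apply/negP => kx.
by have := cmin x; rewrite kx xb ltnNge xc => /(_ isT).
Qed.

Lemma local_rule_inj b c1 k1 c2 k2 : c1.+1 \in b -> c2.+1 \in b ->
  local_rule b c1 k1 = local_rule b c2 k2 -> c1 = c2 /\ k1 = k2.
Proof.
rewrite /local_rule => b1 b2.
have lem c d : c.+1 \in b -> c < d -> floor_part c b <> floor_part d b.
  by move=> cb cd E; have := floor_part_ge cb cd; rewrite -E leqNgt ltnS floor_part_le.
case: eqP => [->|n1]; case: eqP => [->|n2]; last by case=> -> ->.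
- case=> E _; case: (ltngtP c1 c2) => // [c12|c21]; first by case: (lem _ _ b1 c12).
  by case: (lem _ _ b2 c21).
- by case=> E1 E2; case: n2; rewrite -E1 -E2.
by case=> E1 E2; case: n1; rewrite E1 E2.
Qed.

(** An insertion step that has passed a letter is never confused with a step
    that has stopped. *)
Lemma local_rule_neq_max_part b c k : c.+1 \in b -> local_rule b c k <> (max_part b, max_part b).
Proof.
move=> cb; have := max_part_ge cb; rewrite /local_rule.
by case: eqP => [_|n] cp [E1 E2]; [have := floor_part_le c b; lia | apply: n; rewrite E1 E2].
Qed.

(** * Insertion into biwords *)

Lemma local_ruleE b c k : local_rule b c k = if k == c then (floor_part c b, floor_part c b) else (k, c).
Proof. by []. Qed.

Lemma count_mem_gt0 (x : nat) s : (x \in s) = (0 < count_mem x s).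
Proof. by rewrite -has_pred1 has_count. Qed.

(** Two consecutive letters that are pushed by the same insertion keep the order
    of their columns.  For letters of equal value this keeps a biword sorted. *)
Lemma local_rule_lex b0 b1 c0 k0 k a0 a1 a2 :
  down c0 b0 = Some a0 -> up k0 a0 = Some a1 -> up k a1 = Some a2 ->
  up (local_rule b0 c0 k0).1 b0 = Some b1 ->
  (k0 < k) = ((local_rule b0 c0 k0).1 < (local_rule b1 (local_rule b0 c0 k0).2 k).1).
Proof.
move=> ba aa1 aa2; case L: (local_rule b0 c0 k0) => [k0' c1] /=; move: L.
rewrite local_ruleE; case: eqP => [E|kc] [<- <-] bb {k0' c1}; last first.
  rewrite local_ruleE; case: eqP => [->|//] /=; have := floor_part_le c0 b1.
  by have := floor_part_ge (up_in bb) (x := k0.+1) (c := c0); lia.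
rewrite {k0}E in aa1 *; rewrite local_ruleE; case: eqP => [->|km] /=.
  by have := floor_part_le c0 b0; have := floor_part_le (floor_part c0 b0) b1; lia.
have := floor_part_le c0 b0; case: (leqP k (floor_part c0 b0)) => [km' mc|mk _]; first lia.
rewrite ltnNge; apply/negP => kc; have kb : k \notin b0.
  by apply/negP => kb; have := floor_part_ge kb kc; lia.
move: kb; rewrite !count_mem_gt0 -leqNgt leqn0 => /eqP kb.
have /= := up_mem aa2; rewrite count_mem_gt0 /=.
have k1 : 0 != k by lia.
have /= := down_count ba (p := pred1 k) k1; have /= := up_count aa1 (p := pred1 k) k1; move: kb => /=; lia.
Qed.

(** When two insertions pass the same letter one after the other, their columns
    compare in the same way before and after it. *)
Lemma local_rule_order g b b' c1 c2 k a a' :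
  down c2 g = Some b -> down c1 b = Some a -> up k a = Some a' ->
  up (local_rule b c1 k).1 b = Some b' ->
  (c1 < c2) = ((local_rule b c1 k).2 < (local_rule g c2 (local_rule b c1 k).1).2).
Proof.
move=> gb ba aa; case L: (local_rule b c1 k) => [k0' c1'] /=; move: L.
rewrite local_ruleE; case: eqP => [E|kc] [<- <-] bb {k0' c1'}.
  rewrite {k}E in aa *; rewrite local_ruleE; case: eqP => [<-|km] /=.
    by have := floor_part_le c1 b; have := floor_part_le (floor_part c1 b) g; lia.
  have := floor_part_le c1 b; case: (leqP c2 (floor_part c1 b)) => [km' mc|mk _]; first lia.
  rewrite ltnNge; apply/negP => cc; have := down_in gb.
  by case: eqP => [|_ cb]; [lia | have := floor_part_ge cb cc; lia].
rewrite local_ruleE; case: eqP => [E|//] /=; rewrite -{c2}E in gb *.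
have := floor_part_le k g; case: (ltnP c1 k) => [ck _|]; last lia.
suff kg : c1.+1 \in g by have := floor_part_ge kg ck; lia.
have c1b := down_mem ba; have := down_memE gb (x := c1.+1); rewrite c1b eqSS eq_sym.
case: eqP => [//|_]; case: (eqVneq c1.+1 k) => [E|_] /(_ isT isT) //= _.
have k1 : 0 != k by lia.
have /= := down_count ba (p := pred1 k) k1; have /= := down_count gb (p := pred1 k) k1.
have := up_mem aa; rewrite E !count_mem_gt0 /=; lia.
Qed.

(** A word of columns, read from right to left, builds a composition box by
    box.  The words that build [a] encode the Young composition tableaux of
    shape [a]. *)
Fixpoint grow (w : seq nat) : option (seq nat) :=
  if w is k :: w' then obind (up k) (grow w') else Some [::].

Definition shape_of (s : seq (nat * nat)) : seq nat := odflt [::] (grow (unzip1 s)).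

(** Biletters are pairs (column, value).  The value is compared first, then the
    column. *)
Definition lexgt (p q : nat * nat) : bool :=
  (q.2 < p.2) || (q.2 == p.2) && (q.1 < p.1).

(** Inserting the value [z] into a biword with decreasing values: the letters
    of value at most [z] are untouched, [z] enters above them with the largest
    column allowed, and the letters of larger value are then adjusted by the
    local rule.  The second component is the column of the box by which the
    shape has grown. *)
Fixpoint insert (z : nat) (s : seq (nat * nat)) : seq (nat * nat) * nat :=
  let stop := ((max_part (shape_of s), z) :: s, max_part (shape_of s)) in
  if s is (k, x) :: s0 then
    if z < x then
      let: (s1, c) := insert z s0 in
      let: (k', c') := local_rule (shape_of s1) c k in ((k', x) :: s1, c')
    else stop
  else stop.

Lemma insert_pass z k x s : z < x ->
  insert z ((k, x) :: s) =
  (((local_rule (shape_of (insert z s).1) (insert z s).2 k).1, x) :: (insert z s).1,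
   (local_rule (shape_of (insert z s).1) (insert z s).2 k).2).
Proof. by move=> /= ->; case: (insert z s) => s1 c /=; case: (local_rule _ _ _). Qed.

Lemma insert_stop z s : all (fun p => p.2 <= z) (take 1 s) ->
  insert z s = ((max_part (shape_of s), z) :: s, max_part (shape_of s)).
Proof. by case: s => //= -[k x] s; rewrite take0 andbT ltnNge => /= ->. Qed.

(** One square of the growth rule is added for each letter that the insertion
    passes. *)
Lemma grow_insert z s a : grow (unzip1 s) = Some a ->
  grow (unzip1 (insert z s).1) = Some (shape_of (insert z s).1) /\
  down (insert z s).2 (shape_of (insert z s).1) = Some a.
Proof.
elim: s a => [|[k x] s IHs] a.
  by move=> [<-]; rewrite /shape_of /= /max_part big_nil.
move=> sa; case: (ltnP z x) => zx; last first.
  have [b ub] := up_def (max_part_in a).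
  rewrite insert_stop /= ?take0 /= ?zx //.
  rewrite {2 5}/shape_of; rewrite !/(shape_of (_ :: s)) sa /=; move: sa => /= -> /=.
  rewrite ub /=; split=> //; apply: down_up_id ub; apply: contraL (ltnSn (max_part a)) => pa.
  by rewrite -leqNgt max_part_ge.
rewrite insert_pass //; move: sa => /=; case R: (grow (unzip1 s)) => [a0|] //= aa.
have [r d] := IHs _ R; have [b [ub db]] := local_rule_fwd d aa.
by rewrite /shape_of /= r /= ub.
Qed.

Lemma insert_perm z s : perm_eq (unzip2 (insert z s).1) (z :: unzip2 s).
Proof.
elim: s => [|[k x] s IHs] //; case: (ltnP z x) => zx.
  rewrite insert_pass // /= -(perm_cat2l [:: x]) /= in IHs *.
  by apply: perm_trans IHs _; rewrite -[x :: z :: _]/([:: x] ++ [:: z] ++ _) perm_catCA.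
by rewrite insert_stop //= take0 /= zx.
Qed.

Lemma grow_cons k (x : nat) s b : grow (unzip1 ((k, x) :: s)) = Some b ->
  exists2 a, grow (unzip1 s) = Some a & up k a = Some b.
Proof. by move=> /=; case: (grow _) => //= a; exists a. Qed.

Lemma shape_ofE s a : grow (unzip1 s) = Some a -> shape_of s = a.
Proof. by rewrite /shape_of => ->. Qed.

Lemma grow_insert_ex z s a : grow (unzip1 s) = Some a -> exists b,
  [/\ shape_of (insert z s).1 = b, grow (unzip1 (insert z s).1) = Some b &
      down (insert z s).2 b = Some a].
Proof. by move=> /(grow_insert z)[r d]; exists (shape_of (insert z s).1). Qed.

Lemma insert_sorted z s a : grow (unzip1 s) = Some a -> sorted lexgt s ->
  sorted lexgt (insert z s).1.
Proof.
elim: s a => [|[k x] s IHs] a //; case: (ltnP z x) => zx; last first.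
  move=> ra; rewrite insert_stop /= ?take0 /= ?zx // => ps; rewrite ps andbT.
  have [a0 _ up0] := grow_cons ra; rewrite /lexgt /= (shape_ofE (s := (k, x) :: s) ra).
  by have := max_part_ge (up_in up0); lia.
move=> /grow_cons[a0 ra up0] ps; have so := IHs _ ra (path_sorted ps).
rewrite insert_pass //=; case: s {IHs} ra ps so => [|[k0 x0] s] ra ps so.
  by rewrite /= /lexgt /= zx.
case: (ltnP z x0) so => zx0; last first.
  by rewrite insert_stop /= ?take0 ?zx0 // => ->; rewrite /lexgt /= zx.
rewrite insert_pass //= => ->; rewrite andbT.
move: ps => /= /andP[]; rewrite /lexgt /=; case: ltngtP => //= _ kk _.
have [a1 ra1 /= up1] := grow_cons ra; have [b [bE rb db]] := grow_insert_ex z ra1.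
have [b1 [ub _]] := local_rule_fwd db up1; rewrite bE.
rewrite (shape_ofE (a := b1)) /=; last by rewrite rb /= ub.
by rewrite -(local_rule_lex db up1 up0 ub).
Qed.

(** The insertion is undone from the top of the biword: the local rule is
    injective and never produces the pair at which an insertion starts. *)
Lemma insert_inj z1 s1 a1 z2 s2 a2 :
  grow (unzip1 s1) = Some a1 -> grow (unzip1 s2) = Some a2 ->
  insert z1 s1 = insert z2 s2 -> z1 = z2 /\ s1 = s2.
Proof.
have sl z z' s k x s' a : grow (unzip1 s') = Some a -> z < x ->
    ((max_part (shape_of s), z') :: s, max_part (shape_of s)) <> insert z ((k, x) :: s').
  move=> r zx; rewrite insert_pass //; have [b [bE rb db]] := grow_insert_ex z r.
  case=> E1 _ E3 E2; apply: (@local_rule_neq_max_part b (insert z s').2 k); first exact: down_mem db.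
  move: E1 E2; rewrite E3 bE => E1 E2.
  by case L: (local_rule _ _ _) E1 E2 => [u v] /= <- <-.
have stopP z s : (insert z s = ((max_part (shape_of s), z) :: s, max_part (shape_of s))) \/
    exists k x s', s = (k, x) :: s' /\ z < x.
  case: s => [|[k x] s]; first by left.
  case: (ltnP z x) => zx; first by right; exists k, x, s.
  by left; rewrite insert_stop //= take0 /= zx.
elim: s1 s2 a1 a2 => [|[k x] s1 IHs] s2 a1 a2 r1 r2.
  case: (stopP z2 s2) => [->|[k [x [s' [E zx]]]]].
    by rewrite insert_stop // => -[_ -> ->].
  by rewrite {s2}E in r2 *; have [a3 ra3 _] := grow_cons r2; rewrite insert_stop // => /sl; case/(_ _ ra3 zx).
case: (stopP z1 ((k, x) :: s1)) => [->|[_ [x1 [_ [[_ <- _] zx1]]]]].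
  case: (stopP z2 s2) => [->|[k' [x' [s' [E zx]]]]].
    by case=> _ -> <-.
  by rewrite {s2}E in r2 *; have [a3 ra3 _] := grow_cons r2 => /sl; case/(_ _ ra3 zx).
have [a3 ra3 _] := grow_cons r1.
case: (stopP z2 s2) => [->|[k' [x' [s' [E zx]]]]].
  by move/esym/sl; case/(_ _ ra3 zx1).
rewrite {s2}E in r2 *; have [a4 ra4 _] := grow_cons r2.
have [b1 [bE1 rb1 db1]] := grow_insert_ex z1 ra3.
have [b2 [bE2 rb2 db2]] := grow_insert_ex z2 ra4.
rewrite !insert_pass // => -[E1 <- E2 E3].
have bb : b1 = b2 by rewrite -bE1 E2.
have [] := @local_rule_inj b1 (insert z1 s1).2 k (insert z2 s').2 k'.
- exact: down_mem db1.
- by rewrite bb; apply: down_mem db2.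
- move: E1 E3; rewrite bE1 bE2 -bb.
  by case: (local_rule _ _ _) => u v /= -> ->; case: (local_rule _ _ _).
move=> E4 ->; have [] // := IHs s' _ _ ra3 ra4; last by move=> -> ->.
by case: (insert z1 s1) (insert z2 s') E2 E4 => ? ? [? ?] /= -> ->.
Qed.

(** Running the local rule backwards from the removed box must end at a pair
    formed by the largest part, where the value to extract is found.  The order
    condition on the biword is what guarantees that the insertion of this value
    stops at the same place. *)
Lemma insert_surj s' c b a : grow (unzip1 s') = Some b -> down c b = Some a ->
  sorted lexgt s' ->
  exists s z, [/\ grow (unzip1 s) = Some a, sorted lexgt s & insert z s = (s', c)].
Proof.
elim: s' c b a => [|[k' x] s1 IHs] c b a; first by case=> <-.
move=> /grow_cons[b1 rb1 ub] dc so; have so1 := path_sorted so.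
case: (local_rule_bwd ub dc) => [[c1 [k [a1 [L da ua]]]]|[-> -> ->]]; last first.
  exists s1, x; split=> //; rewrite insert_stop ?(shape_ofE rb1) //.
  by case: s1 so {IHs rb1 so1} => //= -[k0 x0] s /andP[+ _]; rewrite take0 /= /lexgt /=; lia.
have [s0 [z [ra0 so0 E]]] := IHs _ _ _ rb1 da so1.
suff [zx ps] : z < x /\ path lexgt (k, x) s0.
  exists ((k, x) :: s0), z; split=> //=; first by rewrite ra0.
  by rewrite zx E (shape_ofE rb1) L.
case: s0 ra0 so0 E => [|[k0 x0] s0] ra0 so0.
  rewrite insert_stop // => -[E1 E2]; move: so; rewrite -E1 /= /lexgt /= (shape_ofE ra0).
  rewrite (shape_ofE ra0) in E2; split=> //.
  case: ltngtP so => //= E so; exfalso.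
  move: L; rewrite local_ruleE; case: eqP => [E3|E3] [E4 E5].
    by have := floor_part_le c1 b1; lia.
  case: ra0 => E6; rewrite -E6 /max_part big_nil in so E2 *.
  by have := up_mem ua; rewrite -E6 in_nil orbF; lia.
case: (ltnP z x0) => zx0; last first.
  rewrite insert_stop /= ?take0 /= ?zx0 // => -[E1 E2].
  rewrite (shape_ofE (s := (k0, x0) :: s0) ra0) in E1 E2.
  have zx : z < x.
    move: so; rewrite -E1 /= /lexgt /= => /andP[+ _]; case: ltngtP => //= E so; exfalso.
    move: L; rewrite local_ruleE; case: eqP => [E3|E3] [E4 E5].
      by have := floor_part_le c1 b1; lia.
    have := up_mem ua; case: eqP => [|_ /max_part_ge]; lia.
  by split=> //=; rewrite [path _ _ _]so0 andbT /lexgt /= (leq_ltn_trans zx0 zx).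
have [a2 ra2 up2] := grow_cons ra0.
have [b2 [bE2 rb2 db2]] := grow_insert_ex z ra2.
have [b3 [ub3 _]] := local_rule_fwd db2 up2.
rewrite insert_pass // bE2 => -[E1 E2].
have b31 : b3 = b1 by move: rb1; rewrite -E1 /= rb2 /= ub3 => -[].
move: so; rewrite -E1 /= /lexgt /= => /andP[lx _].
have zx : z < x by lia.
split=> //=; rewrite [path _ _ _]so0 andbT /lexgt /=; move: lx; case: ltngtP => //= _.
by rewrite (local_rule_lex db2 up2 ua ub3) b31 E2 L.
Qed.

(** The analogue of the row bumping property.  It holds where the insertions
    start, and the local rule preserves it. *)
Lemma insert_order z1 z2 s a : grow (unzip1 s) = Some a ->
  ((insert z1 s).2 < (insert z2 (insert z1 s).1).2) = (z1 <= z2).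
Proof.
have bnd z s' a' : grow (unzip1 s') = Some a' ->
    (insert z s').2 <= max_part a' /\ (insert z s').2 < max_part (shape_of (insert z s').1).
  move=> /(grow_insert_ex z)[b [-> _ db]]; have := max_part_ge (down_mem db).
  by have := down_in db; case: eqP => [-> //|_ /max_part_ge].
have top s' a' z z' : grow (unzip1 s') = Some a' -> z' < z -> 
    (insert z' ((max_part a', z) :: s')).2 <= max_part a'.
  move=> r zz; have [h1 h2] := bnd z' s' a' r; rewrite insert_pass //= local_ruleE.
  by case: eqP => [_|//] /=; apply: leq_trans (floor_part_le _ _) h1.
have stop s' a' : grow (unzip1 s') = Some a' -> all (fun p => p.2 <= z1) (take 1 s') ->
    ((insert z1 s').2 < (insert z2 (insert z1 s').1).2) = (z1 <= z2).
  move=> r st; rewrite [insert z1 _](insert_stop st) (shape_ofE r) [in LHS]/fst [in X in X < _]/snd.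
  case: (leqP z1 z2) => zz; last by have := top _ _ z1 z2 r zz; lia.
  have [b ub] := up_def (max_part_in a').
  rewrite insert_stop /= ?take0 /= ?zz // (shape_ofE (a := b)) /=; last by rewrite r.
  exact: max_part_ge (up_in ub).
elim: s a => [|[k x] s IHs] a r; first exact: stop r _.
have [h1 h2] := bnd z1 _ _ r.
case: (ltnP z1 x) => zx1; last by apply: stop r _; rewrite /= take0 /= zx1.
have [a0 ra0 ua] := grow_cons r; have [b1 [bE1 rb1 db1]] := grow_insert_ex z1 ra0.
have [b2 [ub2 db2]] := local_rule_fwd db1 ua.
case: (ltnP z2 x) => zx2; last first.
  rewrite [insert z2 _]insert_stop; last by rewrite insert_pass //= take0 /= zx2.
  by rewrite h2; lia.
rewrite [insert z1 _]insert_pass // bE1 insert_pass // /= -(IHs _ ra0).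
have [g [gE rg dg]] := grow_insert_ex z2 rb1; rewrite gE.
by rewrite -(local_rule_order dg db1 ua ub2).
Qed.

(** * Signs of insertions *)

Lemma up_sum k a b (F : nat -> nat) : up k a = Some b -> F 0 = 0 ->
  \sum_(x <- b) F x + F k = \sum_(x <- a) F x + F k.+1.
Proof.
rewrite /up; case: eqP => [-> [<-] F0|_ + _].
  by rewrite -cats1 big_cat big_seq1 /= F0 addn0.
elim: a b => //= x a IHa b; case E: (up_pos k a) => [d|].
  by case=> <-; rewrite !big_cons; have := IHa _ E; lia.
by case: eqP => // -> [<-]; rewrite !big_cons; lia.
Qed.

Lemma down_sum c a b (F : nat -> nat) : down c a = Some b -> F 0 = 0 ->
  \sum_(x <- a) F x + F c = \sum_(x <- b) F x + F c.+1.
Proof.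
move=> + F0; elim: a b => //= x a IHa b; case: eqP => [->|_].
  by case: eqP => [->|_] [<-]; rewrite !big_cons ?F0; lia.
by case E: (down c a) => [d|] //= [<-]; rewrite !big_cons; have := IHa _ E; lia.
Qed.

(** For a column word this is the number of column inversions of the tableau;
    for the reversal of a word, its number of inversions. *)
Fixpoint coinv (s : seq nat) : nat :=
  if s is x :: s' then coinv s' + count (ltn x) s' else 0.

(** The number of boxes of [a] in the columns from [c] on, counted from 0. *)
Definition boxes_right (c : nat) (a : seq nat) : nat := \sum_(x <- a) (x - c).

Lemma boxes_rightS c a : boxes_right c a = boxes_right c.+1 a + count (ltn c) a.
Proof.
rewrite /boxes_right; elim: a => [|x a IHa]; rewrite ?big_nil ?big_cons //= IHa.
by case: ltnP; lia.
Qed.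

Lemma boxes_right_eq0 c a : (forall x, x \in a -> x <= c) -> boxes_right c a = 0.
Proof.
move=> ac; rewrite /boxes_right big1_seq // => x /andP[_ /ac]; lia.
Qed.

(** Each letter of a word is the column of the box that it adds. *)
Lemma count_grow k w a : grow w = Some a -> count (ltn k) w = boxes_right k.+1 a.
Proof.
elim: w a => [|j w IHw] a /=; first by case=> <-; rewrite /boxes_right big_nil.
case R: (grow w) => [b|] //= ub; rewrite (IHw _ R).
by have := up_sum (F := fun x => x - k.+1) ub erefl; rewrite -!/(boxes_right _ _); lia.
Qed.

(** The negation is the sign gained when an inserted value passes a larger one.
    At equal columns it comes from the part [c.+1] of [b] that [down c] shortens:
    no part of [b] lies strictly between the new column and [c.+1], so that the
    columns in between have equal heights in [b]. *)
Lemma local_rule_parity b c k a a' : down c b = Some a -> up k a = Some a' ->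
  odd (boxes_right (local_rule b c k).1.+1 b + boxes_right (local_rule b c k).2 a') =
  ~~ odd (boxes_right k.+1 a + boxes_right c a).
Proof.
move=> ba aa; have dS F := down_sum (F := F) ba; have uS F := up_sum (F := F) aa.
rewrite local_ruleE; case: eqP => [E|kc] /=; last first.
  have := dS (fun x => x - k.+1) erefl; have := uS (fun x => x - c) erefl.
  by rewrite -!/(boxes_right _ _); lia.
rewrite {k}E in aa uS *; set m := floor_part c b.
have mc : m <= c := floor_part_le c b.
have E1 : boxes_right m a' = boxes_right m b.
  have := dS (fun x => x - m) erefl; have := uS (fun x => x - m) erefl.
  by rewrite -!/(boxes_right _ _); lia.
have E2 : count (ltn m) b = count (ltn c) b.
  apply: eq_in_count => x xb /=; apply/idP/idP => [mx|]; last by lia.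
  by rewrite ltnNge; apply: contraL mx => /(floor_part_ge xb); rewrite leqNgt.
have E3 : count (ltn c) b = (count (ltn c) a).+1.
  by have := down_count ba (p := ltn c) isT; rewrite /= ltnn ltnSn; lia.
by rewrite E1 (boxes_rightS m) (boxes_rightS c) E2 E3; lia.
Qed.

Lemma lexgt_unzip2 s : sorted lexgt s -> sorted geq (unzip2 s).
Proof.
case: s => //= p s; elim: s p => //= q s IHs p /andP[pq /IHs ->].
by rewrite andbT; move: pq; rewrite /lexgt; lia.
Qed.

Lemma geq_trans : transitive geq. Proof. by move=> x y z /=; lia. Qed.

(** The sum of the parities of the local rule over the letters that are passed:
    the inserted value contributes one sign for each larger value of the biword,
    and the box by which the shape grows contributes the boxes to its right. *)
Lemma insert_parity z s a : grow (unzip1 s) = Some a -> sorted lexgt s ->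
  odd (coinv (unzip1 (insert z s).1)) =
  odd (coinv (unzip1 s) + count (ltn z) (unzip2 s) + boxes_right (insert z s).2 a).
Proof.
elim: s a => [|[k x] s IHs] a r so.
  by case: r => <-; rewrite /boxes_right /= big_nil.
case: (ltnP z x) => zx; last first.
  have so2 := lexgt_unzip2 so.
  have cz : count (ltn z) (unzip2 ((k, x) :: s)) = 0.
    apply/eqP; rewrite -leqn0 leqNgt -has_count; apply/hasPn => y /=.
    rewrite inE => /orP[/eqP -> |ys]; first by rewrite -leqNgt.
    have /allP/(_ _ ys) /= := order_path_min geq_trans so2; lia.
  rewrite cz; move: (s) (k) (x) r zx {IHs so so2 cz} => s' k' x' r zx.
  rewrite insert_stop /= ?take0 /= ?zx // (shape_ofE r).
  have := count_grow (max_part a) r; rewrite /= => ->.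
  by rewrite !boxes_right_eq0 ?addn0 // => y /max_part_ge; lia.
have [a0 ra0 up0] := grow_cons r; have [b [bE rb db]] := grow_insert_ex z ra0.
have := IHs _ ra0 (path_sorted so); rewrite insert_pass //= bE zx.
rewrite (count_grow _ rb) (count_grow _ ra0).
by have := local_rule_parity db up0; lia.
Qed.

Fixpoint inserts (s : seq (nat * nat)) (zs : seq nat) : seq (nat * nat) * seq nat :=
  if zs is z :: zs' then
    let t := inserts (insert z s).1 zs' in (t.1, (insert z s).2 :: t.2)
  else (s, [::]).

Definition downs (cs b : seq nat) : option (seq nat) :=
  foldr (fun c => obind (down c)) (Some b) cs.

(** The inversions of a word that involve its last part [zs], the first part
    being given reversed in [v]. *)
Fixpoint cross_inv (v zs : seq nat) : nat :=
  if zs is z :: zs' then count (ltn z) v + cross_inv (z :: v) zs' else 0.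

(** For each removal, the boxes weakly to the right of the removed one in the
    remaining shape. *)
Fixpoint chain_right (cs b : seq nat) : nat :=
  if cs is c :: cs' then boxes_right c (odflt [::] (downs cs b)) + chain_right cs' b else 0.

Lemma inserts_grow s zs a : grow (unzip1 s) = Some a -> exists b,
  grow (unzip1 (inserts s zs).1) = Some b /\ downs (inserts s zs).2 b = Some a.
Proof.
elim: zs s a => [|z zs IHzs] s a r; first by exists a.
have [b [_ rb db]] := grow_insert_ex z r; have [d [rd dd]] := IHzs _ _ rb.
by exists d; rewrite /= dd.
Qed.

Lemma inserts_sorted s zs a : grow (unzip1 s) = Some a -> sorted lexgt s ->
  sorted lexgt (inserts s zs).1.
Proof.
elim: zs s a => [|z zs IHzs] s a r so //=; have [b [_ rb _]] := grow_insert_ex z r.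
by apply: IHzs rb _; apply: insert_sorted r so.
Qed.

Lemma inserts_size s zs : size (inserts s zs).2 = size zs.
Proof. by elim: zs s => //= z zs IHzs s; rewrite IHzs. Qed.

Lemma inserts_perm s zs : perm_eq (unzip2 (inserts s zs).1) (zs ++ unzip2 s).
Proof.
elim: zs s => //= z zs IHzs s; apply: perm_trans (IHzs _) _.
rewrite -cat_cons -cat1s -catA perm_sym perm_catCA perm_cat2l perm_sym.
exact: insert_perm.
Qed.

Lemma inserts_inj s1 a1 zs1 s2 a2 zs2 :
  grow (unzip1 s1) = Some a1 -> grow (unzip1 s2) = Some a2 ->
  inserts s1 zs1 = inserts s2 zs2 -> s1 = s2 /\ zs1 = zs2.
Proof.
elim: zs1 zs2 s1 a1 s2 a2 => [|z1 zs1 IH] [|z2 zs2] //= s1 a1 s2 a2 r1 r2.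
  by case=> <-.
have [b1 [_ rb1 _]] := grow_insert_ex z1 r1; have [b2 [_ rb2 _]] := grow_insert_ex z2 r2.
move=> [E1 E2 E3]; have [] := IH zs2 _ _ _ _ rb1 rb2.
  by case: (inserts _ zs1) (inserts _ zs2) E1 E3 => ? ? [? ?] /= -> ->.
move=> E4 ->; have [] // := insert_inj (z1 := z1) (z2 := z2) r1 r2; last by move=> -> ->.
by case: (insert z1 s1) (insert z2 s2) E4 E2 => ? ? [? ?] /= -> ->.
Qed.

Lemma downs_cons c cs b a : downs (c :: cs) b = Some a ->
  exists2 d, downs cs b = Some d & down c d = Some a.
Proof. by move=> /=; case: (downs cs b) => //= d; exists d. Qed.

Lemma inserts_surj s' cs b a : grow (unzip1 s') = Some b -> downs cs b = Some a ->
  sorted lexgt s' ->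
  exists s zs, [/\ grow (unzip1 s) = Some a, sorted lexgt s & inserts s zs = (s', cs)].
Proof.
move=> r d so; elim: cs a d => [|c cs IHcs] a; first by case=> <-; exists s', [::].
move=> /downs_cons[d /IHcs [s1 [zs [r1 so1 E1]]] da].
have [s [z [r0 so0 E0]]] := insert_surj r1 da so1.
by exists s, (z :: zs); split=> //=; rewrite E0 /= E1.
Qed.

(** Monotone words correspond to monotone chains of removals, and this is how
    horizontal and vertical strips arise. *)
Lemma inserts_order s zs a : grow (unzip1 s) = Some a ->
  (sorted leq zs = sorted ltn (inserts s zs).2) *
  (sorted gtn zs = sorted geq (inserts s zs).2).
Proof.
elim: zs s a => [|z zs IHzs] // s a r; have [b [_ rb _]] := grow_insert_ex z r.
case: zs IHzs => [|z' zs] IHzs //.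
have [E1 E2] := IHzs _ _ rb; have E := insert_order z z' r.
move: E1 E2 => /= -> ->; rewrite E; split=> //; congr (_ && _).
by rewrite ltnNge -E -leqNgt.
Qed.

Lemma cross_inv_perm v v' zs : perm_eq v v' -> cross_inv v zs = cross_inv v' zs.
Proof.
elim: zs v v' => //= z zs IHzs v v' vv; congr (_ + _); last by apply: IHzs; rewrite perm_cons.
exact/permP.
Qed.

Lemma inserts_parity s zs a b : grow (unzip1 s) = Some a -> sorted lexgt s ->
  grow (unzip1 (inserts s zs).1) = Some b ->
  odd (coinv (unzip1 (inserts s zs).1)) =
  odd (coinv (unzip1 s) + cross_inv (unzip2 s) zs + chain_right (inserts s zs).2 b).
Proof.
elim: zs s a => [|z zs IHzs] s a r so /=; first by rewrite !addn0.
have [b1 [_ rb1 db1]] := grow_insert_ex z r => rb.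
have := IHzs _ _ rb1 (insert_sorted z r so) rb.
have := insert_parity z r so; have [b2 [rb2 db2]] := inserts_grow zs rb1.
rewrite rb in rb2; case: rb2 db2 => <- ->; rewrite /= db1 /= (cross_inv_perm _ (insert_perm z s)).
lia.
Qed.

Lemma coinv_catrev zs v : coinv (catrev zs v) = coinv v + cross_inv v zs.
Proof. by elim: zs v => [|z zs IHzs] v /=; rewrite ?addn0 // IHzs /=; lia. Qed.

Lemma coinv_sorted v : sorted geq v -> coinv v = 0.
Proof.
elim: v => //= x v IHv so; rewrite IHv ?(path_sorted so) //.
apply/eqP; rewrite -leqn0 leqNgt -has_count; apply/hasPn => y ys /=.
have /allP/(_ _ ys) /= := order_path_min geq_trans so; lia.
Qed.

(** * Young composition tableaux as column words *)

Lemma mem_skew_boxes mu la i j :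
  ((i, j) \in skew_boxes mu la) = (nth 0 la i <= j < nth 0 mu i).
Proof.
apply/allpairsPdep/idP => [[i' [j' [+ + [-> ->]]]]|/andP[h1 h2]].
  by rewrite !mem_iota; lia.
exists i, j; rewrite !mem_iota; split=> //; last by lia.
by rewrite /= add0n ltnNge; apply: contraL h2 => /(nth_default 0) ->.
Qed.

Lemma mem_boxes a i j : ((i, j) \in boxes a) = (j < nth 0 a i).
Proof. by rewrite mem_skew_boxes nth_nil. Qed.

Definition triple_ok (R S : seq nat) : bool :=
  all (fun l => (l < size S) && (nth 0 S l <= nth 0 R l.+1) ==>
                (l.+1 < size S) && (nth 0 S l.+1 < nth 0 R l.+1))
      (iota 0 (size R).-1).

Definition row_ok (R S : seq nat) : bool := (head 0 R < head 0 S) && triple_ok R S.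

(** The conditions defining a standard Young composition tableau compare rows
    two by two. *)
Definition tab_ok (T : seq (seq nat)) : bool :=
  all (sorted ltn) T && pairwise row_ok T.

Lemma triple_okP R S :
  reflect (forall l, l.+1 < size R -> l < size S -> nth 0 S l <= nth 0 R l.+1 ->
             l.+1 < size S /\ nth 0 S l.+1 < nth 0 R l.+1)
    (triple_ok R S).
Proof.
apply: (iffP allP) => [h l lR lS le|h l].
  by have := h l; rewrite mem_iota lS le /= => h'; apply/andP/h'; lia.
rewrite mem_iota => lR; apply/implyP => /andP[lS le]; apply/andP/h => //; lia.
Qed.

Lemma tab_okP a T : shape T = a -> is_SYCT a T <-> tab_ok T.
Proof.
move=> <-.
have hE : [seq entry T i 0 | i <- iota 0 (size (shape T))] = map (head 0) T.
  rewrite size_map -[in RHS](mkseq_nth [::] T) /mkseq -map_comp.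
  by apply: eq_map => i; rewrite /entry /= nth0.
have nE i : nth 0 (shape T) i = size (nth [::] T i).
  case: (ltnP i (size T)) => iT; first by rewrite (nth_map [::]).
  by rewrite !nth_default ?size_map.
have prow : pairwise row_ok T = pairwise ltn (map (head 0) T) && pairwise triple_ok T.
  by rewrite pairwise_map -pairwise_relI; apply: eq_pairwise.
rewrite /tab_ok /is_SYCT hE prow -(sorted_pairwise ltn_trans); split.
  case=> -> -> h /=; apply/(pairwiseP [::]) => j i jT iT ji; apply/triple_okP => l lR lS le.
  by have := h i j l ji; rewrite !mem_boxes !nE; apply.
case/and3P => h1 h2 /(pairwiseP [::]) h; split=> // i j l ji.
rewrite !mem_boxes !nE => lR lS le.
have iT : i < size T by rewrite ltnNge; apply: contraL lS => /(nth_default [::]) ->.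
by have /triple_okP := h j i (ltn_trans ji iT) iT ji; apply.
Qed.

Lemma mem_SYCT a T : (T \in SYCT a) =
  [&& shape T == a, perm_eq (flatten T) (iota 1 (sumn a)) & tab_ok T].
Proof.
rewrite mem_filter andbC; apply/idP/idP.
  case/andP=> /mapP[w]; rewrite mem_permutations => pw TE /asboolP.
  have sw : size w = sumn a by rewrite (perm_size pw) size_iota.
  have sT : shape T = a by rewrite TE reshapeKl ?sw.
  by move=> /(tab_okP sT) ->; rewrite sT eqxx TE reshapeKr ?sw // pw.
case/and3P=> /eqP sT pT /(tab_okP sT) oT; rewrite (introT (asboolP _) oT) andbT.
by apply/mapP; exists (flatten T); rewrite ?mem_permutations // -sT flattenK.
Qed.

Lemma SYCT_uniq a : uniq (SYCT a).
Proof.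
rewrite filter_uniq // map_inj_in_uniq ?permutations_uniq // => u v.
rewrite !mem_permutations => pu pv /(congr1 flatten).
by rewrite !reshapeKr // ?(perm_size pu) ?(perm_size pv) size_iota.
Qed.

Section AddMax.
Variables (N : nat) (T1 T2 : seq (seq nat)) (R : seq nat).
Hypothesis small : all (all (gtn N)) (T1 ++ R :: T2).

Let sR : all (gtn N) R.
Proof. by move: small; rewrite all_cat /= => /and3P[]. Qed.

Lemma nth_lt (S : seq nat) l : all (gtn N) S -> l < size S -> nth 0 S l < N.
Proof. by move=> /allP h /(mem_nth 0)/h. Qed.

Lemma triple_ok_rcons_r S : all (gtn N) S -> triple_ok S (rcons R N) = triple_ok S R.
Proof.
move=> sS; apply/triple_okP/triple_okP => h l lS; last first.
  rewrite size_rcons ltnS leq_eqVlt => /orP[/eqP E|lR].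
    by rewrite nth_rcons E ltnn eqxx -E => hN; exfalso; move: (nth_lt sS lS); lia.
  rewrite nth_rcons lR => /h[] // l1 l2; split; first by lia.
  by rewrite nth_rcons l1.
move=> lR le; have [] := h l lS; rewrite ?size_rcons ?nth_rcons ?lR //; first by lia.
rewrite ltnS leq_eqVlt => /orP[/eqP E|lR2]; last by rewrite lR2.
by rewrite E ltnn eqxx -E => hN; exfalso; move: (nth_lt sS lS); lia.
Qed.

(** A largest entry at the end of a row violates the triple rule exactly
    against a lower row of the same length as the row had before. *)
Lemma triple_ok_rcons_l S : R != [::] -> all (gtn N) S ->
  triple_ok (rcons R N) S = triple_ok R S && (size S != size R).
Proof.
move=> R0 sS; have r0 : 0 < size R by rewrite lt0n size_eq0.
apply/triple_okP/andP => [h|[/triple_okP h nS] l].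
  split; first (apply/triple_okP => l lR lS le).
    by have := h l; rewrite size_rcons nth_rcons lR ltnW //; apply.
  apply/eqP => E; have h1 : (size R).-1.+1 = size R by lia.
  have := h (size R).-1; rewrite h1 size_rcons nth_rcons E ltnn eqxx => hh.
  suff [] : false /\ nth 0 S (size R) < N by [].
  apply: hh => //.
  by apply/ltnW/nth_lt => //; rewrite E; lia.
rewrite size_rcons ltnS leq_eqVlt => /orP[/eqP E|lR lS]; last first.
  by rewrite nth_rcons lR; apply: h.
move=> lS _; have lS2 : l.+1 < size S by move: nS; lia.
by split=> //; rewrite nth_rcons E ltnn eqxx nth_lt // -E.
Qed.

Lemma tab_ok_rcons : R != [::] ->
  tab_ok (T1 ++ rcons R N :: T2) =
  tab_ok (T1 ++ R :: T2) && all (fun S => size S != size R) T2.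
Proof.
move=> R0; rewrite /tab_ok !all_cat !pairwise_cat /= !allrel_consr.
have -> : sorted ltn (rcons R N) = sorted ltn R.
  rewrite !(sorted_pairwise ltn_trans) pairwise_rcons andb_idl //.
move: small; rewrite all_cat /= => /and3P[s1 _ s2].
have hd : head 0 (rcons R N) = head 0 R by case: (R) R0.
have -> : all (row_ok^~ (rcons R N)) T1 = all (row_ok^~ R) T1.
  apply: eq_in_all => S /(allP s1) sS /=; rewrite /row_ok triple_ok_rcons_r // hd //.
have -> : all (row_ok (rcons R N)) T2 =
    all (row_ok R) T2 && all (fun S => size S != size R) T2.
  rewrite -all_predI; apply: eq_in_all => S /(allP s2) sS /=.
  by rewrite /row_ok triple_ok_rcons_l // hd andbA.
by rewrite -!andbA; do ?bool_congr.
Qed.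

Lemma tab_ok_new : T2 = [::] -> R = [::] -> all (fun S => S != [::]) T1 ->
  tab_ok (T1 ++ [:: [:: N]]) = tab_ok T1.
Proof.
move=> T20 R0 n1; rewrite /tab_ok all_cat pairwise_cat /= allrel1r !andbT.
suff -> : all (row_ok^~ [:: N]) T1 by [].
move: small; rewrite all_cat => /andP[s1 _].
apply/allP => S ST; have sS := allP s1 _ ST; rewrite /row_ok.
have -> : head 0 S < head 0 [:: N].
  by have := allP n1 _ ST; rewrite -nth0 => nS; apply: nth_lt; rewrite // lt0n size_eq0.
apply/triple_okP => l lS /=; rewrite ltnS leqn0 => /eqP l0; rewrite l0 /=.
by have := nth_lt sS lS; rewrite l0; lia.
Qed.

End AddMax.

Lemma flatten_entryP (T : seq (seq nat)) m :
  reflect (exists r c, c < size (nth [::] T r) /\ entry T r c = m)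
          (m \in flatten T).
Proof.
apply: (iffP flattenP) => [[R /(nthP [::])[r rT <-]] /(nthP 0)[c cR <-]|].
  by exists r, c.
case=> r [c [cR <-]]; exists (nth [::] T r); last exact: mem_nth.
by apply: mem_nth; rewrite ltnNge; apply: contraL cR => /(nth_default [::]) ->.
Qed.

Lemma nth_shape (T : seq (seq nat)) i : nth 0 (shape T) i = size (nth [::] T i).
Proof.
case: (ltnP i (size T)) => iT; first by rewrite (nth_map [::]).
by rewrite !nth_default ?size_map.
Qed.

Lemma column_of_entry T r c : uniq (flatten T) -> c < size (nth [::] T r) ->
  column_of T (entry T r c) = c.
Proof.
move=> uT cT; have cs : c < nth 0 (shape T) r by rewrite nth_shape.
have E : nth 0 (flatten T) (flatten_index (shape T) r c) = entry T r c.
  by rewrite nth_flatten flatten_indexKl // flatten_indexKr.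
rewrite /column_of -E index_uniq ?flatten_indexKr // size_flatten.
exact: flatten_indexP.
Qed.

Fixpoint place_pos (k N : nat) (T : seq (seq nat)) : seq (seq nat) :=
  if T is R :: T' then
    if k \in shape T' then R :: place_pos k N T'
    else if size R == k then rcons R N :: T' else T
  else [::].

Definition place (k N : nat) (T : seq (seq nat)) : seq (seq nat) :=
  if k == 0 then rcons T [:: N] else place_pos k N T.

(** [R] is the row to be extended, [T2] the rows below it; for [k = 0] the row
    is a new empty one at the bottom. *)
Definition split_at_last (k : nat) (R : seq nat) (T2 : seq (seq nat)) : bool :=
  if k == 0 then (R == [::]) && (T2 == [::])
  else (size R == k) && (k \notin shape T2).

(** An empty row [R] does not count as a row of the tableau. *)
Definition base (T1 : seq (seq nat)) (R : seq nat) (T2 : seq (seq nat)) :=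
  if R == [::] then T1 else T1 ++ R :: T2.

Lemma place_split k N T1 R T2 : split_at_last k R T2 ->
  place k N (base T1 R T2) = T1 ++ rcons R N :: T2.
Proof.
rewrite /split_at_last /place /base; case: eqP => [_ /andP[/eqP -> /eqP ->]|k0].
  by rewrite eqxx cats1.
case/andP=> /eqP Rk kT2; rewrite ifN; last by rewrite -size_eq0 Rk; apply/eqP.
elim: T1 => [|S T1 IHT1] /=; first by rewrite (negPf kT2) Rk eqxx.
by rewrite IHT1 ifT // /shape map_cat mem_cat /= Rk inE eqxx orbT.
Qed.

Lemma split_ex k T a : up k (shape T) = Some a -> exists T1 R T2,
  [/\ split_at_last k R T2, T = base T1 R T2 &
   forall N, shape (T1 ++ rcons R N :: T2) = a].
Proof.
rewrite /up /split_at_last /base; case: eqP => [k0 [<-]|k0].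
  exists T, [::], [::]; split=> // N.
  by rewrite /shape map_cat /= cats1.
elim: T a => //= R T IHT a; case U: (up_pos k (shape T)) => [b|].
  case=> <-; have [T1 [S [T2 [/andP[h1 h2] h3 h4]]]] := IHT _ U.
  exists (R :: T1), S, T2; rewrite h1 h2; split=> // [|N].
    by move: h3; rewrite ifN ?[in X in _ -> X]ifN -?size_eq0 ?(eqP h1) ?(introF eqP k0) //= => ->.
  by rewrite -(h4 N).
case: eqP => // Rk [<-]; exists [::], R, T; split=> //=.
- by rewrite Rk eqxx -up_pos_None U.
- by rewrite ifN // -size_eq0 Rk; apply/eqP.
by move=> N; rewrite size_rcons Rk.
Qed.

Definition column_word (T : seq (seq nat)) : seq nat :=
  [seq column_of T m | m <- rev (iota 1 (size (flatten T)))].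

Fixpoint tableau_of (w : seq nat) : seq (seq nat) :=
  if w is k :: w' then place k (size w').+1 (tableau_of w') else [::].

Lemma flatten_base T1 R T2 N k : split_at_last k R T2 ->
  perm_eq (flatten (T1 ++ rcons R N :: T2)) (N :: flatten (base T1 R T2)).
Proof.
move=> sp; have -> : flatten (base T1 R T2) = flatten (T1 ++ R :: T2).
  rewrite /base; case: eqP sp => // ->; rewrite /split_at_last /=.
  by case: eqP => [_ /eqP ->|k0 /andP[/eqP E]]; [rewrite !flatten_cat /= cats0 | rewrite -E in k0].
by apply/permP => p; rewrite !flatten_cat /= -cats1 !count_cat /=; lia.
Qed.

Lemma entry_base T1 R T2 N r c k : split_at_last k R T2 ->
  c < size (nth [::] (base T1 R T2) r) ->
  c < size (nth [::] (T1 ++ rcons R N :: T2) r) /\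
  entry (T1 ++ rcons R N :: T2) r c = entry (base T1 R T2) r c.
Proof.
move=> sp; have E r' : nth [::] (base T1 R T2) r' = nth [::] (T1 ++ R :: T2) r'.
  rewrite /base; case: eqP sp => // ->; rewrite /split_at_last /=.
  case: eqP => [_ /eqP ->|k0 /andP[/eqP E]]; last by rewrite -E in k0.
  by rewrite cats1 nth_rcons; case: ltngtP => // [?|->]; rewrite nth_default //; lia.
rewrite /entry E !nth_cat; case: (ltnP r (size T1)) => // rT; case: (r - size T1) => [|r'] //= cR.
by rewrite size_rcons nth_rcons cR; split=> //; apply: ltnW.
Qed.

Lemma column_word_place T1 R T2 k n : split_at_last k R T2 ->
  perm_eq (flatten (base T1 R T2)) (iota 1 n) ->
  column_word (T1 ++ rcons R n.+1 :: T2) = k :: column_word (base T1 R T2).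
Proof.
move=> sp pT; have pT' := flatten_base T1 n.+1 sp.
have pT2 : perm_eq (flatten (T1 ++ rcons R n.+1 :: T2)) (iota 1 n.+1).
  apply: perm_trans pT' _; rewrite -[X in iota 1 X]addn1 iotaD /= add1n perm_sym.
  by rewrite perm_catC /= perm_cons perm_sym.
have uT : uniq (flatten (base T1 R T2)) by rewrite (perm_uniq pT) iota_uniq.
have uT2 : uniq (flatten (T1 ++ rcons R n.+1 :: T2)) by rewrite (perm_uniq pT2) iota_uniq.
rewrite /column_word (perm_size pT) (perm_size pT2) !size_iota -[X in iota 1 X]addn1 iotaD rev_cat /= add1n.
congr (_ :: _).
  have -> : k = size R.
    by move: sp; rewrite /split_at_last; case: eqP => [-> /andP[/eqP ->]|_ /andP[/eqP ->]].
  have nE : nth [::] (T1 ++ rcons R n.+1 :: T2) (size T1) = rcons R n.+1.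
    by rewrite nth_cat ltnn subnn.
  have E : entry (T1 ++ rcons R n.+1 :: T2) (size T1) (size R) = n.+1.
    by rewrite /entry nE nth_rcons ltnn eqxx.
  by rewrite -[X in column_of _ X]E column_of_entry // nE size_rcons.
apply/eq_in_map => m; rewrite mem_rev -(perm_mem pT) => /flatten_entryP[r [c [cT <-]]].
have [c2 E2] := entry_base n.+1 sp cT.
by rewrite (column_of_entry uT) // -E2 column_of_entry.
Qed.

Lemma perm_iotaS n : perm_eq (n.+1 :: iota 1 n) (iota 1 n.+1).
Proof.
suff -> : iota 1 n.+1 = iota 1 n ++ [:: n.+1] by rewrite perm_sym perm_catC.
by rewrite -[X in iota 1 X = _]addn1 iotaD add1n.
Qed.

Lemma grow_comp w a : grow w = Some a -> is_comp a /\ sumn a = size w.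
Proof.
elim: w a => [|k w IHw] a /=; first by case=> <-.
case R: (grow w) => [b|] //= ub; have [cb sb] := IHw _ R.
by rewrite (up_comp ub cb) (up_sumn ub) sb.
Qed.

Lemma small_base T1 R T2 k n : split_at_last k R T2 ->
  perm_eq (flatten (base T1 R T2)) (iota 1 n) ->
  all (all (gtn n.+1)) (T1 ++ R :: T2).
Proof.
move=> sp pT; have : all (all (gtn n.+1)) (base T1 R T2).
  apply/allP => S ST; apply/allP => m mS.
  have : m \in iota 1 n by rewrite -(perm_mem pT); apply/flattenP; exists S.
  by rewrite mem_iota /=; lia.
rewrite /base; case: eqP sp => // ->; rewrite /split_at_last /=.
case: eqP => [_ /eqP ->|k0 /andP[/eqP E]]; last by rewrite -E in k0.
by rewrite all_cat /= => ->.
Qed.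

(** The heart of the encoding: extending the lowest row of a given length by a
    new largest entry always preserves the tableau conditions. *)
Lemma tab_ok_grow T1 R T2 k n : split_at_last k R T2 ->
  perm_eq (flatten (base T1 R T2)) (iota 1 n) ->
  all (fun S => S != [::]) (base T1 R T2) ->
  tab_ok (T1 ++ rcons R n.+1 :: T2) = tab_ok (base T1 R T2).
Proof.
move=> sp pT; have sm := small_base sp pT; move: sp; rewrite /base; case: eqP => [R0|/eqP R0].
  rewrite /split_at_last; case: eqP => [_ /andP[_ /eqP T20] n1|k0 /andP[/eqP E]]; last first.
    by rewrite -E R0 in k0.
  by rewrite R0 T20; apply: tab_ok_new (sm) T20 R0 n1.
rewrite /split_at_last; case: eqP => [_ /andP[/eqP R1]|k0 /andP[/eqP E kT] _]; first by rewrite R1 in R0.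
rewrite (tab_ok_rcons sm R0) andb_idr // => _; apply/allP => S ST; rewrite E.
by apply: contra kT => /eqP <-; apply: map_f.
Qed.

Lemma comp_nonnil a (T : seq (seq nat)) : shape T = a -> is_comp a -> all (fun S => S != [::]) T.
Proof.
move=> <- /allP h; apply/allP => S ST; rewrite -size_eq0 -lt0n.
exact/h/map_f.
Qed.

Lemma tableau_of_spec w a : grow w = Some a -> tableau_of w \in SYCT a /\ column_word (tableau_of w) = w.
Proof.
elim: w a => [|k w IHw] a r.
  by case: r => <-; rewrite mem_SYCT.
move: (r) => /=; case R: (grow w) => [b|] //= ub; have [cb sb] := grow_comp R.
have [ca sa] := grow_comp r; have [] := IHw _ R.
rewrite mem_SYCT => /and3P[/eqP sT pT oT] wT.
rewrite -sT in ub; have [T1 [S [T2 [sp TE sh]]]] := split_ex ub.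
rewrite sb in pT; rewrite TE in sT pT oT wT *; rewrite (place_split _ _ sp).
rewrite (column_word_place sp pT) wT mem_SYCT sh eqxx /= sa (tab_ok_grow sp pT) ?oT ?andbT.
  split=> //; apply: perm_trans (flatten_base T1 _ sp) _.
  by apply: perm_trans (perm_iotaS _); rewrite perm_cons.
exact: comp_nonnil sT cb.
Qed.

(** Conversely the largest entry of a tableau sits at the end of a row, and by
    the triple rule this row was the lowest of its length before the entry was
    added. *)
Lemma SYCT_tableau_of a T : is_comp a -> T \in SYCT a -> exists2 w, grow w = Some a & T = tableau_of w.
Proof.
move Dn: (sumn a) => n; elim: n a T Dn => [|n IHn] a T sa ca.
  have {ca} a0 : a = [::] by case: a ca sa => //= x a /andP[x0 _]; lia.
  rewrite {sa}a0; rewrite mem_SYCT => /andP[/eqP sT _]; exists [::] => //.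
  by case: T sT.
rewrite mem_SYCT sa => /and3P[/eqP sT pT oT].
have : n.+1 \in flatten T by rewrite (perm_mem pT) mem_iota; lia.
case/flattenP => R' R'T; case: (splitPr R'T) oT pT sT => T1 T2 oT pT sT nR'.
have sR' : sorted ltn R' by move: oT; rewrite /tab_ok all_cat /= => /andP[/and3P[]].
have bd m : m \in flatten (T1 ++ R' :: T2) -> m <= n.+1.
  by rewrite (perm_mem pT) mem_iota; lia.
have [R RE] : exists R, R' = rcons R n.+1.
  case/lastP: R' nR' sR' bd {oT pT sT R'T} => // R y nR sR bd; exists R; congr rcons.
  apply/eqP; rewrite eqn_leq bd /=; last first.
    by rewrite flatten_cat mem_cat /= mem_cat mem_rcons inE eqxx orbT.
  move: nR; rewrite mem_rcons inE => /orP[/eqP -> //|nR]; apply: ltnW.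
  move: sR; rewrite (sorted_pairwise ltn_trans) pairwise_rcons => /andP[/allP/(_ _ nR)//].
subst R'.
have nT := comp_nonnil sT ca.
have [k sp] : exists k, split_at_last k R T2.
  case: (eqVneq R [::]) => [R0|R0].
    exists 0; rewrite /split_at_last /= R0 /=.
    case: T2 {sR' nR'} oT pT nT bd sT => // S T2 oT pT nT bd sT; exfalso.
    move: oT; rewrite /tab_ok pairwise_cat R0 /= => /and5P[_ _ _ /andP[+ _] _].
    rewrite /row_ok /=; move: nT; rewrite all_cat /= => /and4P[_ _ S0 _].
    move: bd => /(_ (head 0 S)); rewrite ltnNge => -> //.
    rewrite flatten_cat mem_cat /= !mem_cat; case: S S0 {sT pT} => //= y S _.
    by rewrite inE eqxx !orbT.
  exists (size R); rewrite /split_at_last size_eq0 (negPf R0) eqxx /=.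
  have sm : all (all (gtn n.+1)) (T1 ++ R :: T2).
    apply/allP => S ST; apply/allP => m mS /=.
    have mT : m \in flatten (T1 ++ R :: T2) by apply/flattenP; exists S.
    have pp : perm_eq (flatten (T1 ++ rcons R n.+1 :: T2)) (n.+1 :: flatten (T1 ++ R :: T2)).
      by apply/permP => p; rewrite !flatten_cat /= -cats1 !count_cat /= ; lia.
    rewrite ltn_neqAle bd ?(perm_mem pp) ?inE ?mT ?orbT // andbT.
    have: uniq (n.+1 :: flatten (T1 ++ R :: T2)) by rewrite -(perm_uniq pp) (perm_uniq pT) iota_uniq.
    by case/andP => + _; apply: contra => /eqP <-.
  move: oT; rewrite (tab_ok_rcons sm R0) => /andP[_ /allP h].
  by apply/negP => /mapP[S /h /eqP E1 E2]; apply: E1.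
have pb : perm_eq (flatten (base T1 R T2)) (iota 1 n).
  rewrite -(perm_cons n.+1) -(permPl (flatten_base T1 n.+1 sp)) (permPl pT).
  by rewrite perm_sym perm_iotaS.
pose b := shape (base T1 R T2).
have nb : all (fun S => S != [::]) (base T1 R T2).
  rewrite /base; case: eqP => [_|/eqP R0]; move: nT; rewrite !all_cat /= => /and3P[-> //].
  by rewrite R0.
have cb : is_comp b.
  by apply/allP => x /mapP[S /(allP nb) S0 ->]; rewrite /= lt0n size_eq0.
have [||w rw TE] := IHn b (base T1 R T2) _ cb.
- by rewrite /b -size_flatten (perm_size pb) size_iota.
- rewrite mem_SYCT /b eqxx -size_flatten (perm_size pb) size_iota pb /=.
  by rewrite -(tab_ok_grow sp pb nb).
have [_ sw] := grow_comp rw.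
have sn : size w = n by rewrite -sw /b -size_flatten (perm_size pb) size_iota.
exists (k :: w); last by rewrite /= -TE (place_split _ _ sp) sn.
rewrite /= rw /=; have kb : (k == 0) || (k \in b).
  move: sp; rewrite /split_at_last /b /base; case: eqP => //= k0 /andP[/eqP E _].
  by rewrite -size_eq0 E (introF eqP k0) /shape map_cat mem_cat /= inE E eqxx orbT.
have [a' ua] := up_def kb; rewrite ua; congr Some.
have [T1' [S [T2' [sp' TE' sh]]]] := split_ex ua.
by rewrite -(sh n.+1) -(place_split _ _ sp') -TE' (place_split _ _ sp).
Qed.

Lemma grow_column_word a T : is_comp a -> T \in SYCT a -> grow (column_word T) = Some a.
Proof. by move=> ca /(SYCT_tableau_of ca)[w rw ->]; have [_ ->] := tableau_of_spec rw. Qed.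

Lemma column_word_inj a : is_comp a -> {in SYCT a &, injective column_word}.
Proof.
move=> ca T1 T2 /(SYCT_tableau_of ca)[w1 r1 ->] /(SYCT_tableau_of ca)[w2 r2 ->].
by rewrite (tableau_of_spec r1).2 (tableau_of_spec r2).2 => ->.
Qed.

Definition words a := map column_word (SYCT a).

Lemma mem_words a w : is_comp a -> (w \in words a) = (grow w == Some a).
Proof.
move=> ca; apply/mapP/eqP => [[T TS ->]|rw]; first exact: grow_column_word.
by have [TS wE] := tableau_of_spec rw; exists (tableau_of w).
Qed.

Lemma words_uniq a : is_comp a -> uniq (words a).
Proof. by move=> ca; rewrite map_inj_in_uniq ?SYCT_uniq //; apply: column_word_inj. Qed.

(** * Column words and fundamental series *)

Lemma count_pairsE P s :
  count_pairs P s = \sum_(b <- s) \sum_(c <- s) (P b c : nat).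
Proof.
rewrite /count_pairs -sum1_count big_mkcond big_allpairs_dep /=.
by apply: eq_bigr => b _; apply: eq_bigr => c _; case: (P b c).
Qed.

Lemma map_entry_boxes T : [seq entry T b.1 b.2 | b <- boxes (shape T)] = flatten T.
Proof.
rewrite /boxes /skew_boxes map_flatten -map_comp; congr flatten.
rewrite size_map -[RHS](mkseq_nth [::]) /mkseq.
apply/eq_in_map => i; rewrite mem_iota /= => iT.
rewrite nth_nil subn0 -map_comp nth_shape -[RHS](mkseq_nth 0) /mkseq.
by apply: eq_map.
Qed.

Lemma coinv_map (f : nat -> nat) n :
  coinv (map f (rev (iota 1 n))) =
  \sum_(x <- iota 1 n) \sum_(y <- iota 1 n) ((f x < f y) && (y < x) : nat).
Proof.
elim: n => [|n IHn]; first by rewrite big_nil.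
have iE : iota 1 n.+1 = rcons (iota 1 n) n.+1 by rewrite -[n.+1]addn1 iotaD cats1 add1n addn1.
rewrite iE rev_rcons /= IHn -[in RHS]cats1 big_cat big_seq1 /=.
congr (_ + _).
  rewrite [LHS]big_seq [RHS]big_seq; apply: eq_bigr => x; rewrite mem_iota => xn.
  have nx : (n.+1 < x) = false by lia.
  by rewrite big_cat big_seq1 nx andbF /= addn0.
rewrite big_cat big_seq1 !ltnn /= addn0 -sum1_count big_map big_mkcond.
rewrite (perm_big (iota 1 n)) /=; last by rewrite perm_rev.
rewrite [LHS]big_seq [RHS]big_seq; apply: eq_bigr => x; rewrite mem_iota => xn.
by rewrite (_ : x < n.+1) ?andbT; [case: ltnP | lia].
Qed.

(** An entry lies in a smaller column than a smaller entry exactly when the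
    corresponding letters of the word are in increasing order. *)
Lemma col_inv_column_word a T : T \in SYCT a -> col_inv T = coinv (column_word T).
Proof.
rewrite mem_SYCT => /and3P[/eqP sT pT _].
have uT : uniq (flatten T) by rewrite (perm_uniq pT) iota_uniq.
rewrite /column_word coinv_map (perm_size pT) size_iota.
under [RHS]eq_bigr do rewrite -(perm_big _ pT) /=.
rewrite -(perm_big _ pT) /= -map_entry_boxes /col_inv count_pairsE big_map.
have colE b : b \in boxes (shape T) -> column_of T (entry T b.1 b.2) = b.2.
  by case: b => i j; rewrite mem_boxes nth_shape => /(column_of_entry uT).
rewrite [LHS]big_seq [RHS]big_seq; apply: eq_bigr => b bT.
rewrite big_map [LHS]big_seq [RHS]big_seq; apply: eq_bigr => c cT.
by rewrite !colE.
Qed.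

Definition incr (a : seq nat) : seq nat := (head 0 a).+1 :: behead a.

(** The composition whose partial sums are the positions of the true bits; a
    composition of [n.+1] has [n] bits. *)
Fixpoint bits_comp (d : seq bool) : seq nat :=
  if d is b :: d' then if b then 1 :: bits_comp d' else incr (bits_comp d') else [:: 1].

Lemma bits_comp_neq0 d : bits_comp d != [::]. Proof. by case: d => //= -[]. Qed.

Lemma bits_comp_comp d : is_comp (bits_comp d).
Proof. by elim: d => //= -[] //= d; case: (bits_comp d) => //= x s /andP[]. Qed.

Lemma sumn_bits_comp d : sumn (bits_comp d) = (size d).+1.
Proof.
by elim: d => //= -[] //= d; have := bits_comp_neq0 d; case: (bits_comp d) => //= x s _; lia.
Qed.

Lemma refines_cons b x a : refines b (x :: a) <->
  exists b1 b2, [/\ b = b1 ++ b2, sumn b1 = x & refines b2 a].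
Proof.
split=> [[[|b1 bs] //= <- [<- <-]]|[b1 [b2 [-> <- [bs <- <-]]]]].
  by exists b1, (flatten bs); split=> //; exists bs.
by exists (b1 :: bs).
Qed.

(** Refinement is inclusion of the sets of partial sums. *)
Lemma refines_bits_comp d' d : size d' = size d ->
  refines (bits_comp d') (bits_comp d) <-> all2 implb d d'.
Proof.
elim: d' d => [|b' d' IHd] [|b d] //=.
  by split=> // _; exists [:: [:: 1]].
case=> /IHd {}IHd; have c' := bits_comp_comp d'; have n' := bits_comp_neq0 d'.
have n := bits_comp_neq0 d; have cd := bits_comp_comp d.
case: b => /=; case: b' => /=; rewrite -?IHd.
- split=> [/refines_cons[[|y b1] [b2 [//= [<- E] [sb] rb]]]|h]; last first.
    by apply/refines_cons; exists [:: 1], (bits_comp d').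
  suff b10 : b1 = [::] by rewrite E b10.
  by case: b1 E sb => // z b1 E /= sb; move: c'; rewrite E /= => /andP[z0 _]; lia.
- split=> // /refines_cons[[|y b1] [b2 [//= [E _] [sb] rb]]].
  by case: (bits_comp d') n' c' E => //= z b0 _ /andP[z0 _] [E]; lia.
- case: (bits_comp d) n => //= x a _; split=> /refines_cons.
    case=> [[|y b1] [b2 [//= [<- E] [sb] rb]]].
    by apply/refines_cons; exists b1, b2; split=> //; lia.
  case=> b1 [b2 [-> <- rb]]; apply/refines_cons; exists (1 :: b1), b2.
  by split.
case: (bits_comp d) n cd => //= x a _ cd; case: (bits_comp d') n' c' => //= z b0 _ /andP[z0 _].
rewrite /incr /=; split=> /refines_cons.
  case=> [[|y b1] [b2 [//= [<- E] [sb] rb]]].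
  by apply/refines_cons; exists (z :: b1), b2; rewrite E; split.
case=> [[|y b1] [b2 [/= E sb rb]]]; first by move: cd sb => /= /andP[x0 _]; lia.
case: E sb => <- -> sb; apply/refines_cons; exists (z.+1 :: b1), b2.
by split=> //=; lia.
Qed.

Definition monomial_word (b w : seq nat) : Prop :=
  exists2 s : seq nat, sorted ltn s /\ size s = size b
    & w = flatten [seq nseq p.1 p.2 | p <- zip b s].

Definition ascent_bits (i : nat) (w : seq nat) : seq bool := pairmap (fun x y => x < y) i w.

(** The words of a monomial quasisymmetric function: the composition is read
    off the positions where the letters increase. *)
Lemma monomial_word_bits b i w : is_comp b ->
  monomial_word b (i :: w) <-> sorted leq (i :: w) /\ b = bits_comp (ascent_bits i w).
Proof.
elim: w i b => [|j w IHw] i b cb.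
  split=> [[s [ss sb]]|[_ ->]]; last by exists [:: i].
  case: b cb s ss sb => [|[|x] [|y b]] // cb [|h s] // ss [sb] [E0]; subst h.
    by case: x {cb} => //; split.
  by case: x cb => //= cb; case: s ss sb => //= z s _ _; case: y cb.
split.
  case=> s [ss sb]; case: b cb s ss sb => [|[|[|x]] b] // cb [|h s] // ss [sb] [E0] /=; subst h.
    move=> E; have mb : monomial_word b (j :: w).
      by exists s => //; split=> //; apply: path_sorted ss.
    have [/(_ mb)[so bE] _] := IHw j b cb.
    have ij : i < j.
      case: b s {IHw mb bE} cb ss sb E => [|[|y] b] // [|j0 s] //= _ /andP[hj _] _ [-> _] //.
    by move: so => /= ->; rewrite ij -bE (ltnW ij).
  case=> E1 E2; rewrite {j}E1 in IHw *.
  have mb : monomial_word (x.+1 :: b) (i :: w) by exists (i :: s); rewrite /= ?E2 ?sb.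
  have [/(_ mb)[so bE] _] := IHw i (x.+1 :: b) cb.
  by move: so => /= ->; rewrite leqnn ltnn -bE.
case=> /= /andP[ij so] bE; have [_ h] := IHw j (bits_comp (ascent_bits j w)) (bits_comp_comp _).
have [s [ss sb] E] := h (conj so erefl).
move: bE; case: ltnP => ij' bE.
  exists (i :: s); last by rewrite bE E.
  split; last by rewrite bE /= sb.
  case: (bits_comp _) (bits_comp_neq0 (ascent_bits j w)) (bits_comp_comp (ascent_bits j w)) sb E => //= [[|y] b'] // _ _.
  by case: s ss => //= j0 s ss _ [E0 _]; subst j0; rewrite ij'.
have ii : i = j by lia.
exists s; first by split=> //; rewrite bE sb; case: (bits_comp _) (bits_comp_neq0 (ascent_bits j w)).
rewrite bE ii E; case: (bits_comp _) (bits_comp_neq0 (ascent_bits j w)) (bits_comp_comp (ascent_bits j w)) sb E => //= [[|y] b'] // _ _.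
by case: s ss => //= j0 s _ _ [<- _].
Qed.

Lemma monomial_word_nil b : is_comp b -> monomial_word b [::] <-> b = [::].
Proof.
case: b => [|[|x] b] // cb; first by split=> // _; exists [::].
by split=> // -[[|h s] []].
Qed.

Lemma comp_of_descents_bits_comp n (P : pred nat) :
  comp_of_descents n.+1 [seq m <- iota 1 n | P m] = bits_comp [seq P m | m <- iota 1 n].
Proof.
rewrite /comp_of_descents /= -[n.+1]/(0 + n).+1.
elim: n 0 => [|n IHn] d /=; first by rewrite addn0 subSn ?subnn.
rewrite -addSnnS -IHn; case: (P _) => /=; first by rewrite subSn ?subnn.
case E: (rcons _ _) => [|h t]; first by case: (filter _ _) E.
have : h \in rcons [seq m <- iota d.+2 n | P m] (d.+1 + n).+1 by rewrite E inE eqxx.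
rewrite mem_rcons inE mem_filter mem_iota => hh /=; rewrite /incr /=; congr (_ :: _); lia.
Qed.

(** Biwords in decreasing order of values and, for equal values, in strictly
    decreasing order of columns.  When [kap] is the column word of a tableau, a
    value is repeated only at positions that are not descents, because the
    entries of the tableau are read from the largest down. *)
Definition compat (kap v : seq nat) : bool :=
  (size kap == size v) && sorted lexgt (zip kap v).

Lemma lex_bits k i ks ws : size ks = size ws ->
  path (fun p q => lexgt q p) (k, i) (zip ks ws) =
  path leq i ws && all2 implb (pairmap (fun x y => y <= x) k ks) (ascent_bits i ws).
Proof.
elim: ks ws k i => [|k' ks IHk] [|i' ws] k i //= [/IHk ->].
rewrite {1}/lexgt /=; case: ltngtP => //= _; first by rewrite implybT.
by rewrite implybF ltnNge; case: (k' <= k); rewrite /= ?andbF.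
Qed.

Lemma compat_rev kap w : size kap = size w ->
  compat (rev kap) (rev w) = sorted (fun p q => lexgt q p) (zip kap w).
Proof. by move=> sz; rewrite /compat !size_rev sz eqxx -rev_zip // rev_sorted. Qed.

Lemma bits_iota (f : nat -> nat) d n :
  pairmap (fun x y => y <= x) (f d) (map f (iota d.+1 n)) =
  [seq f m.+1 <= f m | m <- iota d n].
Proof. by elim: n d => //= n IHn d; rewrite IHn. Qed.

Section Ring.
Variable k : comPzRingType.
Local Open Scope ring_scope.

Lemma sum_ncseries (I : Type) (r : seq I) (P : pred I) (F : I -> ncseries k) w :
  (\sum_(i <- r | P i) F i) w = \sum_(i <- r | P i) F i w.
Proof. by rewrite (big_morph (fun f : ncseries k => f w) (id1 := 0) (op1 := +%R)). Qed.

Lemma sum_single (I : eqType) (cs : seq I) (R : pred I) (M : pred I) b0 M0 : uniq cs ->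
  {in cs, forall b, M b = M0 && (b == b0)} ->
  \sum_(b <- cs | R b) (M b)%:R = [&& M0, R b0 & b0 \in cs]%:R :> k.
Proof.
move=> ucs hM; case: (boolP (b0 \in cs)) => b0cs; last first.
  rewrite !andbF big1_seq // => b /andP[_ bcs]; rewrite hM //.
  by case: eqP => [E|_]; [rewrite E (negPf b0cs) in bcs | rewrite andbF].
rewrite big_mkcond (bigD1_seq b0) //= big1_seq ?addr0 => [|b /andP[bb bcs]].
  by rewrite hM // eqxx !andbT; case: (R b0); rewrite ?andbT ?andbF.
by rewrite hM // (negPf bb) andbF; case: ifP.
Qed.

(** The fundamental function of the descent composition of a tableau is the sum
    of the weakly increasing words that increase strictly at its descents. *)
Lemma OQ_fundamental_column_word a T : T \in SYCT a ->
  OQ_fundamental k (desc_comp T) =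
  skew_pi (fun w => (compat (column_word T) (rev w))%:R : k).
Proof.
rewrite mem_SYCT => /and3P[/eqP sT pT _].
have sz : size (flatten T) = sumn a by rewrite (perm_size pT) size_iota.
rewrite /OQ_fundamental /OQ_monomial -rmorph_sum; congr skew_pi; apply/funext => w.
rewrite sum_ncseries -[X in compat X]revK -map_rev revK.
set kap := map _ _; have skap : size kap = size (flatten T) by rewrite size_map size_iota.
rewrite /desc_comp /descents; move: skap; rewrite /kap {kap}.
(* Bits describe the compositions of positive integers only. *)
case: (size (flatten T)) => [_|n skap] /=.
  rewrite big_cons big_nil addr0 asboolT; last by exists [::].
  congr (nat_of_bool _)%:R; apply/asboolP/idP => [[[|h s] [//= _ _] ->] //|].
  rewrite /compat !size_rev => /andP[/eqP sw _]; have -> : w = [::] by case: (w) sw.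
  by exists [::].
rewrite (comp_of_descents_bits_comp n (fun m => column_of T m.+1 <= column_of T m)%N).
rewrite sumn_bits_comp size_map size_iota -/(iota 1 n.+1) -[_ :: _]/(map (column_of T) (iota 1 n.+1)).
set kap := map _ _ in skap *.
case: w => [|i w].
  rewrite /compat size_rev skap big1_seq // => b /andP[_]; rewrite mem_compositions => /andP[cb sb].
  by rewrite asboolF // => /(monomial_word_nil cb) bE; rewrite bE in sb.
rewrite (@sum_single _ _ _ _ (bits_comp (ascent_bits i w)) (sorted leq (i :: w))) ?compositions_uniq //; last first.
  move=> b; rewrite mem_compositions => /andP[cb _]; apply/asboolP/andP.
    by move=> /(monomial_word_bits _ _ cb)[-> ->].
  by move=> [so /eqP bE]; apply/(monomial_word_bits _ _ cb).
rewrite mem_compositions bits_comp_comp sumn_bits_comp size_pairmap /=; congr (nat_of_bool _)%:R.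
case: (eqVneq (size w) n) => sw; last first.
  by rewrite /compat !size_rev skap !eqSS [n == _]eq_sym (negPf sw) !andbF.
rewrite compat_rev ?skap /= ?sw // eqxx andbT /kap /= lex_bits ?size_map ?size_iota //.
congr (_ && _); apply/asboolP/idP; rewrite bits_iota ?refines_bits_comp ?size_pairmap ?size_map ?size_iota //.
Qed.
End Ring.

(** * Normal forms in the skew ring *)

Section NormalForm.
Variable k : comPzRingType.
Local Open Scope ring_scope.
Implicit Types f g : ncseries k.

Definition word_series (u : seq nat) : ncseries k := fun w => (w == u)%:R.

Definition scale (c : k) f : ncseries k := fun w => c * f w.

(** In this form the closure of the ideal under products applies to scalars. *)
Lemma scaleE c f : scale c f = scale c 1 * f.
Proof.
apply/funext => w.
by rewrite -[RHS]/(ncmul (fun v => c * ncone k v) f w) ncmulZl ncmul1f.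
Qed.

Lemma word_series_cat u v : word_series (u ++ v) = word_series u * word_series v.
Proof.
apply/funext => w; rewrite -[RHS]/(ncmul (word_series u) (word_series v) w) /ncmul /word_series.
transitivity (\sum_(i < (size w).+1) ((take i w == u) && (drop i w == v))%:R : k); last first.
  by apply: eq_bigr => i _; rewrite -natrM mulnb.
case: (eqVneq w (u ++ v)) => [->|wuv].
  have su : (size u < (size (u ++ v)).+1)%N by rewrite size_cat; lia.
  rewrite (bigD1 (Ordinal su)) //= take_size_cat // drop_size_cat // !eqxx big1 ?addr0 //.
  move=> i /negP ii; case: eqP => // ti; case: ii; rewrite -val_eqE /=; apply/eqP.
  by rewrite -[in RHS]ti size_takel // -ltnS.
rewrite big1 // => i _; case: eqP => //= ti; case: eqP => //= di.
by rewrite -ti -di cat_take_drop eqxx in wuv.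
Qed.

Definition eqv f g := anticomm_ideal (f - g).

Lemma eqv_refl f : eqv f f. Proof. by rewrite /eqv subrr; apply: anticomm0. Qed.

Lemma eqv_trans f g h : eqv f g -> eqv g h -> eqv f h.
Proof. by move=> fg gh; rewrite /eqv -[f](subrK g) -addrA; apply: anticommD. Qed.

Lemma eqvMl f g h : eqv f g -> eqv (h * f) (h * g).
Proof. by rewrite /eqv -mulrBr; apply: anticommMl. Qed.

Lemma eqvMr f g h : eqv f g -> eqv (f * h) (g * h).
Proof. by rewrite /eqv -mulrBl; apply: anticommMr. Qed.

Lemma eqvZ c f g : eqv f g -> eqv (scale c f) (scale c g).
Proof. by rewrite (scaleE c f) (scaleE c g); apply: eqvMl. Qed.

Lemma scale_scale c d f : scale c (scale d f) = scale (c * d) f.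
Proof. by apply/funext => w; rewrite /scale mulrA. Qed.

Lemma scale1 f : scale 1 f = f.
Proof. by apply/funext => w; rewrite /scale mul1r. Qed.

Lemma scaleMl c f g : scale c f * g = scale c (f * g).
Proof. by rewrite (scaleE c f) -mulrA -scaleE. Qed.

Lemma word_series_swap x z : (z < x)%N ->
  eqv (word_series [:: x; z]) (scale (-1) (word_series [:: z; x])).
Proof.
move=> zx; have -> : scale (-1) (word_series [:: z; x]) = - word_series [:: z; x].
  by apply/funext => w; rewrite /scale mulN1r.
by rewrite /eqv opprK -[[:: x; z]]cat1s -[[:: z; x]]cat1s !word_series_cat; apply: anticomm_rel.
Qed.

Lemma word_series_insert s z t : sorted leq s -> sorted leq t -> perm_eq t (rcons s z) ->
  eqv (word_series (rcons s z)) (scale ((-1) ^+ count (ltn z) s) (word_series t)).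
Proof.
elim/last_ind: s t => [|s x IHs] t ss st pt.
  rewrite scale1; have -> : t = [:: z] by apply: perm_small_eq.
  exact: eqv_refl.
have ts : sorted leq s by move: ss; rewrite -cats1 => /cat_sorted2[].
have sx : all (geq x) s by move: ss; rewrite (sorted_pairwise leq_trans) pairwise_rcons => /andP[].
case: (leqP x z) => xz.
  have -> : count (ltn z) (rcons s x) = 0%N.
    apply/eqP; rewrite -leqn0 leqNgt -has_count; apply/hasPn => y.
    rewrite mem_rcons inE => /orP[/eqP ->|/(allP sx)] /=; lia.
  have -> : t = rcons (rcons s x) z.
    apply: (sorted_eq leq_trans anti_leq) st _ pt.
    rewrite (sorted_pairwise leq_trans) pairwise_rcons -(sorted_pairwise leq_trans) ss andbT.
    apply/allP => y; rewrite mem_rcons inE => /orP[/eqP ->//|/(allP sx)] /=; lia.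
  by rewrite scale1; apply: eqv_refl.
have stz := sort_sorted leq_total (rcons s z).
have -> : t = rcons (sort leq (rcons s z)) x.
  apply: (sorted_eq leq_trans anti_leq) st _ _.
    rewrite (sorted_pairwise leq_trans) pairwise_rcons -(sorted_pairwise leq_trans) stz andbT.
    apply/allP => y; rewrite mem_sort mem_rcons inE => /orP[/eqP -> |/(allP sx)] /=; lia.
  apply: perm_trans pt _; apply/permP => p.
  by rewrite -!cats1 !count_cat /= !(permP (permEl (perm_sort _ _))) count_cat /=; lia.
have -> : word_series (rcons (rcons s x) z) = word_series s * word_series [:: x; z].
  by rewrite -word_series_cat -!cats1 -catA.
apply: eqv_trans (eqvMl _ (word_series_swap xz)) _.
have -> : word_series s * scale (-1) (word_series [:: z; x]) = scale (-1) (word_series (rcons s z) * word_series [:: x]).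
  rewrite -!word_series_cat; have -> : scale (-1) (word_series [:: z; x]) = - word_series [:: z; x].
    by apply/funext => w; rewrite /scale mulN1r.
  rewrite mulrN -word_series_cat -cats1 -catA /=.
  by apply/funext => w; rewrite /scale mulN1r.
rewrite -[rcons (sort _ _) x]cats1 word_series_cat -[rcons s x]cats1 count_cat /= xz addn1 exprS -scale_scale.
apply: eqvZ; rewrite -scaleMl; apply: eqvMr.
by apply: IHs => //; rewrite perm_sort.
Qed.

(** Adjacent distinct letters anticommute, so that a word equals its sorted
    rearrangement up to the sign of its strict inversions. *)
Lemma word_series_sort u t : sorted leq t -> perm_eq t u ->
  eqv (word_series u) (scale ((-1) ^+ coinv (rev u)) (word_series t)).
Proof.
elim/last_ind: u t => [|u z IHu] t st pt.
  have -> : t = [::] by apply/perm_nilP.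
  by rewrite scale1; apply: eqv_refl.
rewrite rev_rcons /= exprD -scale_scale -{1}cats1 word_series_cat.
apply: eqv_trans (eqvMr _ (IHu (sort leq u) (sort_sorted leq_total u) _)) _.
  by rewrite perm_sort.
rewrite scaleMl; apply: eqvZ; rewrite -word_series_cat cats1.
have -> : count (ltn z) (rev u) = count (ltn z) (sort leq u).
  by apply/permP; rewrite perm_rev perm_sym perm_sort.
apply: word_series_insert => //; first exact: sort_sorted leq_total u.
by apply: perm_trans pt _; rewrite -!cats1 perm_cat2r perm_sym perm_sort.
Qed.

(** A representative of the class of [f] supported on weakly increasing words. *)
Definition normal_form f : ncseries k := fun w =>
  if sorted leq w then \sum_(u <- permutations w) (-1) ^+ coinv (rev u) * f u else 0.

Lemma ideal_sum (I : Type) (r : seq I) (F : I -> ncseries k) :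
  (forall i, anticomm_ideal (F i)) -> anticomm_ideal (\sum_(i <- r) F i).
Proof.
by move=> h; elim/big_rec: _ => [|i f _ hf]; [apply: anticomm0 | apply: anticommD].
Qed.

(** The ideal is closed, so it is enough to treat the finitely many words that
    are rearrangements of a finite list of given words. *)
Lemma skew_pi_normal_form f : skew_pi f = skew_pi (normal_form f).
Proof.
apply/skew_piP/anticomm_closureP => s.
(* The rearrangements of the words at which agreement is asked for. *)
pose U := undup (flatten [seq permutations w | w <- s]).
exists (\sum_(u <- U) scale (f u)
   (word_series u - scale ((-1) ^+ coinv (rev u)) (word_series (sort leq u)))).
  apply: ideal_sum => u; rewrite scaleE; apply: anticommMl.
  by apply: word_series_sort; rewrite ?sort_sorted ?perm_sort //; apply: leq_total.
move=> w ws; rewrite sum_ncseries -[LHS]/(f w - normal_form f w).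
have UE u : perm_eq u w -> u \in U.
  by rewrite mem_undup -mem_permutations => uw; apply/flattenP; exists (permutations w); rewrite ?map_f.
have -> : f w = \sum_(u <- U) f u * word_series u w.
  rewrite (bigD1_seq w) ?undup_uniq ?UE //= /word_series eqxx mulr1 big1 ?addr0 // => u uw.
  by rewrite eq_sym (negPf uw) mulr0.
suff -> : normal_form f w = \sum_(u <- U) f u * ((-1) ^+ coinv (rev u) * word_series (sort leq u) w).
  by rewrite -sumrB; apply: eq_bigr => u _; rewrite -mulrBr.
rewrite /normal_form; case: ifP => sw; last first.
  rewrite big1 // => u _; rewrite /word_series; case: eqP => [E|]; last by rewrite !mulr0.
  by rewrite E sort_sorted // in sw; apply: leq_total.
transitivity (\sum_(u <- U | sort leq u == w) (-1) ^+ coinv (rev u) * f u).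
  rewrite -[RHS]big_filter; apply: perm_big; apply: uniq_perm.
  - exact: permutations_uniq.
  - by rewrite filter_uniq ?undup_uniq.
  move=> u; rewrite mem_permutations mem_filter.
  apply/idP/andP => [uw|[/eqP <- _]]; last by rewrite perm_sym perm_sort.
  split; last exact: UE.
  apply/eqP/(sorted_eq leq_trans anti_leq) => //; first exact: sort_sorted leq_total _.
  by rewrite perm_sort.
rewrite big_mkcond; apply: eq_bigr => u _; rewrite /word_series [w == _]eq_sym.
by case: eqP; rewrite ?mulr0 // mulr1 mulrC.
Qed.

End NormalForm.

(** * Multiplying by monotone words *)

Definition col_height (j : nat) (a : seq nat) : nat := count (ltn j) a.

Lemma down_col_height c a b j : down c a = Some b -> col_height j a = col_height j b + (j == c).
Proof.
by move=> /down_count /(_ (ltn j) isT) /=; rewrite /col_height; lia.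
Qed.

Lemma downs_col_height cs a b j : downs cs b = Some a -> col_height j b = col_height j a + count_mem j cs.
Proof.
elim: cs a => [|c cs IHcs] a; first by case=> <-; rewrite addn0.
by move=> /downs_cons[d /IHcs -> /(down_col_height j) ->] /=; rewrite [c == j]eq_sym; lia.
Qed.

Lemma downs_sumn cs a b : downs cs b = Some a -> sumn b = sumn a + size cs.
Proof.
elim: cs a => [|c cs IHcs] a; first by case=> <-; rewrite addn0.
by move=> /downs_cons[d /IHcs -> /down_sumn ->] /=; lia.
Qed.

Lemma downs_perm cs cs' a b : downs cs b = Some a -> downs cs' b = Some a -> perm_eq cs cs'.
Proof.
move=> h h'; apply/allP => j _; apply/eqP.
by have := downs_col_height j h; rewrite (downs_col_height j h') => /addnI/esym.
Qed.

(** The flag chooses between the two Pieri rules: the words of the second factor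
    are weakly increasing for horizontal strips and strictly decreasing for
    vertical strips, and the chains of removals are monotone accordingly. *)
Definition letter_rel (h : bool) : rel nat := if h then leq else gtn.
Definition chain_rel (h : bool) : rel nat := if h then ltn else geq.

(** The multiset of removed columns is determined by the heights of the columns
    of the two shapes. *)
Lemma downs_uniq h cs cs' a b : downs cs b = Some a -> downs cs' b = Some a ->
  sorted (chain_rel h) cs -> sorted (chain_rel h) cs' -> cs = cs'.
Proof.
move=> d d'; have p := downs_perm d d'; case: h => /= s s'.
  by apply: (irr_sorted_eq ltn_trans ltnn s s'); apply: perm_mem.
by apply: (sorted_eq geq_trans _ s s' p) => x y /=; lia.
Qed.

Section Product.
Variable k : comPzRingType.
Local Open Scope ring_scope.

Lemma ncseries_sign m (f : ncseries k) w : ((-1) ^+ m * f) w = (-1) ^+ m * f w.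
Proof.
by rewrite -signr_odd -[in RHS]signr_odd; case: (odd m); rewrite ?mul1r ?mulN1r.
Qed.

(** The series represents the Schur function by column words; it is supported on
    weakly increasing words. *)
Definition schur_series (a : seq nat) : ncseries k := fun w =>
  (-1) ^+ NE (tilde a) *
  \sum_(kap <- words a) (-1) ^+ coinv kap * (compat kap (rev w))%:R.

Lemma OQ_schurE a : is_comp a -> OQ_schur k a = skew_pi (schur_series a).
Proof.
move=> ca; rewrite /OQ_schur.
rewrite (eq_big_seq (fun T => skew_pi ((-1) ^+ coinv (column_word T) *
     ((fun w => (compat (column_word T) (rev w))%:R) : ncseries k)))); last first.
  by move=> T TS; rewrite (OQ_fundamental_column_word k TS) (col_inv_column_word TS) rmorphMsign.
rewrite -rmorph_sum -rmorphMsign; congr skew_pi; apply/funext => w.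
rewrite ncseries_sign sum_ncseries /schur_series big_map; congr (_ * _).
by apply: eq_bigr => T _; rewrite ncseries_sign.
Qed.

Definition row_series (h : bool) (n : nat) : ncseries k := fun w =>
  ((size w == n) && sorted (letter_rel h) w)%:R.

Lemma ncmulE (f g : ncseries k) w :
  (f * g) w = \sum_(i < (size w).+1) f (take i w) * g (drop i w).
Proof. by []. Qed.

Section Expansion.
Variables (h : bool) (alpha : seq nat) (n : nat).
Hypothesis calpha : is_comp alpha.

(** A term [x] of the product is a column word of shape [alpha] together with a
    word.  The letters of the first factor come first in the word and are paired
    with the columns; the remaining ones are to be inserted. *)
Definition start (x : seq nat * seq nat) : seq (nat * nat) :=
  zip x.1 (rev (take (sumn alpha) x.2)).

Definition tail_of (x : seq nat * seq nat) := drop (sumn alpha) x.2.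

Definition image_of (x : seq nat * seq nat) : seq nat :=
  unzip1 (inserts (start x) (tail_of x)).1.

Definition good (x : seq nat * seq nat) : bool :=
  compat x.1 (rev (take (sumn alpha) x.2)) && sorted (letter_rel h) (tail_of x).

(** The terms of the product that contribute to the coefficient of [w] in the
    normal form. *)
Definition domain w := [seq x <- [seq (kap, u) | kap <- words alpha, u <- permutations w] | good x].

Lemma normal_form_product w :
  normal_form (schur_series alpha * row_series h n) w =
  if (size w == sumn alpha + n)%N && sorted leq w then
    \sum_(x <- domain w) (-1) ^+ (NE (tilde alpha) + coinv x.1 + coinv (rev x.2))
  else 0.
Proof.
rewrite /normal_form; case: (sorted leq w); rewrite ?andbF // andbT.
pose p := sumn alpha.
have sz kap : kap \in words alpha -> size kap = p.
  by rewrite mem_words // => /eqP /grow_comp[_ <-].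
(* Only the cut of a word after its first [sumn alpha] letters contributes. *)
have A0 (u : seq nat) i : (i < (size u).+1)%N -> i != p -> schur_series alpha (take i u) = 0.
  move=> iu ip; rewrite /schur_series big1_seq ?mulr0 // => kap /sz sk.
  by rewrite /compat size_rev size_takel // sk eq_sym (negPf ip) mulr0.
case: (eqVneq (size w) (p + n)%N) => sw; last first.
  rewrite big1_seq // => u; rewrite mem_permutations => /perm_size su.
  rewrite ncmulE big1 ?mulr0 // => i _; case: (eqVneq (i : nat) p) => ip; last first.
    by rewrite A0 ?mul0r.
  rewrite /row_series; case: eqP => [E|_]; rewrite ?mulr0 //.
  by case/eqP: sw; rewrite -E size_drop -ip subnKC; [rewrite su | rewrite -ltnS].
rewrite /domain big_filter [RHS]big_mkcond big_allpairs_dep /= exchange_big /=.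
rewrite [LHS]big_seq [RHS]big_seq; apply: eq_bigr => u; rewrite mem_permutations => /perm_size su.
have pu : (p < (size u).+1)%N by rewrite su sw; lia.
rewrite ncmulE (bigD1 (Ordinal pu)) //= [X in _ * (_ + X)]big1 ?addr0; last first.
  by move=> i ip; rewrite A0 ?mul0r.
have -> : row_series h n (drop p u) = (sorted (letter_rel h) (tail_of ([::], u)))%:R.
  by rewrite /row_series size_drop su sw addKn eqxx.
rewrite /schur_series !mulr_sumr mulr_suml mulr_sumr.
apply: eq_bigr => kap _; rewrite /good /=.
case: (compat _ _); rewrite /= ?mulr0 ?mul0r ?mulr0 // /tail_of /=.
case: (sorted _ _); rewrite ?mulr0 // !mulr1.
by rewrite -!exprD; congr (_ ^+ _); lia.
Qed.

(** All that the insertion of the second factor yields.  The insertion sorts the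
    word, so that the value line of the resulting biword is [rev w], and its
    column line is a column word of a shape [b] above [alpha].  The parity
    combines the sign of sorting the word with the signs of the column words. *)
Lemma good_state x w : x \in domain w -> sorted leq w -> size w = (sumn alpha + n)%N ->
  exists b, [/\ is_comp b, sumn b = (sumn alpha + n)%N,
    grow (image_of x) = Some b, compat (image_of x) (rev w) &
    [/\ zip (image_of x) (rev w) = (inserts (start x) (tail_of x)).1,
       downs (inserts (start x) (tail_of x)).2 b = Some alpha,
       sorted (chain_rel h) (inserts (start x) (tail_of x)).2,
       size (inserts (start x) (tail_of x)).2 = n &
       odd (coinv (image_of x)) =
       odd (coinv x.1 + coinv (rev x.2) + chain_right (inserts (start x) (tail_of x)).2 b)]].
Proof.
case: x => kap u; rewrite mem_filter => /andP[gx /allpairsP[[kap' u'] /= [+ + [E1 E2]]]] sw zw.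
rewrite -{kap'}E1 -{u'}E2 mem_permutations mem_words // => /eqP rk pu.
have su := perm_size pu; have [ca sk] := grow_comp rk.
move: gx; rewrite /good /= => /andP[/andP[/eqP skt so] st].
have r0 : grow (unzip1 (start (kap, u))) = Some alpha by rewrite unzip1_zip // skt.
have u2 : unzip2 (start (kap, u)) = rev (take (sumn alpha) u) by rewrite unzip2_zip // skt.
have [b [rb db]] := inserts_grow (tail_of (kap, u)) r0.
have [cb sb] := grow_comp rb; have szn : size (tail_of (kap, u)) = n.
  by rewrite size_drop su zw addKn.
have so' := inserts_sorted (tail_of (kap, u)) r0 so.
have u2E : unzip2 (inserts (start (kap, u)) (tail_of (kap, u))).1 = rev w.
  apply: (sorted_eq geq_trans) (lexgt_unzip2 so') _ _.
  - by move=> x y /=; lia.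
  - by rewrite rev_sorted.
  apply: perm_trans (inserts_perm _ _) _; rewrite u2 /tail_of /= perm_catC.
  apply: (perm_trans (y := u)); last by rewrite perm_sym perm_rev perm_sym.
  by rewrite -[X in perm_eq _ X](cat_take_drop (sumn alpha)) perm_cat2r perm_rev.
have zE : zip (image_of (kap, u)) (rev w) = (inserts (start (kap, u)) (tail_of (kap, u))).1.
  by rewrite -u2E zip_unzip.
exists b; split=> //.
- by rewrite (downs_sumn db) inserts_size szn.
- by rewrite /compat zE so' andbT -u2E !size_map.
split=> //.
- have [o1 o2] := inserts_order (tail_of (kap, u)) r0; move: st.
  by rewrite /letter_rel /chain_rel; case: (h) => /=; rewrite ?o1 ?o2.
- by rewrite inserts_size.
rewrite /image_of (inserts_parity r0 so rb) u2 unzip1_zip ?skt //=.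
have -> : rev u = catrev (tail_of (kap, u)) (rev (take (sumn alpha) u)).
  by rewrite -[in LHS](cat_take_drop (sumn alpha) u) rev_cat catrevE.
have sv : sorted geq (rev (take (sumn alpha) u)) by rewrite -u2; apply: lexgt_unzip2.
by rewrite coinv_catrev (coinv_sorted sv) add0n.
Qed.
Variables (Q : pred (seq nat)) (H : seq nat -> nat).
Hypothesis QP : forall b, is_comp b -> sumn b = (sumn alpha + n)%N ->
  (Q b <-> exists cs, [/\ size cs = n, sorted (chain_rel h) cs & downs cs b = Some alpha]).
Hypothesis HP : forall b cs, is_comp b -> size cs = n -> sorted (chain_rel h) cs ->
  downs cs b = Some alpha -> odd (chain_right cs b) = odd (H b).

(** The terms contributing to the coefficient of [w] in the expansion over the
    shapes [b] selected by [Q]. *)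
Definition targets w := [seq kap | b <- [seq b <- compositions (sumn alpha + n) | Q b],
   kap <- [seq kap <- words b | compat kap (rev w)]].

(** The insertion is a bijection.  A column word determines its shape [b], hence
    the monotone chain of removals, so nothing is lost by forgetting the chain. *)
Lemma perm_image w : sorted leq w -> size w = (sumn alpha + n)%N ->
  perm_eq (map image_of (domain w)) (targets w).
Proof.
move=> sw zw; apply: uniq_perm.
- rewrite map_inj_in_uniq => [|x y xd yd E].
    rewrite filter_uniq // allpairs_uniq ?words_uniq ?permutations_uniq //.
    by move=> [? ?] [? ?] _ _ [-> ->].
  have [b [_ _ rb _ [zx dx sx _ _]]] := good_state xd sw zw.
  have [b' [_ _ rb' _ [zy dy sy _ _]]] := good_state yd sw zw.
  have bb : b = b' by move: rb; rewrite E rb' => -[].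
  rewrite -{b' rb'}bb in dy.
  have cE := downs_uniq dx dy sx sy.
  have iE : inserts (start x) (tail_of x) = inserts (start y) (tail_of y).
    move: zx zy cE; rewrite E => -> + ; by case: (inserts _ _) (inserts _ _) => ? ? [? ?] /= -> ->.
  move: xd yd; rewrite !mem_filter => /andP[gx /allpairsP[[kx ux] /= [kx1 ux1 xE]]].
  move=> /andP[gy /allpairsP[[ky uy] /= [ky1 uy1 yE]]]; subst x y.
  move: kx1 ky1; rewrite !mem_words // => /eqP rkx /eqP rky.
  move: gx gy; rewrite /good /= => /andP[/andP[/eqP szx _] _] /andP[/andP[/eqP szy _] _].
  have r1 : grow (unzip1 (start (kx, ux))) = Some alpha by rewrite unzip1_zip // szx.
  have r2 : grow (unzip1 (start (ky, uy))) = Some alpha by rewrite unzip1_zip // szy.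
  have [sE tE] := inserts_inj r1 r2 iE.
  have := congr1 unzip1 sE; rewrite !unzip1_zip ?szx ?szy //= => ->.
  have := congr1 unzip2 sE; rewrite !unzip2_zip ?szx ?szy //= => /(can_inj revK) uE.
  by rewrite -[ux](cat_take_drop (sumn alpha)) uE -[drop _ _]/(tail_of (kx, ux)) tE cat_take_drop.
(* Distinct shapes have distinct column words. *)
- apply: allpairs_uniq_dep => [|b|].
  + by rewrite filter_uniq ?compositions_uniq.
  + rewrite mem_filter mem_compositions => /and3P[_ cb _].
    by rewrite filter_uniq ?words_uniq.
  move=> [b kap] [b' kap'] /allpairsPdep[b1 [k1 [+ + [E1 E2]]]] /allpairsPdep[b2 [k2 [+ + [E3 E4]]]] /= E.
  subst b1 b2 k1 k2 kap'.
  rewrite !mem_filter !mem_compositions => /and3P[_ cb _] + /and3P[_ cb' _].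
  rewrite !mem_words // => /andP[_ /eqP rk] /andP[_ /eqP rk'].
  by move: rk; rewrite rk' => -[->].
move=> kap; apply/mapP/allpairsPdep => [[x xd ->]|[b [kap' [+ + ->]]]].
  have [b [cb sb rb cmp [zx dx sx nx _]]] := good_state xd sw zw.
  have qb : Q b by apply/(QP cb sb); eexists; split; [exact: nx | exact: sx | exact: dx].
  by exists b, (image_of x); rewrite !mem_filter mem_compositions qb cb sb mem_words // rb !eqxx cmp.
rewrite !mem_filter mem_compositions => /and3P[qb cb /eqP sb].
rewrite mem_words // => /andP[/andP[/eqP sk so] /eqP rk].
(* The preimage is extracted along the chain of removals of [b]. *)
have [cs [ncs scs dcs]] := (QP cb sb).1 qb.
have rk1 : grow (unzip1 (zip kap' (rev w))) = Some b by rewrite unzip1_zip // sk.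
have [s [zs [rs ss iE]]] := inserts_surj rk1 dcs so.
have [_ szs] := grow_comp rs; rewrite size_map in szs.
have tk : take (sumn alpha) (rev (unzip2 s) ++ zs) = rev (unzip2 s).
  by rewrite take_size_cat // size_rev size_map szs.
have dr : drop (sumn alpha) (rev (unzip2 s) ++ zs) = zs.
  by rewrite drop_size_cat // size_rev size_map szs.
have st : start (unzip1 s, rev (unzip2 s) ++ zs) = s by rewrite /start /= tk revK zip_unzip.
have tl : tail_of (unzip1 s, rev (unzip2 s) ++ zs) = zs by rewrite /tail_of /= dr.
exists (unzip1 s, rev (unzip2 s) ++ zs); last first.
  by rewrite /image_of st tl iE /= unzip1_zip // sk.
rewrite mem_filter /good tl /= tk revK /compat zip_unzip ss !size_map eqxx /=; apply/andP; split.
  have [o1 o2] := inserts_order zs rs; move: scs; rewrite -[cs]/((zip kap' (rev w), cs).2) -iE.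
  by rewrite /letter_rel /chain_rel; case: (h) => /=; rewrite ?o1 ?o2.
apply/allpairsP; exists (unzip1 s, rev (unzip2 s) ++ zs); split=> //=.
  by rewrite mem_words // rs.
rewrite mem_permutations; have := inserts_perm s zs; rewrite iE unzip2_zip ?sk // => pw.
apply: (perm_trans (y := zs ++ unzip2 s)); last by rewrite -(permPl pw) perm_rev.
by rewrite perm_catC perm_cat2l perm_rev.
Qed.

(** Both sides have the same normal form: the terms are matched by the insertion
    and their signs differ by the parity of [chain_right] along the chain of
    removals, which depends on [b] only. *)
Lemma schur_product_expansion :
  skew_pi (schur_series alpha) * skew_pi (row_series h n) =
  \sum_(b <- compositions (sumn alpha + n) | Q b)
    (-1) ^+ (NE (tilde alpha) + NE (tilde b) + H b) * OQ_schur k b.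
Proof.
have -> : skew_pi (schur_series alpha) * skew_pi (row_series h n) =
    skew_pi (normal_form (schur_series alpha * row_series h n)).
  by rewrite -skew_pi_normal_form rmorphM.
rewrite [RHS]big_seq_cond (eq_bigr (fun b => skew_pi
   ((-1) ^+ (NE (tilde alpha) + NE (tilde b) + H b) * schur_series b))); last first.
  by move=> b /andP[]; rewrite mem_compositions => /andP[cb _] _; rewrite OQ_schurE // rmorphMsign.
rewrite -rmorph_sum -big_seq_cond; congr skew_pi; apply/funext => w.
rewrite normal_form_product sum_ncseries; case: ifP => [/andP[/eqP zw sw]|]; last first.
  move=> /negbT nw; rewrite big1_seq // => b; rewrite mem_compositions => /and3P[_ cb /eqP sb].
  rewrite ncseries_sign /schur_series big1_seq ?mulr0 // => kap; rewrite mem_words //.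
  move=> /eqP /grow_comp[_ sk]; rewrite (_ : compat kap (rev w) = false) ?mulr0 //.
  apply/negP => /andP[/eqP sz /lexgt_unzip2]; rewrite unzip2_zip ?sz // rev_sorted => sw.
  by case/negP: nw; rewrite sw andbT -sb sk sz size_rev.
transitivity (\sum_(kap <- map image_of (domain w))
    (-1) ^+ (NE (tilde alpha) + H (odflt [::] (grow kap)) + coinv kap) : k).
  rewrite big_map [LHS]big_seq [RHS]big_seq; apply: eq_bigr => x xd.
  have [b [cb sb rb cmp [zx dx sx nx par]]] := good_state xd sw zw.
  rewrite rb /= -signr_odd -[RHS]signr_odd; congr (_ ^+ (nat_of_bool _)).
  move: par (HP cb nx sx dx); rewrite !oddD; move: (odd (coinv (image_of x))) => p0.
  move: (odd (chain_right _ _)) (odd (coinv x.1)) => p1 p2.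
  move: (odd (coinv (rev x.2))) (odd (H b)) (odd (NE _)) => p3 p4 p5 -> ->.
  by case: p2 p3 p4 p5 => [] [] [] [].
rewrite (perm_big _ (perm_image sw zw)) /= big_allpairs_dep /= big_filter.
rewrite [LHS]big_seq_cond [RHS]big_seq_cond; apply: eq_bigr => b.
rewrite mem_compositions => /andP[/andP[cb _] qb].
rewrite ncseries_sign /schur_series big_filter mulr_sumr mulr_sumr.
rewrite big_mkcond [LHS]big_seq [RHS]big_seq; apply: eq_bigr => kap; rewrite mem_words // => /eqP -> /=.
case: (compat _ _); rewrite ?mulr0 ?mulr1 // -!exprD.
rewrite -signr_odd -[RHS]signr_odd !oddD; congr (_ ^+ (nat_of_bool _)).
move: (odd (NE (tilde alpha))) (odd (NE (tilde b))) (odd (H b)) (odd (coinv kap)).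
by do 4!case.
Qed.

End Expansion.
End Product.

(** * The one-row and one-column functions *)

Lemma up_row_shape k a n : up k a = Some [:: n.+1] ->
  k = n /\ a = (if n == 0 then [::] else [:: n]).
Proof.
rewrite /up; case: eqP => [-> [E]|k0].
  by case: a E => [|x a] /= [E] //; [rewrite -E | case: a E].
case: a => //= x a; case U: (up_pos k a) => [b|].
  by case=> _ E; rewrite E in U; case: a U => //= y a; case: (up_pos k a) => // ; case: eqP.
by case: eqP => // -> [<- ->]; split=> //; case: eqP.
Qed.

Lemma iota0S n : 0 :: iota 1 n = iota 0 n ++ [:: n].
Proof. by rewrite -[LHS]/(iota 0 n.+1) -[n.+1]addn1 iotaD. Qed.

(** A shape with one row, or with one column, has a single tableau. *)
Lemma grow_row_shape n kap : grow kap = Some (if n == 0 then [::] else [:: n]) <-> kap = rev (iota 0 n).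
Proof.
elim: n kap => [|n IHn] kap; split => [|->] //=.
- by move=> r; have [_ ] := grow_comp r; case: kap r.
- case: kap => //= k kap; case R: (grow kap) => [a|] //= /up_row_shape[-> aE].
  rewrite aE in R; move/IHn: R => ->.
  by rewrite iota0S rev_cat.
rewrite iota0S rev_cat /=; have /IHn -> : rev (iota 0 n) = rev (iota 0 n) by [].
by case: (n) => //= m; rewrite /up /= eqxx.
Qed.

Lemma up_col_shape k a n : up k a = Some (nseq n.+1 1) -> k = 0 /\ a = nseq n 1.
Proof.
have nE : nseq n.+1 1 = rcons (nseq n 1) 1 by elim: n => //= n <-.
rewrite /up; case: eqP => [-> [E]|k0].
  by split=> //; apply: (@rcons_injl _ 1); rewrite -nE.
move=> U; exfalso; have := up_in (k := k) (a := a) (b := nseq n.+1 1).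
by rewrite /up (introF eqP k0) => /(_ U); rewrite mem_nseq /= => /eqP [].
Qed.

Lemma grow_col_shape n kap : grow kap = Some (nseq n 1) <-> kap = nseq n 0.
Proof.
elim: n kap => [|n IHn] kap; split => [|->] //.
- by move=> r; have [_ ] := grow_comp r; case: kap r.
- case: kap => //= k kap; case R: (grow kap) => [a|] // /up_col_shape[-> aE].
  by rewrite aE in R; move/IHn: R => ->.
have /IHn /= -> : nseq n 0 = nseq n 0 by [].
by rewrite /up /=; congr Some; elim: (n) => //= m ->.
Qed.

Lemma words_single a kap : is_comp a -> (forall kap', grow kap' = Some a <-> kap' = kap) ->
  perm_eq (words a) [:: kap].
Proof.
move=> ca h; apply: uniq_perm => // [|kap']; first exact: words_uniq.
by rewrite mem_words // inE; apply/eqP/eqP => /h.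
Qed.

Lemma NE_row n : NE (tilde [:: n]) = 0.
Proof.
rewrite /tilde /NE /= count_pairsE big1_seq // => -[i j]; rewrite mem_boxes => /andP[_ ij].
rewrite big1_seq // => -[i' j']; rewrite mem_boxes => /andP[_ ij'] /=.
by case: i ij => [|i] /=; rewrite ?nth_nil.
Qed.

Lemma tilde_col n : tilde (nseq n 1) = nseq n 1.
Proof.
apply: sorted_sort; first exact: geq_trans.
by case: n => //= n; elim: n => //= n ->.
Qed.

Lemma NE_col n : NE (tilde (nseq n 1)) = 0.
Proof.
rewrite tilde_col /NE count_pairsE big1_seq // => -[i j]; rewrite mem_boxes => /andP[_ ij].
rewrite big1_seq // => -[i' j']; rewrite mem_boxes => /andP[_ ij'] /=.
move: ij'; rewrite nth_nseq; case: ifP => // _; case: j' => // _.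
by rewrite ltn0 andbF.
Qed.

Lemma coinv_ltn w : sorted ltn w -> coinv w = 'C(size w, 2).
Proof.
elim: w => //= x w IHw pw; rewrite IHw ?(path_sorted pw) // binS bin1; congr (_ + _).
apply/eqP; rewrite -all_count; apply: sub_all (order_path_min ltn_trans pw).
by [].
Qed.

Lemma compat_row n w : compat (rev (iota 0 n)) (rev w) = (size w == n) && sorted leq w.
Proof.
case: (eqVneq (size w) n) => sw; last first.
  by rewrite /compat !size_rev size_iota eq_sym (negPf sw).
rewrite compat_rev ?size_iota //; case: w n sw => [|i w] [|n] //= [sw].
rewrite lex_bits ?size_iota // andb_idr // => _.
have E := bits_iota id 0 n; rewrite map_id in E; rewrite E.
have: size (iota 0 n) = size (ascent_bits i w) by rewrite size_iota size_pairmap.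
by elim: (iota 0 n) (ascent_bits i w) => [|x s IHs] [|y t] //= [/IHs ->]; rewrite ltnn.
Qed.

Lemma compat_col n w : compat (nseq n 0) (rev w) = (size w == n) && sorted ltn w.
Proof.
case: (eqVneq (size w) n) => sw; last first.
  by rewrite /compat size_nseq size_rev eq_sym (negPf sw).
rewrite -[nseq n 0](revK) compat_rev; last by rewrite size_rev size_nseq.
have -> : rev (nseq n 0) = nseq n 0.
  apply: (@eq_from_nth _ 0); first by rewrite size_rev.
  by move=> i; rewrite size_rev size_nseq => ni; rewrite nth_rev size_nseq // !nth_nseq ni; case: ifP.
case: w n sw => [|i w] [|n] //= [<-] {n}.
by elim: w i => //= j w IHw i; rewrite IHw /lexgt /= ltnn andbF orbF.
Qed.

Section Rows.
Variable k : comPzRingType.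
Local Open Scope ring_scope.

Lemma OQ_schur_row n : (0 < n)%N -> OQ_schur k [:: n] = skew_pi (row_series k true n).
Proof.
case: n => // n _; rewrite OQ_schurE //; congr skew_pi; apply/funext => w.
have h kap : grow kap = Some [:: n.+1] <-> kap = rev (iota 0 n.+1) := grow_row_shape n.+1 kap.
rewrite /schur_series NE_row mul1r (perm_big _ (words_single _ h)) // big_seq1.
rewrite compat_row coinv_sorted ?mul1r //.
rewrite rev_sorted; apply: sub_sorted (iota_ltn_sorted 0 n.+1) => x y; exact: ltnW.
Qed.

Lemma col_comp n : is_comp (nseq n 1%N).
Proof. by rewrite /is_comp all_nseq orbT. Qed.

Lemma OQ_schur_col n : OQ_schur k (nseq n 1%N) =
  skew_pi ((fun w => ((size w == n) && sorted ltn w)%:R) : ncseries k).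
Proof.
rewrite OQ_schurE ?col_comp //; congr skew_pi; apply/funext => w.
rewrite /schur_series NE_col mul1r (perm_big _ (words_single (col_comp n) (grow_col_shape n))) // big_seq1.
rewrite compat_col coinv_sorted ?mul1r //.
by case: n => //= n; elim: n.
Qed.

Lemma sum_perm_single (w v : seq nat) (r : rel nat) (F : seq nat -> k) :
  perm_eq v w -> (forall u, perm_eq u w -> sorted r u -> u = v) ->
  \sum_(u <- permutations w) F u * (sorted r u)%:R = F v * (sorted r v)%:R.
Proof.
move=> vw uE; rewrite (bigD1_seq v) ?mem_permutations ?permutations_uniq //=.
rewrite big1_seq ?addr0 // => u; rewrite mem_permutations => /andP[uv uw].
case: (boolP (sorted r u)) => su; last by rewrite mulr0.
by rewrite (uE _ uw su) eqxx in uv.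
Qed.

(** Reversing a strictly monotone word of length [n] reverses all its pairs of
    letters.  This is the sign by which the rule for columns differs from the
    rule for rows. *)
Lemma skew_incr_decr n :
  skew_pi ((fun w => ((size w == n) && sorted ltn w)%:R) : ncseries k) =
  (-1) ^+ 'C(n, 2) * skew_pi (row_series k false n).
Proof.
rewrite -rmorphMsign skew_pi_normal_form [RHS]skew_pi_normal_form; congr skew_pi; apply/funext => w.
rewrite /normal_form; case: ifP => // sw.
have szu u : u \in permutations w -> size u = size w by rewrite mem_permutations => /perm_size.
transitivity (\sum_(u <- permutations w) ((-1) ^+ coinv (rev u) * (size w == n)%:R) * (sorted ltn u)%:R : k).
  by rewrite [LHS]big_seq [RHS]big_seq; apply: eq_bigr => u /szu ->; rewrite -mulrA -natrM mulnb.
transitivity (\sum_(u <- permutations w) ((-1) ^+ coinv (rev u) * (-1) ^+ 'C(n, 2) * (size w == n)%:R) * (sorted gtn u)%:R : k); last first.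
  rewrite [LHS]big_seq [RHS]big_seq; apply: eq_bigr => u /szu zu.
  by rewrite ncseries_sign /row_series zu -!mulrA -natrM mulnb.
(* The only candidates are [w] and, for the other relation, its reversal. *)
rewrite (@sum_perm_single w w ltn) //; last first.
  move=> u uw su; apply: (sorted_eq leq_trans anti_leq) => //.
  by apply: sub_sorted su => x y; apply: ltnW.
rewrite (@sum_perm_single w (rev w) gtn) ?perm_rev //; last first.
  move=> u uw su; apply: (sorted_eq geq_trans).
  - by move=> x y /=; lia.
  - by apply: sub_sorted su => x y /=; apply: ltnW.
  - by rewrite rev_sorted.
  by rewrite perm_sym perm_rev perm_sym.
have e : sorted gtn (rev w) = sorted ltn w by rewrite rev_sorted.
rewrite e revK coinv_sorted ?rev_sorted // mul1r.
case: (boolP (sorted ltn w)) => slw; last by rewrite !mulr0.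
rewrite !mulr1 (coinv_ltn slw).
case: eqP => [->|]; rewrite ?mulr0 ?mulr1 //.
by rewrite -signr_odd; case: (odd _); rewrite ?expr0 ?expr1 ?mulr1 ?mulrNN ?mulr1.
Qed.

End Rows.

(** * Chains of removals and strips *)

(** The passage between a partition and its transpose: removals are followed
    through the heights of the columns, which do not depend on the order of the
    parts, while strips are defined by rows. *)
Lemma part_col_height la i j : sorted geq la -> (j < nth 0 la i) = (i < col_height j la).
Proof.
rewrite /col_height; elim: la i => [|x la IHla] i sl; first by rewrite nth_nil.
case: i => [|i] /=; last first.
  rewrite IHla ?(path_sorted sl) //; case: (ltnP j x) => //= xj.
  have c0 : count (ltn j) la = 0.
    apply/eqP; rewrite -leqn0 leqNgt -has_count; apply/hasPn => y.
    by move=> /(allP (order_path_min geq_trans sl)) /=; lia.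
  by rewrite c0.
case: (ltnP j x) => xj //=; symmetry; apply/negbTE.
rewrite -leqNgt leqNgt -has_count; apply/hasPn => y.
by move=> /(allP (order_path_min geq_trans sl)) /=; lia.
Qed.

Lemma tilde_sorted a : sorted geq (tilde a).
Proof. by apply: sort_sorted => x y /=; lia. Qed.

Lemma tilde_perm a : perm_eq (tilde a) a. Proof. by rewrite perm_sort. Qed.

Lemma col_height_tilde j a : col_height j (tilde a) = col_height j a.
Proof. exact/permP/tilde_perm. Qed.

Lemma includedP la mu : sorted geq la -> sorted geq mu ->
  reflect (forall j, col_height j la <= col_height j mu) (included la mu).
Proof.
move=> sl sm; apply: (iffP allP) => [h j|h i _].
  rewrite leqNgt; apply/negP => jj; have := part_col_height (col_height j mu) j sm.
  rewrite ltnn; have := part_col_height (col_height j mu) j sl; rewrite jj => jl.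
  have := h (col_height j mu); rewrite mem_iota /= add0n => /(_ _) hh.
  suff: nth 0 la (col_height j mu) <= nth 0 mu (col_height j mu) by lia.
  by apply: hh; rewrite ltnNge; apply: contraL jl => /(nth_default 0) ->.
rewrite leqNgt; apply/negP => ii; have := part_col_height i (nth 0 mu i) sl.
rewrite ii => /esym; have := part_col_height i (nth 0 mu i) sm; rewrite ltnn => /esym.
by have := h (nth 0 mu i); lia.
Qed.

Lemma count_iota_between a b n : b <= n ->
  count (fun i => a <= i < b) (iota 0 n) = b - a.
Proof.
move=> bn; rewrite -(subnKC bn) iotaD count_cat add0n.
have -> : count (fun i => a <= i < b) (iota b (n - b)) = 0.
  apply/eqP; rewrite -leqn0 leqNgt -has_count; apply/hasPn => i; rewrite mem_iota; lia.
rewrite addn0; elim: b {n bn} => [|b IHb]; first by [].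
rewrite -[b.+1]addn1 iotaD count_cat /= add0n addn0 addn1.
rewrite (@eq_in_count _ _ (fun i => a <= i < b)); first by rewrite IHb; lia.
by move=> i; rewrite mem_iota; lia.
Qed.

Lemma count_cols la mu j : sorted geq la -> sorted geq mu ->
  count_mem j [seq b.2 | b <- skew_boxes mu la] = col_height j mu - col_height j la.
Proof.
move=> sl sm; rewrite count_map /skew_boxes.
transitivity (count (fun i => col_height j la <= i < col_height j mu) (iota 0 (size mu))).
  elim: (iota 0 (size mu)) => //= i s IHs; rewrite count_cat IHs; congr (_ + _).
  rewrite count_map (eq_count (a2 := pred1 j)) // count_uniq_mem ?iota_uniq // mem_iota.
  rewrite -(part_col_height _ _ sm) [col_height j la <= i]leqNgt -(part_col_height _ _ sl) -leqNgt; lia.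
exact: count_iota_between (count_size _ _).
Qed.

Lemma count_rows la mu i : count_mem i [seq b.1 | b <- skew_boxes mu la] = nth 0 mu i - nth 0 la i.
Proof.
rewrite count_map /skew_boxes.
have h s : uniq s -> count (preim fst (pred1 i)) [seq (i0, j) | i0 <- s,
     j <- iota (nth 0 la i0) (nth 0 mu i0 - nth 0 la i0)] =
     (i \in s) * (nth 0 mu i - nth 0 la i).
  elim: s => //= i0 s IHs /andP[ns us]; rewrite count_cat (IHs us) count_map inE.
  case: (eqVneq i i0) => [->|ii] /=.
    rewrite (negPf ns) mul1n addn0 (eq_count (a2 := predT)) ?count_predT ?size_iota //.
    by move=> j /=; rewrite eqxx.
  by rewrite (eq_count (a2 := pred0)) ?count_pred0 // => j /=; rewrite eq_sym (negPf ii).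
rewrite h ?iota_uniq // mem_iota /= add0n; case: ltnP => [|im]; first by rewrite mul1n.
by rewrite [nth 0 mu i]nth_default.
Qed.

Definition strip_cols (mu la : seq nat) : seq nat := sort leq [seq b.2 | b <- skew_boxes mu la].

Lemma strip_columnsE mu la : strip_columns mu la = map succn (strip_cols mu la).
Proof.
rewrite /strip_columns /strip_cols.
have -> : [seq b.2.+1 | b <- skew_boxes mu la] = map succn [seq b.2 | b <- skew_boxes mu la].
  by rewrite -map_comp.
by rewrite sort_map.
Qed.

(** Zero parts do not interfere with the removals, so that they may be deleted at
    each removal or only at the end. *)
Lemma rem_down c a : omap drop_zeros (rem_part c.+1 a) = down c (drop_zeros a).
Proof.
rewrite /rem_part; elim: a => //= x a IHa; rewrite inE.
case: (eqVneq c.+1 x) => [<-|cx] /=; first by rewrite eqxx; case: c {IHa}.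
case: x cx => [|x] cx /=; first by rewrite -IHa; case: (c.+1 \in a).
by rewrite [x.+1 == _]eq_sym (negPf cx) -IHa; case: (c.+1 \in a).
Qed.

Lemma row_op_downs cs b : is_comp b -> row_op (map succn cs) b = downs cs b.
Proof.
move=> cb; rewrite /row_op; have {2}-> : b = drop_zeros b by apply/esym/all_filterP.
elim: cs => //= c cs <-; case: (foldr _ _ _) => //= a; exact: rem_down.
Qed.

Lemma col_op_downs cs b : is_comp b -> col_op (map succn cs) b = downs (rev cs) b.
Proof.
move=> cb; rewrite -row_op_downs // /col_op /row_op map_rev.
by rewrite -[in LHS](revK (map succn cs)) foldl_rev.
Qed.

Section Chain.
Variables (alpha beta : seq nat) (cs : seq nat).
Hypothesis chain : downs cs beta = Some alpha.

Lemma chain_included : included (tilde alpha) (tilde beta).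
Proof.
apply/includedP; rewrite ?tilde_sorted // => j.
by rewrite !col_height_tilde (downs_col_height j chain) leq_addr.
Qed.

(** Every removal shortens one column by one box, in the composition and in its
    sorted rearrangement alike. *)
Lemma chain_cols : perm_eq [seq b.2 | b <- skew_boxes (tilde beta) (tilde alpha)] cs.
Proof.
apply/allP => j _; apply/eqP; rewrite count_cols ?tilde_sorted //.
by rewrite !col_height_tilde (downs_col_height j chain) addKn.
Qed.

Lemma chain_horizontal : sorted ltn cs -> strip_cols (tilde beta) (tilde alpha) = cs.
Proof.
move=> scs; apply: (sorted_eq leq_trans anti_leq).
- exact: sort_sorted leq_total _.
- by apply: sub_sorted scs => x y; apply: ltnW.
by rewrite perm_sort chain_cols.
Qed.

Lemma chain_vertical : sorted geq cs -> rev (strip_cols (tilde beta) (tilde alpha)) = cs.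
Proof.
move=> scs; rewrite -[RHS]revK; congr rev; apply: (sorted_eq leq_trans anti_leq).
- exact: sort_sorted leq_total _.
- by rewrite rev_sorted.
by rewrite perm_sort perm_sym perm_rev perm_sym chain_cols.
Qed.

Lemma chain_size : size (skew_boxes (tilde beta) (tilde alpha)) = size cs.
Proof. by rewrite -(perm_size chain_cols) size_map. Qed.

End Chain.

Lemma downs_count_top cs a b (j : nat) : downs cs b = Some a -> all (geq j) cs ->
  count_mem j.+1 b = count_mem j.+1 a + count_mem j cs.
Proof.
elim: cs a => [|c cs IHcs] a; first by case=> <-; rewrite addn0.
move=> /downs_cons[d dd dc] /= /andP[cj acs]; rewrite (IHcs _ dd acs).
have := down_count dc (p := pred1 j.+1) isT; rewrite /= eqSS.
have -> : (c == j.+1) = false by apply/negbTE; move: cj => /=; lia.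
by rewrite addn0 => ->; rewrite addnA.
Qed.

(** A decreasing chain removes from the smaller columns first, so that no removal
    acts on a part that another one has shortened. *)
Lemma downs_count_le cs a b (j : nat) : downs cs b = Some a -> sorted geq cs ->
  count_mem j cs <= count_mem j.+1 b.
Proof.
elim: cs a => [|c cs IHcs] a //= dd scs; case: (leqP c j) => cj.
  rewrite (@downs_count_top (c :: cs) a b j dd) ?leq_addl //=.
  rewrite cj; apply: sub_all (order_path_min geq_trans scs) => x /=; lia.
move: (dd); case D: (downs cs b) => [d|] // _.
have -> : (c == j) = false by apply/negbTE; lia.
exact: IHcs D (path_sorted scs).
Qed.

Lemma col_heightS (j : nat) b : col_height j b = col_height j.+1 b + count_mem j.+1 b.
Proof. by rewrite /col_height; elim: b => //= x b ->; lia. Qed.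

(** Let [j] be the length of row [i] of the smaller partition.  Were two boxes
    removed from this row, column [j.+1] of [beta] would be higher than column
    [j] of [alpha]; but [beta] loses in column [j] no more boxes than it has parts
    equal to [j.+1]. *)
Lemma chain_vertical_rows cs alpha beta : downs cs beta = Some alpha -> sorted geq cs ->
  uniq [seq b.1 | b <- skew_boxes (tilde beta) (tilde alpha)].
Proof.
move=> dd scs; apply/count_mem_uniq => i.
have le1 : count_mem i [seq b.1 | b <- skew_boxes (tilde beta) (tilde alpha)] <= 1.
  rewrite count_rows leq_subLR addn1 leqNgt; apply/negP.
  rewrite (part_col_height _ _ (tilde_sorted _)) => h.
  have := part_col_height i (nth 0 (tilde alpha) i) (tilde_sorted alpha); rewrite ltnn => /esym/negbT.
  rewrite -leqNgt; move: h; rewrite !col_height_tilde; set j := nth 0 _ _.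
  by have := downs_col_height j dd; have := col_heightS j beta; have := downs_count_le j dd scs; lia.
by rewrite -has_pred1 has_count; case: (count _ _) le1 => [|[|]].
Qed.

(** The operator row removes from the largest column down, and the columns of a
    horizontal strip are distinct; its removals thus form a strictly increasing
    chain, and conversely such a chain removes a horizontal strip. *)
Lemma horizontal_chain n alpha beta : is_comp beta ->
  (horizontal_strip n (tilde beta) (tilde alpha)
     && (row_op (strip_columns (tilde beta) (tilde alpha)) beta == Some alpha))
  <-> exists cs, [/\ size cs = n, sorted (chain_rel true) cs & downs cs beta = Some alpha].
Proof.
move=> cb; rewrite strip_columnsE row_op_downs //; split.
  case/andP=> /and3P[_ un /eqP sz] /eqP dd.
  exists (strip_cols (tilde beta) (tilde alpha)); split=> //.
    by rewrite size_sort size_map.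
  by rewrite /chain_rel /= ltn_sorted_uniq_leq sort_uniq un sort_sorted //; apply: leq_total.
case=> cs [ncs scs dd]; rewrite (chain_horizontal dd scs) dd eqxx andbT.
rewrite /horizontal_strip (chain_included dd) (perm_uniq (chain_cols dd)) (chain_size dd) ncs eqxx.
by move: scs; rewrite /chain_rel /= ltn_sorted_uniq_leq => /andP[->].
Qed.

(** The operator col removes from the smallest column up, in weakly decreasing
    chains. *)
Lemma vertical_chain n alpha beta : is_comp beta ->
  (vertical_strip n (tilde beta) (tilde alpha)
     && (col_op (strip_columns (tilde beta) (tilde alpha)) beta == Some alpha))
  <-> exists cs, [/\ size cs = n, sorted (chain_rel false) cs & downs cs beta = Some alpha].
Proof.
move=> cb; rewrite strip_columnsE col_op_downs //; split.
  case/andP=> /and3P[_ un /eqP sz] /eqP dd.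
  exists (rev (strip_cols (tilde beta) (tilde alpha))); split=> //.
    by rewrite size_rev size_sort size_map.
  by rewrite /chain_rel /= rev_sorted sort_sorted //; apply: leq_total.
case=> cs [ncs scs dd]; rewrite (chain_vertical dd scs) dd eqxx andbT.
by rewrite /vertical_strip (chain_included dd) (chain_vertical_rows dd scs) (chain_size dd) ncs eqxx.
Qed.

(** * Slides preserve descents *)

Definition occupied (h : option (nat * nat)) (f : nat -> nat -> nat) i j : bool :=
  (f i j != 0) || (h == Some (i, j)).

(** The intermediate stages of a slide: fillings with 0 outside of the diagram,
    of a skew shape with inner shape [la], in which the box [h] may be a hole.
    The diagram is convex, the entries are distinct and increase along rows
    and columns, across the hole as well. *)
Record punctured (la : seq nat) (h : option (nat * nat)) (f : nat -> nat -> nat) : Prop := Punctured {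
  punctured_part : forall i, nth 0 la i.+1 <= nth 0 la i;
  punctured_out : forall i j, j < nth 0 la i -> ~~ occupied h f i j;
  punctured_hole : forall i j, h = Some (i, j) -> f i j = 0;
  punctured_down : forall i j i' j', i <= i' -> j <= j' -> occupied h f i' j' ->
    (nth 0 la i <= j) -> occupied h f i j;
  punctured_mono : forall i j i' j', i <= i' -> j <= j' -> f i j != 0 -> f i' j' != 0 ->
    f i j <= f i' j';
  punctured_inj : forall i j i' j', f i j = f i' j' -> f i j != 0 -> (i, j) = (i', j')
}.

Definition has_value (f : nat -> nat -> nat) v := exists i j, f i j = v.

Definition descent (f : nat -> nat -> nat) a :=
  exists i j i' j', [/\ f i j = a, f i' j' = a.+1 & i < i'].

Definition ascent (f : nat -> nat -> nat) a :=
  exists i j i' j', [/\ f i j = a, f i' j' = a.+1 & j < j'].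

Section Punctured.
Variables (la : seq nat) (h : option (nat * nat)) (f : nat -> nat -> nat).
Hypothesis F : punctured la h f.

Lemma punctured_part_le i i' : i <= i' -> nth 0 la i' <= nth 0 la i.
Proof.
move=> /subnKC <-; elim: (i' - i) => [|n IHn]; first by rewrite addn0.
by rewrite addnS; apply: leq_trans IHn; apply: punctured_part F _.
Qed.

Lemma punctured_convex i j i' j' a b : occupied h f i j -> occupied h f i' j' ->
  i <= a <= i' -> j <= b <= j' -> occupied h f a b.
Proof.
move=> o o' /andP[ia ai] /andP[jb bj]; apply: (punctured_down F ai bj o').
apply: leq_trans jb; rewrite leqNgt; apply/negP => jl.
have := punctured_out F (i := i) (j := j); rewrite o => /(_ _)/negP; apply => //.
exact: leq_trans jl (punctured_part_le ia).
Qed.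

Lemma punctured_strict i j i' j' : i <= i' -> j <= j' -> f i j != 0 -> f i' j' != 0 ->
  (i, j) != (i', j') -> f i j < f i' j'.
Proof.
move=> ii jj n n' ne; rewrite ltn_neqAle (punctured_mono F ii jj n n') andbT.
by apply: contraNneq ne => /(punctured_inj F) ->.
Qed.

(** If [a.+1] were strictly below and strictly to the right of [a], the two other
    corners of the rectangle would be occupied, and at most one of them is the
    hole; the other would contain a value between [a] and [a.+1]. *)
Lemma ascent_descent a : 0 < a -> ascent f a -> descent f a -> False.
Proof.
move=> a0 [i [j [i' [j' [fa fa' jj]]]]] [k [l [k' [l' [ga ga' kk]]]]].
have n : f i j != 0 by rewrite fa -lt0n.
have n' : f i' j' != 0 by rewrite fa'.
have [E1 E2] : (i, j) = (k, l) by apply: (punctured_inj F) => //; rewrite fa ga.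
have [E3 E4] : (i', j') = (k', l') by apply: (punctured_inj F) => //; rewrite fa' ga'.
subst k l k' l'.
have o : occupied h f i j by rewrite /occupied n.
have o' : occupied h f i' j' by rewrite /occupied n'.
have mid u v : i <= u <= i' -> j <= v <= j' -> f u v != 0 -> (u, v) = (i, j) \/ (u, v) = (i', j').
  move=> /andP[iu ui] /andP[jv vj] nuv.
  have := punctured_mono F iu jv n nuv; have := punctured_mono F ui vj nuv n'.
  rewrite fa fa' leq_eqVlt ltnS => /orP[/eqP E _|le le'].
    by right; apply: (punctured_inj F) => //; rewrite fa'.
  by left; apply: (punctured_inj F) => //; rewrite fa; apply/eqP; rewrite eqn_leq le le'.
have o1 : occupied h f i j' by apply: (punctured_convex o o'); rewrite leqnn ltnW //.
have o2 : occupied h f i' j by apply: (punctured_convex o o'); rewrite leqnn ltnW //.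
case/orP: o1 => [n1|/eqP h1].
  have u1 : i <= i <= i' by lia.
  have u2 : j <= j' <= j' by lia.
  by case: (mid _ _ u1 u2 n1) => -[]; lia.
case/orP: o2 => [n2|]; last by rewrite h1 => /eqP [? ?]; lia.
have u1 : i <= i' <= i' by lia.
have u2 : j <= j <= j' by lia.
by case: (mid _ _ u1 u2 n2) => -[]; lia.
Qed.

Lemma ascent_or_descent a : 0 < a -> has_value f a -> has_value f a.+1 ->
  ascent f a \/ descent f a.
Proof.
move=> a0 [i [j fa]] [i' [j' fa']].
case: (ltnP j j') => jj; first by left; exists i, j, i', j'.
case: (ltnP i i') => ii; first by right; exists i, j, i', j'.
have := punctured_mono F ii jj; rewrite fa fa'; lia.
Qed.

End Punctured.

Section Move.
Variables (la : seq nat) (f : nat -> nat -> nat) (i0 j0 i1 j1 : nat).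
Hypothesis F : punctured la (Some (i0, j0)) f.
Hypothesis pos : 0 < f i1 j1.
Hypothesis adj : (i1, j1) = (i0, j0.+1) /\ ((f i0.+1 j0 == 0) || (f i1 j1 < f i0.+1 j0)) \/
                 (i1, j1) = (i0.+1, j0) /\ ((f i0 j0.+1 == 0) || (f i1 j1 < f i0 j0.+1)).

Let g := move_entry f (i0, j0) (i1, j1).

Let le01 : i0 <= i1 /\ j0 <= j1 /\ (i0, j0) != (i1, j1).
Proof. by case: adj => -[[-> ->] _]; rewrite xpair_eqE; lia. Qed.

Lemma moveE i j : g i j = if (i, j) == (i0, j0) then f i1 j1
                          else if (i, j) == (i1, j1) then 0 else f i j.
Proof. by []. Qed.

Lemma f_hole : f i0 j0 = 0. Proof. exact: (punctured_hole F). Qed.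

Lemma move_pos i j : g i j != 0 -> exists i' j', f i' j' = g i j /\
  ((i, j) = (i0, j0) /\ (i', j') = (i1, j1) \/ (i, j) = (i', j') /\ (i', j') != (i1, j1)).
Proof.
rewrite moveE; case: (eqVneq (i, j) (i0, j0)) => [E _|ne].
  by exists i1, j1; split=> //; left.
case: (eqVneq (i, j) (i1, j1)) => // ne' _.
by exists i, j; split=> //; right.
Qed.

Lemma move_pos_inv i j : f i j != 0 -> exists i' j', g i' j' = f i j /\
  ((i', j') = (i0, j0) /\ (i, j) = (i1, j1) \/ (i', j') = (i, j)).
Proof.
move=> n; have [E|ne] := eqVneq (i, j) (i1, j1).
  by exists i0, j0; rewrite moveE eqxx; case: E => -> ->; split=> //; left.
exists i, j; rewrite moveE (negPf ne); case: (eqVneq (i, j) (i0, j0)) => [[E1 E2]|_].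
  by rewrite E1 E2 f_hole in n.
by split=> //; right.
Qed.

Lemma move_has v : 0 < v -> has_value g v <-> has_value f v.
Proof.
move=> v0; split=> -[i [j E]].
  have n : g i j != 0 by rewrite E -lt0n.
  by have [i' [j' [E' _]]] := move_pos n; exists i', j'; rewrite E'.
have n : f i j != 0 by rewrite E -lt0n.
by have [i' [j' [E' _]]] := move_pos_inv n; exists i', j'; rewrite E'.
Qed.

Lemma move_occupied i j : occupied (Some (i1, j1)) g i j = occupied (Some (i0, j0)) f i j.
Proof.
rewrite /occupied moveE ![Some _ == _](inj_eq Some_inj) ![_ == (i, j)]eq_sym.
case: (eqVneq (i, j) (i0, j0)) => [[-> ->]|ne]; first by rewrite f_hole -lt0n pos.
by case: (eqVneq (i, j) (i1, j1)) => [[-> ->]|ne']; rewrite ?orbT ?orbF // -lt0n pos.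
Qed.

(** The smaller neighbour moves into the hole; the choice of the smaller one keeps
    the entries increasing past the box that is left. *)
Lemma move_punctured : punctured la (Some (i1, j1)) g.
Proof.
have [li [lj ne01]] := le01; have ne10 : (i1, j1) != (i0, j0) by rewrite eq_sym.
split.
- exact: punctured_part F.
- by move=> i j; rewrite move_occupied; apply: (punctured_out F).
- by move=> i j [<- <-]; rewrite moveE (negPf ne10) eqxx.
- by move=> i j i' j'; rewrite !move_occupied; apply: (punctured_down F).
- have n1 : f i1 j1 != 0 by rewrite -lt0n.
  move=> i j i' j' ii jj n n'.
  have [a [b [F1 [[[Ei Ej] [Ea Eb]]|[[Ei Ej] ne]]]]] := move_pos n;
  have [a' [b' [F2 [[[Ei' Ej'] [Ea' Eb']]|[[Ei' Ej'] ne']]]]] := move_pos n';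
  rewrite -F1 -F2; subst.
  + by [].
  (* The moved entry against one to the south-east of the hole: by convexity the
     other neighbour of the hole is between them if they are not comparable. *)
  + have n2 : f a' b' != 0 by rewrite F2.
    have o2 : occupied (Some (i0, j0)) f a' b' by rewrite /occupied n2.
    have o0 : occupied (Some (i0, j0)) f i0 j0 by rewrite /occupied eqxx orbT.
    case: adj => -[[E1 E2] c]; subst i1 j1.
      case: (ltnP j0 b') => jb; first by apply: (punctured_mono F) n1 n2; lia.
      have bE : b' = j0 by lia. subst b'.
      case: (ltnP i0 a') => ia; last first.
        have aE : a' = i0 by lia.
        by move: n2; rewrite aE (punctured_hole F erefl).
      have : occupied (Some (i0, j0)) f i0.+1 j0 by apply: (punctured_convex F o0 o2); lia.
      rewrite /occupied => /orP[n3|/eqP []]; last by lia.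
      move: c; rewrite (negPf n3) /= => c; apply: leq_trans (ltnW c) _.
      by apply: (punctured_mono F) n3 n2; lia.
    case: (ltnP i0 a') => ia; first by apply: (punctured_mono F) n1 n2; lia.
    have aE : a' = i0 by lia. subst a'.
    case: (ltnP j0 b') => jb; last first.
      have bE : b' = j0 by lia.
      by move: n2; rewrite bE (punctured_hole F erefl).
    have : occupied (Some (i0, j0)) f i0 j0.+1 by apply: (punctured_convex F o0 o2); lia.
    rewrite /occupied => /orP[n3|/eqP []]; last by lia.
    move: c; rewrite (negPf n3) /= => c; apply: leq_trans (ltnW c) _.
    by apply: (punctured_mono F) n3 n2; lia.
  + have n2 : f a b != 0 by rewrite F1.
    by apply: (punctured_mono F) n2 n1; lia.
  have n2 : f a b != 0 by rewrite F1.
  have n3 : f a' b' != 0 by rewrite F2.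
  by apply: (punctured_mono F) n2 n3.
move=> i j i' j' E n; have n' : g i' j' != 0 by rewrite -E.
have [a [b [E1 h1]]] := move_pos n; have [a' [b' [E2 h2]]] := move_pos n'.
have [ea eb] : (a, b) = (a', b') by apply: (punctured_inj F); rewrite E1 ?E2.
subst a' b'; case: h1 => [[-> p]|[-> p]]; case: h2 => [[-> q]|[-> q]] //.
  by rewrite p eqxx in q.
by rewrite q eqxx in p.
Qed.

(** A horizontal move changes no row and a vertical move changes no column, so
    one of them preserves descents by definition and the other one ascents; in a
    punctured tableau a value is a descent exactly when it is not an ascent. *)
Lemma move_descent a : 0 < a -> descent g a <-> descent f a.
Proof.
move=> a0; case: adj => -[[E1 E2] _].
  split=> -[i [j [i' [j' [ga ga' ii]]]]].
    have [|k [l [gk hk]]] := @move_pos i j; first by rewrite ga -lt0n.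
    have [|k' [l' [gk' hk']]] := @move_pos i' j'; first by rewrite ga'.
    exists k, l, k', l'; rewrite gk gk'; split=> //.
    suff [-> ->] : k = i /\ k' = i' by [].
    by split; [case: hk => [[[? ?] [? ?]]|[[? ?] _]] | case: hk' => [[[? ?] [? ?]]|[[? ?] _]]]; lia.
  have [|k [l [gk hk]]] := @move_pos_inv i j; first by rewrite ga -lt0n.
  have [|k' [l' [gk' hk']]] := @move_pos_inv i' j'; first by rewrite ga'.
  exists k, l, k', l'; rewrite gk gk'; split=> //.
  suff [-> ->] : k = i /\ k' = i' by [].
  by split; [case: hk => [[[? ?] [? ?]]|[? ?]] | case: hk' => [[[? ?] [? ?]]|[? ?]]]; lia.
have asc : ascent g a <-> ascent f a.
  split=> -[i [j [i' [j' [ga ga' ii]]]]].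
    have [|k [l [gk hk]]] := @move_pos i j; first by rewrite ga -lt0n.
    have [|k' [l' [gk' hk']]] := @move_pos i' j'; first by rewrite ga'.
    exists k, l, k', l'; rewrite gk gk'; split=> //.
    suff [-> ->] : l = j /\ l' = j' by [].
    by split; [case: hk => [[[? ?] [? ?]]|[[? ?] _]] | case: hk' => [[[? ?] [? ?]]|[[? ?] _]]]; lia.
  have [|k [l [gk hk]]] := @move_pos_inv i j; first by rewrite ga -lt0n.
  have [|k' [l' [gk' hk']]] := @move_pos_inv i' j'; first by rewrite ga'.
  exists k, l, k', l'; rewrite gk gk'; split=> //.
  suff [-> ->] : l = j /\ l' = j' by [].
  by split; [case: hk => [[[? ?] [? ?]]|[? ?]] | case: hk' => [[[? ?] [? ?]]|[? ?]]]; lia.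
have hasE u v : descent u v -> has_value u v /\ has_value u v.+1.
  by move=> [i [j [i' [j' [ga ga' ii]]]]]; split; [exists i, j | exists i', j'].
split=> d; have [h1 h2] := hasE _ _ d.
  have [h3 h4] := (proj1 (move_has a0) h1, proj1 (move_has (ltn0Sn a)) h2).
  case: (ascent_or_descent F a0 h3 h4) => // /asc ac.
  by case: (ascent_descent move_punctured a0 ac d).
have [h3 h4] := (proj2 (move_has a0) h1, proj2 (move_has (ltn0Sn a)) h2).
case: (ascent_or_descent move_punctured a0 h3 h4) => // /asc ac.
by case: (ascent_descent F a0 ac d).
Qed.

End Move.

Lemma slide_stop_punctured la i j f : punctured la (Some (i, j)) f -> f i j.+1 = 0 -> f i.+1 j = 0 ->
  punctured la None f.
Proof.
move=> F r d; split.
- exact: punctured_part F.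
- by move=> a b /(punctured_out F); rewrite /occupied negb_or orbF => /andP[].
- by [].
- move=> a b a' b' aa bb o' out.
  have n' : f a' b' != 0 by move: o'; rewrite /occupied orbF.
  have o2 : occupied (Some (i, j)) f a' b' by rewrite /occupied n'.
  have := punctured_down F aa bb o2 out; rewrite /occupied orbF => /orP[//|/eqP [E1 E2]].
  rewrite -{a}E1 -{b}E2 in aa bb out *.
  have o0 : occupied (Some (i, j)) f i j by rewrite /occupied eqxx orbT.
  case: (ltnP j b') => jb.
    have : occupied (Some (i, j)) f i j.+1 by apply: (punctured_convex F o0 o2); lia.
    by rewrite /occupied r => /eqP [] /n_Sn.
  case: (ltnP i a') => ia.
    have : occupied (Some (i, j)) f i.+1 j by apply: (punctured_convex F o0 o2); lia.
    by rewrite /occupied d => /eqP [] /n_Sn.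
  have [E1 E2] : a' = i /\ b' = j by lia.
  by rewrite E1 E2 in n'.
- exact: punctured_mono F.
exact: punctured_inj F.
Qed.

Record same_descents (f g : nat -> nat -> nat) : Prop := SameDescents {
  same_value : forall v, 0 < v -> has_value g v <-> has_value f v;
  same_descent : forall a, 0 < a -> descent g a <-> descent f a }.

Lemma same_descents_refl f : same_descents f f. Proof. by []. Qed.

Lemma same_descents_trans f g h : same_descents f g -> same_descents g h -> same_descents f h.
Proof.
move=> [v1 d1] [v2 d2]; split=> a a0; first by rewrite (v2 a a0); apply: v1.
by rewrite (d2 a a0); apply: d1.
Qed.

(** Slides must be shown to terminate: the hole moves away from the corner
    within a square that contains the diagram. *)
Definition bounded N h f := forall i j, occupied h f i j -> i < N /\ j < N.

Lemma slide_punctured la i j f g : slide i j f g -> punctured la (Some (i, j)) f ->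
  [/\ punctured la None g, same_descents f g &
   forall N, bounded N (Some (i, j)) f -> bounded N None g].
Proof.
elim=> {i j f g} [i j f r d F|i j f g r d _ IH F|i j f g r d _ IH F].
- split; [exact: slide_stop_punctured F r d | exact: same_descents_refl |].
  by move=> N b a c; rewrite /occupied orbF => n; apply: b; rewrite /occupied n.
- have adj : (i, j.+1) = (i, j.+1) /\ ((f i.+1 j == 0) || (f i j.+1 < f i.+1 j)) \/
      (i, j.+1) = (i.+1, j) /\ ((f i j.+1 == 0) || (f i j.+1 < f i j.+1)) by left.
  have [T S B] := IH (move_punctured F r adj); split=> //; last first.
    by move=> N b; apply: B => x y; rewrite (move_occupied F r); apply: b.
  apply: same_descents_trans S; split=> v v0; first exact: (move_has _ _ F).
  exact: (move_descent F r adj).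
have adj : (i.+1, j) = (i, j.+1) /\ ((f i.+1 j == 0) || (f i.+1 j < f i.+1 j)) \/
    (i.+1, j) = (i.+1, j) /\ ((f i j.+1 == 0) || (f i.+1 j < f i j.+1)) by right.
have [T S B] := IH (move_punctured F r adj); split=> //; last first.
  by move=> N b; apply: B => x y; rewrite (move_occupied F r); apply: b.
apply: same_descents_trans S; split=> v v0; first exact: (move_has _ _ F).
exact: (move_descent F r adj).
Qed.

Lemma slide_exists la N i j f : punctured la (Some (i, j)) f -> bounded N (Some (i, j)) f ->
  exists g, slide i j f g.
Proof.
(* The hole moves down or to the right. *)
have [m] := ubnP (N + N - (i + j)); elim: m i j f => // m IHm i j f mm F b.
have [iN jN] : i < N /\ j < N by apply: b; rewrite /occupied eqxx orbT.
have right : 0 < f i j.+1 -> (f i.+1 j == 0) || (f i j.+1 < f i.+1 j) -> exists g, slide i j f g.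
  move=> r c; have adj : (i, j.+1) = (i, j.+1) /\ ((f i.+1 j == 0) || (f i j.+1 < f i.+1 j)) \/
      (i, j.+1) = (i.+1, j) /\ ((f i j.+1 == 0) || (f i j.+1 < f i j.+1)) by left.
  have [|||g sg] := IHm i j.+1 (move_entry f (i, j) (i, j.+1)).
  - lia.
  - exact: (move_punctured F r adj).
  - by move=> x y; rewrite (move_occupied F r); apply: b.
  by exists g; apply: slide_right sg.
have down : 0 < f i.+1 j -> (f i j.+1 == 0) || (f i.+1 j < f i j.+1) -> exists g, slide i j f g.
  move=> r c; have adj : (i.+1, j) = (i, j.+1) /\ ((f i.+1 j == 0) || (f i.+1 j < f i.+1 j)) \/
      (i.+1, j) = (i.+1, j) /\ ((f i j.+1 == 0) || (f i.+1 j < f i j.+1)) by right.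
  have [|||g sg] := IHm i.+1 j (move_entry f (i, j) (i.+1, j)).
  - lia.
  - exact: (move_punctured F r adj).
  - by move=> x y; rewrite (move_occupied F r); apply: b.
  by exists g; apply: slide_down sg.
case: (posnP (f i j.+1)) => r; case: (posnP (f i.+1 j)) => d.
- by exists f; apply: slide_stop.
- by apply: down; rewrite ?r.
- by apply: right; rewrite ?d.
case: (ltngtP (f i j.+1) (f i.+1 j)) => c.
- by apply: right; rewrite ?c ?orbT.
- by apply: down; rewrite ?c ?orbT.
by case: (punctured_inj F c (lt0n_neq0 r)); lia.
Qed.

(** The slide begins by moving a corner of the inner shape into the diagram as
    the hole. *)
Lemma rectify_start la i j f : nth 0 la i = j.+1 -> nth 0 la i.+1 <= j ->
  punctured la None f -> punctured (set_nth 0 la i j) (Some (i, j)) f.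
Proof.
move=> li lj F; have nE x : nth 0 (set_nth 0 la i j) x = if x == i then j else nth 0 la x.
  by rewrite nth_set_nth.
have fo x y : y < nth 0 la x -> f x y = 0.
  by move=> /(punctured_out F); rewrite /occupied orbF negbK => /eqP.
split.
- move=> x; rewrite !nE; have := punctured_part F x.
  case: (eqVneq x.+1 i) => [E1|_]; case: (eqVneq x i) => [E2|_]; try lia.
    by rewrite -E1 in li; lia.
  by rewrite -E2 in li lj; lia.
- move=> x y; rewrite nE /occupied negb_or => h.
  have h' : y < nth 0 la x by move: h; case: (eqVneq x i) => [->|//]; rewrite li; lia.
  rewrite fo // eqxx /=; apply/eqP => -[E1 E2]; move: h; rewrite -E1 -E2 eqxx; lia.
- by move=> x y [<- <-]; apply: fo; rewrite li.
- move=> x y x' y' xx yy; rewrite nE {1}/occupied => /orP[n'|/eqP [E1 E2]] h.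
    case: (ltnP y (nth 0 la x)) => yl.
      rewrite /occupied; have [E1 E2] : x = i /\ y = j.
        by move: h; case: (eqVneq x i) => [E|_]; [move: yl; rewrite E li; lia | lia].
      by rewrite E1 E2 eqxx orbT.
    have o' : occupied None f x' y' by rewrite /occupied n'.
    by have := punctured_down F xx yy o' yl; rewrite /occupied orbF => ->.
  rewrite -{x'}E1 -{y'}E2 in xx yy.
  move: h; case: (eqVneq x i) => [E|xi] h.
    have -> : y = j by lia.
    by rewrite E /occupied eqxx orbT.
  by have := punctured_part_le F xx; rewrite li; lia.
- exact: punctured_mono F.
exact: punctured_inj F.
Qed.

Lemma rectifies_punctured la f g : rectifies la f g -> punctured la None f ->
  same_descents f g /\ punctured [::] None g.
Proof.
elim=> {la f g} [la f s F|la i j f g h li lj sl _ IH F].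
  split; first exact: same_descents_refl.
  have l0 i : nth 0 la i = 0.
    have [il|il] := ltnP i (size la); last by rewrite nth_default.
    by apply/eqP; move: s => /eqP; rewrite sumnE sum_nat_seq_eq0 => /allP; apply; apply: mem_nth.
  case: F => p o hh d m n; split=> //.
  - by move=> i; rewrite !nth_nil.
  - by move=> i j i' j' ii jj o' _; apply: d ii jj o' _; rewrite l0.
have [T S _] := slide_punctured sl (rectify_start li lj F).
by have [S2 T2] := IH T; split=> //; apply: same_descents_trans S2.
Qed.

Lemma rectifies_exists N la f : punctured la None f -> bounded N None f ->
  (forall i, nth 0 la i <= N) -> size la <= N ->
  exists g, rectifies la f g.
Proof.
have [m] := ubnP (sumn la); elim: m la f => // m IHm la f lm F b lN sN.
case: (posnP (sumn la)) => s0; first by exists f; apply: rectifies_straight.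
have ex : exists i, 0 < nth 0 la i.
  have : has (ltn 0) la.
    move: s0; rewrite lt0n sumnE sum_nat_seq_eq0 -has_predC; apply: sub_has => x /=.
    by rewrite lt0n.
  by move=> /(has_nthP 0)[i il h]; exists i.
have bd i : 0 < nth 0 la i -> i <= size la.
  by move=> h; rewrite leqNgt; apply/negP => si; rewrite nth_default ?ltnn // in h; apply: ltnW.
(* The last nonempty row of the inner shape ends in a corner. *)
case: (ex_maxnP ex bd) => i il imax; case E: (nth 0 la i) il => [//|j] _.
have lj : nth 0 la i.+1 <= j.
  by case: (posnP (nth 0 la i.+1)) => [->//|/imax]; rewrite ltnn.
have F' := rectify_start E lj F.
have szi : i < size la by rewrite ltnNge; apply/negP => /(nth_default 0); rewrite E.
have jN : j < N by rewrite -E.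
have b' : bounded N (Some (i, j)) f.
  move=> x y; rewrite /occupied => /orP[n|/eqP [<- <-]]; first by apply: b; rewrite /occupied n.
  by split=> //; apply: leq_trans sN.
have [g sg] := slide_exists F' b'; have [T _ B] := slide_punctured sg F'.
have [|||||g' rg] := IHm (set_nth 0 la i j) g.
- rewrite sumn_set_nth szi E /=; have : nth 0 la i <= sumn la; last by lia.
  by rewrite -[sumn la]/(sumn la) sumnE (big_nth 0) (bigD1_seq i) ?mem_index_iota ?iota_uniq //= leq_addr.
- exact: T.
- exact: B b'.
- by move=> x; rewrite nth_set_nth /=; case: eqP => // _; apply: ltnW.
- by rewrite size_set_nth; move: szi sN; lia.
by exists g'; apply: rectifies_slide E lj sg rg.
Qed.

(** * Odd Littlewood-Richardson numbers of strips *)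

Lemma part_antitone la i i' : sorted geq la -> i <= i' -> nth 0 la i' <= nth 0 la i.
Proof.
move=> sl ii; rewrite leqNgt; apply/negP => h.
have := part_col_height i' (nth 0 la i) sl; rewrite h => /esym h2.
by have := part_col_height i (nth 0 la i) sl; rewrite ltnn (leq_ltn_trans ii h2).
Qed.

(** Values in strictly increasing columns leave no room for a second row, and the
    only row is filled from its beginning. *)
Lemma straight_row n g : punctured [::] None g ->
  (forall v, 0 < v -> has_value g v <-> v <= n) ->
  (forall i j i' j', 0 < g i j -> g i j < g i' j' -> j < j') ->
  forall i j, g i j = if (i == 0) && (j < n) then j.+1 else 0.
Proof.
move=> G val col.
have row0 i j : g i j != 0 -> i = 0.
  case: i => // i n0; exfalso.
  have := punctured_down G (leqnSn i) (leqnn j) (i' := i.+1) (j' := j).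
  rewrite /occupied !orbF nth_nil => /(_ n0 isT) n1.
  have lt : g i j < g i.+1 j by apply: (punctured_strict G); rewrite // xpair_eqE; lia.
  by have := col _ _ _ _ _ lt; rewrite lt0n n1 ltnn => /(_ isT).
have pos v : 0 < v -> v <= n -> g 0 v.-1 = v.
  elim/ltn_ind: v => v IHv v0 vn.
  have [i [j gv]] := (val v v0).2 vn.
  have i0 : i = 0 by apply: (row0 i j); rewrite gv -lt0n.
  subst i; have n1 : g 0 j != 0 by rewrite gv -lt0n.
  case: (ltngtP j v.-1) => [jv|vj|<- //].
    have : g 0 j = j.+1 by rewrite -[j]/(j.+1.-1); apply: IHv; lia.
    by rewrite gv; lia.
  have : occupied None g 0 v.-1.
    by apply: (punctured_down G (i' := 0) (j' := j)); rewrite ?nth_nil ?(ltnW vj) // /occupied n1.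
  rewrite /occupied orbF => n2.
  have xv : g 0 v.-1 < v by rewrite -[X in _ < X]gv; apply: (punctured_strict G); rewrite ?(ltnW vj) // xpair_eqE /=; lia.
  have := IHv _ xv; rewrite lt0n n2 => /(_ isT) h.
  have xn : g 0 v.-1 <= n by apply: ltnW; apply: leq_trans xv vn.
  have : (0, (g 0 v.-1).-1) = (0, v.-1) by apply: (punctured_inj G); rewrite h.
  case; lia.
move=> i j; case: (eqVneq i 0) => [->|i0] /=; last first.
  by apply/eqP; apply: contraNT i0 => /row0 ->.
case: ltnP => jn; first by have := pos j.+1; apply.
apply/eqP; rewrite -[_ == 0]negbK -lt0n; apply/negP => g0.
have gn : g 0 j <= n by apply/(val _ g0); exists 0, j.
have h := pos _ g0 gn.
have : (0, (g 0 j).-1) = (0, j) by apply: (punctured_inj G); rewrite h // -lt0n.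
case; lia.
Qed.

Lemma punctured_transpose g : punctured [::] None g -> punctured [::] None (fun i j => g j i).
Proof.
move=> G; split.
- by move=> i; rewrite !nth_nil.
- by move=> i j; rewrite nth_nil.
- by [].
- move=> i j i' j' ii jj; rewrite /occupied !orbF => n _.
  have := punctured_down G jj ii; rewrite /occupied !orbF nth_nil; exact.
- by move=> i j i' j' ii jj; apply: (punctured_mono G).
by move=> i j i' j' E n; case: (punctured_inj G E n) => -> ->.
Qed.

Lemma entry_row n i j : entry (row_tableau [:: n]) i j = if (i == 0) && (j < n) then j.+1 else 0.
Proof.
rewrite /entry /row_tableau /= addn0 take_oversize ?size_iota //.
case: i => [|i] /=; last by rewrite !nth_nil.
by case: ltnP => jn; [rewrite nth_iota | rewrite nth_default ?size_iota].
Qed.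

Lemma entry_col n i j : entry (row_tableau (nseq n 1)) i j = if (j == 0) && (i < n) then i.+1 else 0.
Proof.
rewrite /entry /row_tableau; have -> : sumn (nseq n 1) = n by rewrite sumn_nseq mul1n.
rewrite -[i.+1]/(0 + i.+1) -[iota 1 n]/(iota (0 + 1) n).
suff h s : nth [::] (reshape (nseq n 1) (iota s n)) i = if i < n then [:: s + i] else [::].
  rewrite h; case: ltnP => ji; rewrite ?andbT ?andbF ?nth_nil // add0n add1n.
  by case: j => [|j] //=; rewrite nth_nil.
elim: n s i => [|n IHn] s [|i] //=; first by rewrite take0 addn0.
by rewrite drop0 IHn ltnS addSnnS.
Qed.

(** It suffices to compare consecutive values, provided that no value is
    missing. *)
Lemma value_chain (f : nat -> nat -> nat) (key : nat -> nat -> nat) :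
  (forall u v, 0 < u -> u < v -> has_value f v -> has_value f u) ->
  (forall i j i' j', 0 < f i j -> f i' j' = (f i j).+1 -> key i j < key i' j') ->
  forall i j i' j', 0 < f i j -> f i j < f i' j' -> key i j < key i' j'.
Proof.
move=> dense st i j i' j' p; move Dm: (f i' j' - f i j) => m.
elim: m i' j' Dm => [|m IHm] i' j' Dm lt; first by lia.
case: (posnP m) => [m0|mp]; first by apply: st => //; lia.
have [k [l E]] : has_value f (f i' j').-1.
  by apply: (dense _ (f i' j')); [lia | lia | exists i', j'].
apply: (@ltn_trans (key k l)); first by apply: IHm; rewrite E; lia.
by apply: st; rewrite E; lia.
Qed.

Lemma mem_map_inj (T U : eqType) (f : T -> U) s : uniq (map f s) -> {in s &, injective f}.
Proof.
elim: s => //= d s IHs /andP[ns us] b c; rewrite !inE.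
move=> /orP[/eqP ->|bs] /orP[/eqP ->|cs] // E; last exact: IHs.
  by rewrite E map_f in ns.
by rewrite -E map_f in ns.
Qed.

Definition dense (f : nat -> nat -> nat) :=
  forall u v, 0 < u -> u < v -> has_value f v -> has_value f u.

(** Without descents each value lies strictly to the right of the preceding one;
    with descents everywhere it lies strictly below. *)
Lemma no_descent_cols la h f : punctured la h f -> dense f ->
  (forall a, 0 < a -> ~ descent f a) ->
  forall i j i' j', 0 < f i j -> f i j < f i' j' -> j < j'.
Proof.
move=> F df nd; apply: (value_chain (key := fun _ j => j)) => // i j i' j' p E.
have v1 : has_value f (f i j) by exists i, j.
have v2 : has_value f (f i j).+1 by exists i', j'.
have [[a [b [a' [b' [E1 E2 lt]]]]]|/(nd _ p)//] := ascent_or_descent F p v1 v2.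
have [_ <-] : (a, b) = (i, j) by apply: (punctured_inj F) => //; rewrite E1 -lt0n.
by have [_ <-] : (a', b') = (i', j') by apply: (punctured_inj F); rewrite E2 // E.
Qed.

Lemma all_descent_rows la h f : punctured la h f -> dense f ->
  (forall a, 0 < a -> has_value f a.+1 -> descent f a) ->
  forall i j i' j', 0 < f i j -> f i j < f i' j' -> i < i'.
Proof.
move=> F df ad; apply: (value_chain (key := fun i _ => i)) => // i j i' j' p E.
have v2 : has_value f (f i j).+1 by exists i', j'.
have [a [b [a' [b' [E1 E2 lt]]]]] := ad _ p v2.
have [<- _] : (a, b) = (i, j) by apply: (punctured_inj F) => //; rewrite E1 -lt0n.
by have [<- _] : (a', b') = (i', j') by apply: (punctured_inj F); rewrite E2 // E.
Qed.

Lemma count_lt_mono (s : seq nat) x y : x \in s -> x < y ->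
  count (gtn x) s < count (gtn y) s.
Proof.
move=> xs xy; have c0 : 0 < count_mem x s by rewrite -has_count has_pred1.
suff : count (gtn x) s + count_mem x s <= count (gtn y) s by lia.
elim: (s) => //= z t IHt; case: (eqVneq z x) => [->|zx]; first by rewrite ltnn xy; lia.
by case: (ltnP z x) => zx'; [rewrite (ltn_trans zx' xy) | case: (z < y)]; lia.
Qed.

Lemma count_lt_iota n x : 0 < x <= n.+1 -> count (gtn x) (iota 1 n) = x.-1.
Proof.
move=> xn; have := @count_iota_between 1 x n.+1; rewrite /= add0n subn1 => <-; last by lia.
apply: eq_in_count => i; rewrite mem_iota /=; lia.
Qed.

Section Skew.
Variables (la mu : seq nat).
Hypotheses (sla : sorted geq la) (smu : sorted geq mu) (inc : included la mu).

Let delta := skew_boxes mu la.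
Let n := size delta.

Lemma included_nth i : nth 0 la i <= nth 0 mu i.
Proof.
case: (ltnP i (size la)) => il; last by rewrite nth_default.
by have /allP := inc; apply; rewrite mem_iota.
Qed.

Lemma nth_skew_shape i : nth 0 (skew_shape mu la) i = nth 0 mu i - nth 0 la i.
Proof.
case: (ltnP i (size mu)) => im; first by rewrite (nth_map 0) ?size_iota // nth_iota.
by rewrite [nth 0 mu i]nth_default // sub0n nth_default // size_map size_iota.
Qed.

Lemma sumn_skew_shape : sumn (skew_shape mu la) = n.
Proof.
rewrite /n /delta /skew_boxes size_flatten /shape -map_comp; congr sumn.
by apply: eq_map => i /=; rewrite size_map size_iota.
Qed.

Definition at_box S (b : nat * nat) := skew_entry la S b.1 b.2.

Lemma map_skew_entry S : shape S = skew_shape mu la -> map (at_box S) delta = flatten S.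
Proof.
move=> sh; rewrite /delta /skew_boxes map_flatten -map_comp; congr flatten.
have sz : size S = size mu by rewrite -[size S](size_map size) -/(shape S) sh size_map size_iota.
rewrite -[RHS](mkseq_nth [::]) /mkseq sz; apply/eq_in_map => i; rewrite mem_iota /= => im.
rewrite -map_comp -[RHS](mkseq_nth 0) /mkseq -nth_shape sh nth_skew_shape.
rewrite -[nth 0 la i in LHS]addn0 iotaDl -map_comp addn0; apply: eq_map => j /=.
by rewrite /at_box /skew_entry /= ltnNge leq_addr /= addKn.
Qed.

Lemma skew_entry_eq0 S (i j : nat) : shape S = skew_shape mu la -> (i, j) \notin delta ->
  skew_entry la S i j = 0.
Proof.
move=> sh; rewrite mem_skew_boxes /skew_entry.
case: (ltnP j (nth 0 la i)) => //= lj mj.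
rewrite /entry [nth 0 (nth _ _ _) _]nth_default // -nth_shape sh nth_skew_shape; lia.
Qed.

Lemma mem_skew_SYT S : (S \in skew_SYT mu la) =
  [&& shape S == skew_shape mu la, perm_eq (flatten S) (iota 1 n) & `[< is_skew_SYT mu la S >]].
Proof.
rewrite mem_filter andbC /fillings sumn_skew_shape; apply/idP/idP.
  case/andP=> /mapP[w]; rewrite mem_permutations => pw TE ->; rewrite andbT.
  have sw : size w = sumn (skew_shape mu la) by rewrite (perm_size pw) size_iota sumn_skew_shape.
  by rewrite TE reshapeKl ?sw // eqxx reshapeKr ?sw.
case/and3P=> /eqP sS pS ->; rewrite andbT.
by apply/mapP; exists (flatten S); rewrite ?mem_permutations // -sS flattenK.
Qed.

Lemma skew_SYT_uniq : uniq (skew_SYT mu la).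
Proof.
rewrite filter_uniq // map_inj_in_uniq ?permutations_uniq // => u v.
rewrite !mem_permutations => pu pv /(congr1 flatten).
by rewrite !reshapeKr // ?(perm_size pu) ?(perm_size pv) size_iota.
Qed.

Section Filling.
Variable S : seq (seq nat).
Hypotheses (shS : shape S = skew_shape mu la) (pS : perm_eq (flatten S) (iota 1 n)).

Lemma at_box_uniq : uniq (map (at_box S) delta).
Proof. by rewrite map_skew_entry // (perm_uniq pS) iota_uniq. Qed.

Lemma at_box_mem b : b \in delta -> 0 < at_box S b <= n.
Proof.
move=> bd; have : at_box S b \in iota 1 n by rewrite -(perm_mem pS) -map_skew_entry // map_f.
by rewrite mem_iota; lia.
Qed.

Lemma at_box_neq0 i j : (skew_entry la S i j != 0) = ((i, j) \in delta).
Proof.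
case: (boolP ((i, j) \in delta)) => h; last by rewrite skew_entry_eq0 // eqxx.
by have := at_box_mem h; rewrite lt0n => /andP[].
Qed.

Lemma at_box_inj : {in delta &, injective (at_box S)}.
Proof.
exact: mem_map_inj at_box_uniq.
Qed.

Lemma skew_value v : 0 < v -> has_value (skew_entry la S) v <-> v <= n.
Proof.
move=> v0; split=> [[i [j E]]|vn].
  have : (i, j) \in delta by rewrite -at_box_neq0 E -lt0n.
  by move=> /at_box_mem; rewrite /at_box E => /andP[].
have : v \in flatten S by rewrite (perm_mem pS) mem_iota; lia.
by rewrite -map_skew_entry // => /mapP[[i j] _ ->]; exists i, j.
Qed.

Hypothesis yS : is_skew_SYT mu la S.

Lemma skew_row_lt i j : (i, j) \in delta -> (i, j.+1) \in delta ->
  skew_entry la S i j < skew_entry la S i j.+1.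
Proof.
rewrite !mem_skew_boxes => /andP[h1 h2] /andP[h3 h4].
rewrite /skew_entry !ltnNge h1 h3 /= subSn //= /entry.
have so : sorted ltn (nth [::] S i).
  case: (ltnP i (size S)) => iS; last by rewrite nth_default.
  by have /allP := yS.1; apply; apply: mem_nth.
rewrite -ltnNge; apply: (sorted_ltn_nth ltn_trans 0 so); rewrite // inE -nth_shape shS nth_skew_shape; lia.
Qed.

Lemma skew_punctured : punctured la None (skew_entry la S).
Proof.
have conv i j i' j' a b : (i, j) \in delta -> (i', j') \in delta ->
    i <= a <= i' -> j <= b <= j' -> (a, b) \in delta.
  rewrite !mem_skew_boxes => /andP[h1 h2] /andP[h3 h4] /andP[h5 h6] /andP[h7 h8].
  have := part_antitone sla h5; have := part_antitone smu h6; lia.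
split.
- by move=> i; apply: part_antitone.
- by move=> i j h; rewrite /occupied orbF at_box_neq0 mem_skew_boxes; lia.
- by [].
- move=> i j i' j' ii jj; rewrite /occupied !orbF !at_box_neq0 !mem_skew_boxes => h1 h2.
  have := part_antitone smu ii; lia.
- move=> i j i' j' ii jj; rewrite !at_box_neq0 => d d'.
  apply: (@leq_trans (skew_entry la S i' j)).
    move: d d' ii; move: i' => i'; move Dm: (i' - i) => m; elim: m i' Dm => [|m IHm] i' Dm d d' ii.
      by have -> : i' = i by lia.
    case: i' Dm d' ii => [|i'] Dm d' ii; first by lia.
    have dm : (i', j) \in delta by apply: conv d d' _ _; lia.
    have dm1 : (i'.+1, j) \in delta by apply: conv d d' _ _; lia.
    apply: leq_trans (IHm _ _ d _ _) (ltnW (yS.2 _ _ dm dm1)); try lia.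
    by apply: conv d d' _ _; lia.
  have d1 : (i', j) \in delta by apply: conv d d' _ _; lia.
  move: d1 d' jj {d ii}; move Dm: (j' - j) => m; elim: m j' Dm => [|m IHm] j' Dm d d' jj.
    by have -> : j' = j by lia.
  case: j' Dm d' jj => [|j'] Dm d' jj; first by lia.
  have dm : (i', j') \in delta by apply: conv d d' _ _; lia.
  apply: leq_trans (IHm _ _ d _ _) (ltnW (skew_row_lt dm d')) => //; lia.
move=> i j i' j' E n0; apply: (@at_box_inj (i, j) (i', j')); rewrite -?at_box_neq0 //.
by rewrite -E.
Qed.

End Filling.

(** With the column as key these are the fillings labelled from left to right;
    with the row as key, those labelled from top to bottom. *)
Definition keyed (key : nat * nat -> nat) S :=
  forall b c, b \in delta -> c \in delta -> key b < key c -> at_box S b < at_box S c.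

Lemma skew_dense S f : shape S = skew_shape mu la -> perm_eq (flatten S) (iota 1 n) ->
  same_descents (skew_entry la S) f -> dense f.
Proof.
move=> sh pS [sv _] u v u0 uv /sv h; apply/sv => //; apply/(skew_value sh pS u0).
have v0 : 0 < v by apply: ltn_trans uv.
by have := (skew_value sh pS v0).1 (h v0); lia.
Qed.

Lemma skew_rectifies S : S \in skew_SYT mu la ->
  exists g, rectifies la (skew_entry la S) g.
Proof.
rewrite mem_skew_SYT => /and3P[/eqP sh pS /asboolP yS].
apply: (@rectifies_exists (size mu + nth 0 mu 0 + size la)).
- exact: skew_punctured.
- move=> i j; rewrite /occupied orbF at_box_neq0 // mem_skew_boxes => /andP[_ h].
  have := part_antitone smu (leq0n i); have : i < size mu; last by lia.
  by rewrite ltnNge; apply: contraL h => /(nth_default 0) ->.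
- move=> i; have := part_antitone sla (leq0n i); have := included_nth 0; lia.
lia.
Qed.

(** The tableau with a single row is the only one without descents, and
    rectification preserves descents.  On a horizontal strip a filling without
    descents is labelled from left to right. *)
Lemma rect_rowP S : S \in skew_SYT mu la -> uniq [seq b.2 | b <- delta] ->
  has_rectification la S (row_tableau [:: n]) <-> keyed snd S.
Proof.
move=> SS uc; have [g0 rg0] := skew_rectifies SS; move: SS.
rewrite mem_skew_SYT => /and3P[/eqP sh pS /asboolP yS].
have F := skew_punctured sh pS yS; have key_inj := mem_map_inj uc.
split=> [[g rg gE]|kS].
  have [sg G] := rectifies_punctured rg F.
  have nd a : 0 < a -> ~ descent (skew_entry la S) a.
    move=> a0 /(same_descent sg a0) [i [j [i' [j' [_ + lt]]]]].
    by rewrite gE entry_row; case: i' lt.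
  have cols := no_descent_cols F (skew_dense sh pS (same_descents_refl _)) nd.
  move=> [i j] [i' j'] b c /= jj; rewrite /at_box /=; rewrite ltnNge leq_eqVlt.
  apply/negP => /orP[/eqP E|lt].
    have [_ E2] : (i', j') = (i, j) by apply: (at_box_inj sh pS c b); rewrite /at_box E.
    by rewrite E2 ltnn in jj.
  have p : 0 < skew_entry la S i' j' by rewrite lt0n at_box_neq0.
  by have := cols _ _ _ _ p lt; lia.
exists g0 => //; have [sg G] := rectifies_punctured rg0 F.
have nd a : 0 < a -> ~ descent (skew_entry la S) a.
  move=> a0 d; case: (d) => [i [j [i' [j' [E1 E2 ii]]]]].
  have b : (i, j) \in delta by rewrite -(at_box_neq0 sh pS) E1 -lt0n.
  have c : (i', j') \in delta by rewrite -(at_box_neq0 sh pS) E2.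
  apply: (ascent_descent F a0) d; exists i, j, i', j'; split=> //.
  rewrite ltnNge leq_eqVlt; apply/negP => /orP[/eqP E|/(kS _ _ c b)].
    by have [E3] := key_inj _ _ c b E; move: ii; rewrite E3 ltnn.
  by rewrite /at_box /= E1 E2; lia.
move=> i j; rewrite entry_row; apply: (straight_row G).
  by move=> v v0; rewrite (same_value sg v0); apply: (skew_value sh pS).
apply: (no_descent_cols G (skew_dense sh pS sg)) => a a0 /(same_descent sg a0).
exact: nd.
Qed.

(** Dually, the tableau with a single column is the only one in which every value
    but the last is a descent. *)
Lemma rect_colP S : S \in skew_SYT mu la -> uniq [seq b.1 | b <- delta] ->
  has_rectification la S (row_tableau (nseq n 1)) <-> keyed fst S.
Proof.
move=> SS uc; have [g0 rg0] := skew_rectifies SS; move: SS.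
rewrite mem_skew_SYT => /and3P[/eqP sh pS /asboolP yS].
have F := skew_punctured sh pS yS; have key_inj := mem_map_inj uc.
split=> [[g rg gE]|kS].
  have [sg G] := rectifies_punctured rg F.
  have ad a : 0 < a -> has_value (skew_entry la S) a.+1 -> descent (skew_entry la S) a.
    move=> a0 /(skew_value sh pS (ltn0Sn a)) an; apply/(same_descent sg a0).
    by exists a.-1, 0, a, 0; rewrite !gE !entry_col /= an (_ : a.-1 < n) prednK //; lia.
  have rows := all_descent_rows F (skew_dense sh pS (same_descents_refl _)) ad.
  move=> [i j] [i' j'] b c /= ii; rewrite /at_box /=; rewrite ltnNge leq_eqVlt.
  apply/negP => /orP[/eqP E|lt].
    have [E2 _] : (i', j') = (i, j) by apply: (at_box_inj sh pS c b); rewrite /at_box E.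
    by rewrite E2 ltnn in ii.
  have p : 0 < skew_entry la S i' j' by rewrite lt0n at_box_neq0.
  by have := rows _ _ _ _ p lt; lia.
exists g0 => //; have [sg G] := rectifies_punctured rg0 F.
have ad a : 0 < a -> has_value (skew_entry la S) a.+1 -> descent (skew_entry la S) a.
  move=> a0 v2; have [i [j E1]] := skew_dense sh pS (same_descents_refl _) a0 (ltnSn a) v2.
  case: v2 => [i' [j' E2]].
  have b : (i, j) \in delta by rewrite -(at_box_neq0 sh pS) E1 -lt0n.
  have c : (i', j') \in delta by rewrite -(at_box_neq0 sh pS) E2.
  exists i, j, i', j'; split=> //.
  rewrite ltnNge leq_eqVlt; apply/negP => /orP[/eqP E|/(kS _ _ c b)].
    by have [E4 E3] := key_inj _ _ c b E; move: E2; rewrite E4 E3 E1; lia.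
  by rewrite /at_box /= E1 E2; lia.
have rows := all_descent_rows G (skew_dense sh pS sg).
move=> i j; rewrite entry_col; apply: (straight_row (punctured_transpose G)).
  move=> v v0; rewrite -(skew_value sh pS v0) -(same_value sg v0).
  by split=> -[x [y E]]; exists y, x.
move=> x y x' y'; apply: rows => a a0 h.
by apply/(same_descent sg a0)/(ad _ a0)/(same_value sg (ltn0Sn a)).
Qed.

Section Ranks.
Variable key : nat * nat -> nat.
Hypothesis ukey : uniq (map key delta).
Hypothesis key_row : forall i j, (i, j) \in delta -> (i, j.+1) \in delta -> key (i, j) < key (i, j.+1).
Hypothesis key_col : forall i j, (i, j) \in delta -> (i.+1, j) \in delta -> key (i, j) < key (i.+1, j).

Definition rank b := (count (gtn (key b)) (map key delta)).+1.

(** The filling that increases with an injective key: each box contains its rank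
    among the keys. *)
Definition rank_filling := reshape (skew_shape mu la) (map rank delta).

Let shR : shape rank_filling = skew_shape mu la.
Proof. by rewrite reshapeKl // sumn_skew_shape size_map. Qed.

Let flR : flatten rank_filling = map rank delta.
Proof. by rewrite reshapeKr // sumn_skew_shape size_map. Qed.

Lemma rank_mono b c : b \in delta -> key b < key c -> rank b < rank c.
Proof. by move=> bd; rewrite /rank ltnS => /count_lt_mono; apply; apply: map_f. Qed.

Lemma rank_perm : perm_eq (map rank delta) (iota 1 n).
Proof.
have ur : uniq (map rank delta).
  rewrite map_inj_in_uniq ?(map_uniq ukey) // => b c bd cd E.
  apply: (mem_map_inj ukey) => //; case: (ltngtP (key b) (key c)) => //.
    by move=> /(rank_mono bd); rewrite E ltnn.
  by move=> /(rank_mono cd); rewrite E ltnn.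
have sub : {subset map rank delta <= iota 1 n}.
  move=> v /mapP[b bd ->]; rewrite mem_iota /rank /= add1n ltnS.
  rewrite -[X in _ < X](size_map key delta) -count_predT.
  rewrite ltn_neqAle sub_count // andbT; apply/eqP => E.
  have := count_lt_mono (map_f key bd) (ltnSn (key b)).
  by rewrite E => /leq_trans /(_ (count_size _ _)); rewrite count_predT ltnn.
have [|_ h] := uniq_min_size ur sub; first by rewrite size_iota size_map.
by apply: uniq_perm; rewrite ?iota_uniq.
Qed.

Lemma at_box_rank b : b \in delta -> at_box rank_filling b = rank b.
Proof.
have : map (at_box rank_filling) delta = map rank delta by rewrite map_skew_entry // flR.
by move/eq_in_map => h /h.
Qed.

Lemma rank_filling_skew : rank_filling \in skew_SYT mu la.
Proof.
rewrite mem_skew_SYT shR eqxx flR rank_perm /=; apply/asboolP; split.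
  apply/(all_nthP [::]) => i iS; apply/(sortedP 0) => l lR.
  have := lR; rewrite -nth_shape shR nth_skew_shape => lR'.
  have b : (i, nth 0 la i + l) \in delta by rewrite mem_skew_boxes; lia.
  have c : (i, (nth 0 la i + l).+1) \in delta by rewrite mem_skew_boxes; lia.
  have := rank_mono b (key_row b c); rewrite -!at_box_rank // /at_box /skew_entry /=.
  by rewrite !ltnNge leq_addr leqW ?leq_addr //= addKn -addnS addKn -ltnNge.
by move=> i j b c; have := rank_mono b (key_col b c); rewrite -!at_box_rank.
Qed.

Lemma keyed_rank : keyed key rank_filling.
Proof. by move=> b c bd cd /(rank_mono bd); rewrite !at_box_rank. Qed.

Lemma keyed_unique S : S \in skew_SYT mu la -> keyed key S -> S = rank_filling.
Proof.
rewrite mem_skew_SYT => /and3P[/eqP sh pS _] kS.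
rewrite -[LHS]flattenK sh /rank_filling; congr reshape.
rewrite -map_skew_entry //; apply/eq_in_map => b bd; rewrite /rank.
have bn := at_box_mem sh pS bd.
have <- : count (gtn (at_box S b)) (map (at_box S) delta) = count (gtn (key b)) (map key delta).
  rewrite !count_map; apply: eq_in_count => c cd /=.
  apply/idP/idP => [lt|/(kS _ _ cd bd)//]; rewrite ltnNge leq_eqVlt; apply/negP => /orP[/eqP E|].
    by rewrite (mem_map_inj ukey bd cd E) ltnn in lt.
  by move=> /(kS _ _ bd cd); lia.
rewrite map_skew_entry // (permP pS) count_lt_iota; lia.
Qed.

Lemma sum_keyed (P : pred (seq (seq nat))) (F : seq (seq nat) -> int) :
  (forall S, S \in skew_SYT mu la -> P S <-> keyed key S) ->
  (\sum_(S <- skew_SYT mu la | P S) F S = F rank_filling)%R.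
Proof.
move=> h; rewrite big_mkcond (bigD1_seq rank_filling) ?skew_SYT_uniq ?rank_filling_skew //=.
rewrite (_ : P _ = true); last by apply/(h _ rank_filling_skew)/keyed_rank.
rewrite big1_seq ?GRing.addr0 // => S /andP[ne SS]; case: ifP => // /(h _ SS) kS.
by rewrite (keyed_unique SS kS) eqxx in ne.
Qed.

End Ranks.

Lemma oddLR_row : uniq [seq b.2 | b <- delta] ->
  oddLR la [:: n] mu = ((-1) ^+ row_inv (adjoin la (rank_filling snd)))%R.
Proof.
move=> uc; rewrite /oddLR inc; apply: sum_keyed => [//|i j _ _ //|i j b c|S SS].
  by case: (mem_map_inj uc b c erefl); lia.
by apply: iff_trans (rect_rowP SS uc); split=> /asboolP.
Qed.

Lemma oddLR_col : uniq [seq b.1 | b <- delta] ->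
  oddLR la (nseq n 1) mu = ((-1) ^+ row_inv (adjoin la (rank_filling fst)))%R.
Proof.
move=> uc; rewrite /oddLR inc; apply: sum_keyed => [//|i j b c|i j _ _ //|S SS].
  by case: (mem_map_inj uc b c erefl); lia.
by apply: iff_trans (rect_colP SS uc); split=> /asboolP.
Qed.

End Skew.

(** * The parity identity *)

(** The exponent that a shape contributes to the sign of the Pieri rules. *)
Definition colbinom (a : seq nat) : nat := binom2 (transpose (tilde a)).

Lemma colbinomE N a : (forall x : nat, x \in a -> x <= N) ->
  colbinom a = \sum_(j <- iota 0 N) 'C(col_height j a, 2).
Proof.
move=> aN; rewrite /colbinom /binom2 /transpose big_map.
under eq_bigr do rewrite -/(col_height _ _) col_height_tilde.
have hN : head 0 (tilde a) <= N.
  case E: (tilde a) => [|x s] //=; apply: aN.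
  by rewrite -(perm_mem (tilde_perm a)) E mem_head.
rewrite -[in RHS](subnKC hN) iotaD big_cat /= [X in _ + X]big1_seq ?addn0 // => j /andP[_].
rewrite mem_iota add0n => /andP[jh _]; rewrite (_ : col_height j a = 0) // -col_height_tilde.
apply/eqP; rewrite -leqn0 leqNgt -(part_col_height _ _ (tilde_sorted a)) nth0; lia.
Qed.

Lemma down_colbinom c a b : down c b = Some a -> colbinom b = colbinom a + col_height c a.
Proof.
(* A bound for the parts of both shapes, and for the column [c]. *)
move=> da; pose N := (\max_(x <- b) x) + (\max_(x <- a) x) + c.+1.
have mx (s : seq nat) (x : nat) : x \in s -> x <= \max_(y <- s) y by move=> xs; apply: leq_bigmax_seq.
rewrite (@colbinomE N b); last by move=> x /mx; rewrite /N; lia.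
rewrite (@colbinomE N a); last by move=> x /mx; rewrite /N; lia.
have cN : c \in iota 0 N by rewrite mem_iota /N; lia.
rewrite (bigD1_seq c) ?iota_uniq //= [in RHS](bigD1_seq c) ?iota_uniq //=.
rewrite (down_col_height c da) eqxx addn1 binS bin1.
rewrite (eq_bigr (fun j => 'C(col_height j a, 2))); first by lia.
by move=> j jc; rewrite (down_col_height j da) (negPf jc) addn0.
Qed.

(** The boxes strictly to the right of the removed one are easier to compare with
    pairs of boxes of the sorted shapes. *)
Fixpoint chain_right_strict (cs b : seq nat) : nat :=
  if cs is c :: cs' then boxes_right c.+1 (odflt [::] (downs cs b)) + chain_right_strict cs' b else 0.

(** The boxes in the column of the removed box account for the change of the sum of
    the binomials of the column heights. *)
Lemma chain_rightE cs a b : downs cs b = Some a -> chain_right cs b + colbinom a = chain_right_strict cs b + colbinom b.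
Proof.
elim: cs a => [|c cs IHcs] a; first by case=> <-.
move=> dd; have [d d1 d2] := downs_cons dd; have := IHcs _ d1.
have -> : chain_right (c :: cs) b = boxes_right c a + chain_right cs b.
  by rewrite /= -[obind _ _]/(downs (c :: cs) b) dd.
have -> : chain_right_strict (c :: cs) b = boxes_right c.+1 a + chain_right_strict cs b.
  by rewrite /= -[obind _ _]/(downs (c :: cs) b) dd.
rewrite (down_colbinom d2) boxes_rightS -/(col_height c a); lia.
Qed.

(** To the right of a removed box there are boxes of the final shape and boxes that
    the chain removes later; these are the latter. *)
Fixpoint inv_below (cs : seq nat) : nat :=
  if cs is c :: cs' then count (gtn c) cs' + inv_below cs' else 0.

Lemma chain_right_strictE cs a b : downs cs b = Some a ->
  chain_right_strict cs b = \sum_(c <- cs) boxes_right c.+1 a + inv_below cs.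
Proof.
elim: cs a => [|c cs IHcs] a; first by rewrite big_nil.
move=> dd; have [d d1 d2] := downs_cons dd.
have -> : chain_right_strict (c :: cs) b = boxes_right c.+1 a + chain_right_strict cs b.
  by rewrite /= -[obind _ _]/(downs (c :: cs) b) dd.
rewrite big_cons (IHcs _ d1) /=.
suff -> : \sum_(c0 <- cs) boxes_right c0.+1 d = \sum_(c0 <- cs) boxes_right c0.+1 a + count (gtn c) cs by lia.
elim: (cs) => [|c' s IHs]; rewrite ?big_nil // !big_cons IHs /=.
have := down_sum (F := fun x => x - c'.+1) d2 erefl; rewrite -!/(boxes_right _ _).
by case: (ltnP c' c); lia.
Qed.

Lemma inv_below_ltn cs : sorted ltn cs -> inv_below cs = 0.
Proof.
elim: cs => //= c cs IHcs p; rewrite (IHcs (path_sorted p)) addn0.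
apply/eqP; rewrite -leqn0 leqNgt -has_count; apply/hasPn => x.
by move=> /(allP (order_path_min ltn_trans p)) /=; lia.
Qed.

Lemma inv_below_geq cs : sorted geq cs ->
  inv_below cs = \sum_(x <- cs) \sum_(y <- cs) (x < y : nat).
Proof.
elim: cs => [|c cs IHcs] p; first by rewrite big_nil.
rewrite /= (IHcs (path_sorted p)) !big_cons ltnn add0n.
have -> : \sum_(y <- cs) (c < y : nat) = 0.
  rewrite big1_seq // => y /andP[_ /(allP (order_path_min geq_trans p))] /=.
  by case: ltnP => //; lia.
rewrite add0n.
rewrite -sum1_count big_mkcond -big_split /=; apply: eq_bigr => x _.
by rewrite big_cons; case: ltnP.
Qed.

Definition box_ne (b c : nat * nat) := (c.1 < b.1) && (b.2 < c.2).

Section Boxes.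
Variables (la mu : seq nat).
Hypotheses (sla : sorted geq la) (smu : sorted geq mu) (inc : included la mu).
Let delta := skew_boxes mu la.
Let n := size delta.

Lemma skew_boxes_uniq mu' la' : uniq (skew_boxes mu' la').
Proof.
apply: allpairs_uniq_dep => [|i _|]; rewrite ?iota_uniq //.
by move=> [i j] [i' j'] _ _ /= [-> ->].
Qed.

Lemma boxes_split : perm_eq (boxes mu) (boxes la ++ delta).
Proof.
apply: uniq_perm; first exact: skew_boxes_uniq.
  rewrite cat_uniq !skew_boxes_uniq andbT /=; apply/hasPn => -[i j].
  by rewrite mem_boxes mem_skew_boxes; lia.
move=> [i j]; rewrite mem_cat !mem_boxes mem_skew_boxes.
by have := included_nth inc i; lia.
Qed.

Lemma boxes_right_boxes t : boxes_right t.+1 la = \sum_(c <- boxes la) (t < c.2 : nat).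
Proof.
rewrite /boxes_right /boxes /skew_boxes big_allpairs_dep /= (big_nth 0) /index_iota subn0.
apply: eq_bigr => i _; rewrite nth_nil subn0.
by elim: (nth 0 la i) => [|x IHx]; rewrite ?big_nil // -addn1 iotaD big_cat big_seq1 -IHx /=; case: ltnP; lia.
Qed.

Definition pairsum (P : nat * nat -> nat * nat -> bool) s t :=
  \sum_(b <- s) \sum_(c <- t) (P b c : nat).

Lemma count_pairs_cat P s t : count_pairs P (s ++ t) =
  pairsum P s s + pairsum P s t + (pairsum P t s + pairsum P t t).
Proof.
rewrite count_pairsE big_cat /pairsum /=; congr (_ + _); rewrite -big_split /=;
  by apply: eq_bigr => b _; rewrite big_cat.
Qed.

Lemma count_pairs_perm P s t : perm_eq s t -> count_pairs P s = count_pairs P t.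
Proof.
move=> st; rewrite !count_pairsE (perm_big _ st) /=.
by apply: eq_bigr => b _; apply: perm_big.
Qed.

Lemma eq_pairsum P Q s t : (forall b c, b \in s -> c \in t -> P b c = Q b c) ->
  pairsum P s t = pairsum Q s t.
Proof.
move=> h; rewrite /pairsum [LHS]big_seq [RHS]big_seq; apply: eq_bigr => b bs.
by rewrite [LHS]big_seq [RHS]big_seq; apply: eq_bigr => c ct; rewrite h.
Qed.

Lemma pairsum_swap P s t : pairsum P s t = pairsum (fun b c => P c b) t s.
Proof. exact: exchange_big. Qed.

Lemma pairsum0 P s t : (forall b c, b \in s -> c \in t -> P b c = false) -> pairsum P s t = 0.
Proof.
move=> h; rewrite (eq_pairsum (Q := fun _ _ => false)) // /pairsum big1 // => b _.
by rewrite big1.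
Qed.

Lemma NE_split : NE mu = NE la + pairsum box_ne (boxes la) delta + pairsum box_ne delta (boxes la)
                        + pairsum box_ne delta delta.
Proof.
rewrite /NE -[fun b c => _]/box_ne (count_pairs_perm _ boxes_split) count_pairs_cat count_pairsE.
by rewrite -/(pairsum _ _ _); lia.
Qed.

Lemma col_sum : \sum_(b <- delta) boxes_right b.2.+1 la = pairsum box_ne delta (boxes la).
Proof.
rewrite /pairsum; under eq_bigr do rewrite boxes_right_boxes.
apply: (eq_pairsum (P := fun b c => b.2 < c.2)) => -[i j] [i' j'].
rewrite mem_skew_boxes mem_boxes /box_ne /= => h h'.
case: (ltnP i' i) => //= ii; have := part_antitone sla ii; lia.
Qed.

Section Row.
Variable S : seq (seq nat).
Hypotheses (shS : shape S = skew_shape mu la) (pS : perm_eq (flatten S) (iota 1 n)).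

Lemma row_tableau_entry i j : j < nth 0 la i ->
  entry (row_tableau la) i j = (sumn (take i la) + j).+1.
Proof.
move=> jl; have sh : shape (row_tableau la) = la by rewrite reshapeKl ?size_iota.
have fl : flatten (row_tableau la) = iota 1 (sumn la) by rewrite reshapeKr ?size_iota.
have := nth_flatten 0 (row_tableau la) (flatten_index la i j).
rewrite sh flatten_indexKl // flatten_indexKr // fl nth_iota ?flatten_indexP //.
Qed.

Lemma row_tableau_bound i j : j < nth 0 la i -> entry (row_tableau la) i j <= sumn la.
Proof. by move=> jl; rewrite row_tableau_entry //; apply: (flatten_indexP jl). Qed.

Lemma row_tableau_lt i j i' j' : j < nth 0 la i -> j' < nth 0 la i' -> i < i' ->
  entry (row_tableau la) i j < entry (row_tableau la) i' j'.
Proof.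
move=> jl jl' ii; rewrite !row_tableau_entry // ltnS.
have il : i < size la by rewrite ltnNge; apply: contraL jl => /(nth_default 0) ->.
have : sumn (take i.+1 la) <= sumn (take i' la).
  by rewrite -[in take i' la](subnKC ii) takeD sumn_cat leq_addr.
rewrite (take_nth 0 il) -cats1 sumn_cat /=; lia.
Qed.

Lemma size_rows : size S = size mu.
Proof. by rewrite -[size S](size_map size) -/(shape S) shS size_map size_iota. Qed.

Lemma adjoin_shape : shape (adjoin la S) = mu.
Proof.
apply: (@eq_from_nth _ 0); first by rewrite !size_map size_iota size_rows.
move=> i; rewrite !size_map size_iota size_rows => im.
rewrite nth_shape (nth_map 0) ?size_iota ?size_rows // nth_iota ?size_rows // add0n.
rewrite size_cat size_map -!nth_shape shS nth_skew_shape reshapeKl ?size_iota //.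
by rewrite subnKC // included_nth.
Qed.

Lemma adjoin_entry i j : j < nth 0 mu i -> entry (adjoin la S) i j =
  if j < nth 0 la i then entry (row_tableau la) i j else sumn la + at_box la S (i, j).
Proof.
move=> jm; have im : i < size mu by rewrite ltnNge; apply: contraL jm => /(nth_default 0) ->.
rewrite {1}/entry (nth_map 0) ?size_iota ?size_rows // nth_iota ?size_rows // add0n nth_cat.
have -> : size (nth [::] (row_tableau la) i) = nth 0 la i.
  by rewrite -nth_shape reshapeKl ?size_iota.
case: ltnP => // jl; rewrite /at_box /skew_entry /= ltnNge jl /=.
rewrite (nth_map 0) // -nth_shape shS nth_skew_shape; lia.
Qed.

(** The entries of the strip exceed those of the inner shape, which are in reading
    order: a box of the strip forms an inversion with every box of the inner
    shape below it. *)
Lemma row_inv_adjoin : row_inv (adjoin la S) =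
  pairsum (fun b c => b.1 < c.1) delta (boxes la) +
  pairsum (fun b c => (b.1 < c.1) && (at_box la S c <= at_box la S b)) delta delta.
Proof.
rewrite /row_inv adjoin_shape (count_pairs_perm _ boxes_split) count_pairs_cat.
rewrite [pairsum _ (boxes la) (boxes la)]pairsum0 ?[pairsum _ (boxes la) delta]pairsum0 ?add0n.
- congr (_ + _); apply: eq_pairsum => -[i j] [i' j'] /=.
    rewrite mem_skew_boxes mem_boxes => h h'.
    have := included_nth inc i' => ll; rewrite !adjoin_entry; try lia.
    rewrite h' [j < _]ltnNge (proj1 (andP h)) /=.
    by rewrite (leq_trans (row_tableau_bound h')) ?leq_addr // andbT.
  rewrite !mem_skew_boxes => h h'; rewrite !adjoin_entry; try lia.
  by rewrite ![_ < nth 0 la _]ltnNge (proj1 (andP h)) (proj1 (andP h')) /= leq_add2l.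
- move=> [i j] [i' j'] /=; rewrite mem_boxes mem_skew_boxes => h h'.
  have := included_nth inc i => ll; rewrite !adjoin_entry; try lia.
  rewrite h [j' < _]ltnNge (proj1 (andP h')) /=.
  have := row_tableau_bound h; have : 0 < at_box la S (i', j'); last lia.
  by have := at_box_mem sla smu inc shS pS (b := (i', j')); rewrite mem_skew_boxes h' => /(_ isT) /andP[].
move=> [i j] [i' j'] /=; rewrite !mem_boxes => h h'.
have := included_nth inc i; have := included_nth inc i' => ll ll'; rewrite !adjoin_entry; try lia.
rewrite h h'; case: ltnP => //= ii; apply/negbTE; rewrite -ltnNge.
exact: row_tableau_lt.
Qed.

End Row.

(** A box of the inner shape that is below a box of the strip is also to its
    left. *)
Lemma row_side : pairsum (fun b c => b.1 < c.1) delta (boxes la) = pairsum box_ne (boxes la) delta.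
Proof.
rewrite [RHS]pairsum_swap; apply: eq_pairsum => -[i j] [i' j'].
rewrite mem_skew_boxes mem_boxes /box_ne /= => h h'.
case: (ltnP i i') => //= ii; have := part_antitone sla (ltnW ii); lia.
Qed.

End Boxes.

Lemma chain_right_strict_boxes cs alpha beta : downs cs beta = Some alpha ->
  chain_right_strict cs beta = pairsum box_ne (skew_boxes (tilde beta) (tilde alpha)) (boxes (tilde alpha))
                 + inv_below cs.
Proof.
move=> dd; rewrite (chain_right_strictE dd); congr (_ + _).
rewrite -(col_sum (tilde_sorted alpha) (tilde_sorted beta) (chain_included dd)).
rewrite -(perm_big _ (chain_cols dd)) /= big_map; apply: eq_bigr => b _.
by rewrite /boxes_right; apply: perm_big; rewrite perm_sym tilde_perm.
Qed.

Section Parity.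
Variables (cs alpha beta : seq nat).
Hypothesis chain : downs cs beta = Some alpha.
Let la := tilde alpha.
Let mu := tilde beta.
Let delta := skew_boxes mu la.
Let sla : sorted geq la := tilde_sorted alpha.
Let smu : sorted geq mu := tilde_sorted beta.
Let inc : included la mu := chain_included chain.

(** The pairs of boxes in north-east position with the higher box in the inner
    shape are counted twice.  Those with the lower box in it are inversions by
    [row_side], and those within a horizontal strip are inversions because the
    strip is labelled from left to right. *)
Lemma parity_row : sorted ltn cs ->
  odd (NE la + NE mu + chain_right_strict cs beta) = odd (row_inv (adjoin la (rank_filling la mu snd))).
Proof.
move=> scs; have uc : uniq [seq b.2 | b <- delta].
  by rewrite (perm_uniq (chain_cols chain)); move: scs; rewrite ltn_sorted_uniq_leq => /andP[].
have RS : rank_filling la mu snd \in skew_SYT mu la.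
  apply: (rank_filling_skew sla smu inc uc) => // i j b c.
  by case: (mem_map_inj uc b c erefl); lia.
have kR := @keyed_rank la mu snd; have := RS.
rewrite mem_skew_SYT // => /and3P[/eqP sh pS _].
rewrite (row_inv_adjoin sla smu inc sh pS) (row_side sla) //.
rewrite (NE_split sla smu inc) (chain_right_strict_boxes chain) (inv_below_ltn scs) addn0.
have -> : pairsum (fun b c => (b.1 < c.1) &&
     (at_box la (rank_filling la mu snd) c <= at_box la (rank_filling la mu snd) b)) delta delta
   = pairsum box_ne delta delta.
  rewrite [RHS]pairsum_swap; apply: eq_pairsum => b c bd cd; rewrite /box_ne.
  case: (ltnP b.1 c.1) => //= bc; case: (ltngtP c.2 b.2) => [lt|lt|E].
  - by rewrite ltnW // kR.
  - by apply/negbTE; rewrite -ltnNge kR.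
  by rewrite (mem_map_inj uc cd bd E) ltnn in bc.
rewrite -/la -/mu -/delta; move: (pairsum _ _ _) (pairsum _ _ _) (pairsum _ _ _) (NE la).
by move=> x1 x2 x3 x4; lia.
Qed.

(** On a vertical strip the filling from top to bottom has no inversions within the
    strip, and the pairs of the strip in north-east position cancel against the
    removals of the chain at distinct columns. *)
Lemma parity_col : sorted geq cs ->
  odd (NE la + NE mu + chain_right_strict cs beta) = odd (row_inv (adjoin la (rank_filling la mu fst))).
Proof.
move=> scs; have uc : uniq [seq b.1 | b <- delta] by apply: chain_vertical_rows chain scs.
have RS : rank_filling la mu fst \in skew_SYT mu la.
  apply: (rank_filling_skew sla smu inc uc) => // i j b c.
  by case: (mem_map_inj uc b c erefl); lia.
have kR := @keyed_rank la mu fst; have := RS.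
rewrite mem_skew_SYT // => /and3P[/eqP sh pS _].
rewrite (row_inv_adjoin sla smu inc sh pS) (row_side sla) //.
rewrite (NE_split sla smu inc) (chain_right_strict_boxes chain) (inv_below_geq scs).
have -> : pairsum (fun b c => (b.1 < c.1) &&
     (at_box la (rank_filling la mu fst) c <= at_box la (rank_filling la mu fst) b)) delta delta = 0.
  apply: pairsum0 => b c bd cd; case: (ltnP b.1 c.1) => //= bc.
  by apply/negbTE; rewrite -ltnNge kR.
have -> : \sum_(x <- cs) \sum_(y <- cs) (x < y : nat) = pairsum box_ne delta delta.
  rewrite -(perm_big _ (chain_cols chain)) /= big_map.
  under eq_bigr do rewrite -(perm_big _ (chain_cols chain)) /= big_map.
  apply: (eq_pairsum (P := fun b c => b.2 < c.2)) => -[i j] [i' j'] bd cd; rewrite /box_ne /=.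
  case: (ltnP j j') => jj; rewrite ?andbF // andbT; apply/esym; rewrite ltnNge; apply/negP => ii.
  have bd' : (i', j) \in delta.
    move: bd cd; rewrite !mem_skew_boxes -/la -/mu => h h'; have := part_antitone sla ii; lia.
  by case: (mem_map_inj uc bd' cd erefl); lia.
rewrite -/la -/mu -/delta; move: (pairsum _ _ _) (pairsum _ _ _) (pairsum _ _ _) (NE la).
by move=> x1 x2 x3 x4; lia.
Qed.

Lemma sign_row : sorted ltn cs ->
  oddLR la [:: size cs] mu =
  ((-1) ^+ (NE la + NE mu + chain_right cs beta + (colbinom alpha + colbinom beta)))%R.
Proof.
move=> scs; have uc : uniq [seq b.2 | b <- delta].
  by rewrite (perm_uniq (chain_cols chain)); move: scs; rewrite ltn_sorted_uniq_leq => /andP[].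
rewrite -(chain_size chain) (oddLR_row sla smu inc uc) -GRing.signr_odd -(parity_row scs).
rewrite -[RHS]GRing.signr_odd; congr (_ ^+ (nat_of_bool _))%R.
by have := chain_rightE chain; lia.
Qed.

Lemma sign_col : sorted geq cs ->
  oddLR la (nseq (size cs) 1) mu =
  ((-1) ^+ (NE la + NE mu + chain_right cs beta + (colbinom alpha + colbinom beta)))%R.
Proof.
move=> scs; have uc : uniq [seq b.1 | b <- delta] by apply: chain_vertical_rows chain scs.
rewrite -(chain_size chain) (oddLR_col sla smu inc uc) -GRing.signr_odd -(parity_col scs).
rewrite -[RHS]GRing.signr_odd; congr (_ ^+ (nat_of_bool _))%R.
by have := chain_rightE chain; lia.
Qed.

End Parity.

(** * The Pieri rules *)

Local Open Scope ring_scope.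

Lemma mulrz_sign (R : pzRingType) (x : R) m : x *~ (-1) ^+ m = (-1) ^+ m * x.
Proof. by rewrite -signr_odd -[in RHS]signr_odd; case: odd; rewrite ?mulrN1z ?mulN1r ?mulr1z ?mul1r. Qed.

Lemma eq_sign (R : pzRingType) m p : odd m = odd p -> (-1) ^+ m = (-1) ^+ p :> R.
Proof. by rewrite -signr_odd => ->; rewrite signr_odd. Qed.

(** The two Pieri rules differ in the monotonicity of the chains, in the sign
    [e] of the second factor, and in the way in which a chain is recovered from
    the shapes. *)
Lemma schur_product_chains (k : comPzRingType) (h : bool) alpha n (Q : pred (seq nat))
    (chain : seq nat -> seq nat) (coef : seq nat -> int) e :
  is_comp alpha ->
  (forall b, is_comp b ->
     Q b <-> exists cs, [/\ size cs = n, sorted (chain_rel h) cs & downs cs b = Some alpha]) ->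
  (forall b cs, sorted (chain_rel h) cs -> downs cs b = Some alpha -> chain b = cs) ->
  (forall b cs, size cs = n -> sorted (chain_rel h) cs -> downs cs b = Some alpha ->
     coef b = (-1) ^+ (e + (NE (tilde alpha) + NE (tilde b) + chain_right cs b))) ->
  skew_pi (schur_series k alpha) * ((-1) ^+ e * skew_pi (row_series k h n)) =
  \sum_(b <- compositions (sumn alpha + n) | Q b) OQ_schur k b *~ coef b.
Proof.
move=> ca QP chainE coefE.
rewrite mulrA commr_sign -mulrA (schur_product_expansion k ca (Q := Q) (H := fun b => chain_right (chain b) b)).
- rewrite big_distrr big_seq_cond [RHS]big_seq_cond; apply: eq_bigr => b /andP[].
  rewrite mem_compositions => /andP[cb _] /(QP b cb) [cs [szcs scs dd]].
  by rewrite (coefE b cs szcs scs dd) mulrz_sign /= (chainE b cs scs dd) mulrA -exprD.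
- by move=> b cb _; apply: QP.
by move=> b cs _ _ scs dd; rewrite (chainE b cs).
Qed.

Theorem theorem6p10 (k : comPzRingType) (alpha : seq nat) (n : nat)
    (alpha_comp : is_comp alpha) (n_gt0 : (0 < n)%N) :
  OQ_schur k alpha * OQ_schur k [:: n] =
    \sum_(beta <- compositions (sumn alpha + n)%N
           | horizontal_strip n (tilde beta) (tilde alpha)
             && (row_op (strip_columns (tilde beta) (tilde alpha)) beta
                 == Some alpha))
      OQ_schur k beta *~
        (pieri_sign alpha beta * oddLR (tilde alpha) [:: n] (tilde beta))
  /\
  OQ_schur k alpha * OQ_schur k (nseq n 1%N) =
    \sum_(beta <- compositions (sumn alpha + n)%N
           | vertical_strip n (tilde beta) (tilde alpha)
             && (col_op (strip_columns (tilde beta) (tilde alpha)) beta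
                 == Some alpha))
      OQ_schur k beta *~
        ((-1) ^+ 'C(n, 2) * pieri_sign alpha beta
         * oddLR (tilde alpha) (nseq n 1%N) (tilde beta)).
Proof.
split.
- rewrite (OQ_schurE k alpha_comp) (OQ_schur_row k n_gt0) -[skew_pi (row_series _ _ _)]mul1r.
  apply: (schur_product_chains k (e := 0)
            (chain := fun b => strip_cols (tilde b) (tilde alpha))) => //.
  + by move=> b; apply: horizontal_chain.
  + by move=> b cs scs dd; apply: chain_horizontal dd scs.
  move=> b cs <- scs dd; rewrite (sign_row dd scs) /pieri_sign -exprD; apply: eq_sign.
  by rewrite /colbinom; lia.
rewrite (OQ_schurE k alpha_comp) OQ_schur_col skew_incr_decr.
apply: (schur_product_chains k
          (chain := fun b => rev (strip_cols (tilde b) (tilde alpha)))) => //.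
- by move=> b; apply: vertical_chain.
- by move=> b cs scs dd; apply: chain_vertical dd scs.
move=> b cs <- scs dd; rewrite (sign_col dd scs) /pieri_sign -!exprD; apply: eq_sign.
by rewrite /colbinom; lia.
Qed.
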